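(* Suppose the following conditions hold. (B1) There exist positive constants $\mu,c_1,\lambda_1$ and a positive definite matrix $\dot\Psi_0$ such that $\langle\Psi(\theta_1)-\Psi(\theta_2),\theta_1-\theta_2\rangle\ge\mu\|\theta_1-\theta_2\|^2$ for $\theta_1,\theta_2\in\Theta$, $\|\Psi(\theta)-\Psi(\theta^* )-\dot\Psi_0(\theta-\theta^* )\|\le c_1\|\theta-\theta^*\|^2$ for $\theta\in\Theta$, and $\lambda_{\min}(\dot\Psi_0)\ge\lambda_1$. (B4) There exist a function $h_0:\mathcal{X}\to\mathbb{R}_+$ and a constant $c_4>0$ such that for any $\theta,\theta'\in\Theta$ and each coordinate $j$, $|h_{\theta,j}(X)-h_{\theta',j}(X)|\le h_0(X)\|\theta-\theta'\|$, and $\|h_0(X)\|_{\psi_1}\le c_4$. (B5) With $\xi_i=h_{\theta^*}(X_i)$ and $\Sigma=\mathbb{E}\{\xi_i\xi_i^{\top}\}$, there exist positive constants $c_5,\lambda_2$ such that $\lambda_{\min}(\Sigma)\ge\lambda_2$ and $\|\xi_1\|_{\psi_1}\le c_5$. Let $D_\Theta=\sup_{\theta_1,\theta_2\in\Theta}\|\theta_1-\theta_2\|$ be the diameter of $\Theta$. Then $$\sup_{A\in\mathcal{A}}\bigl|\mathbb{P}\bigl(\sqrt n\,\Sigma^{-1/2}\dot\Psi_0(\hat\theta_n-\theta^* )\in A\bigr)-\mathbb{P}(Z\in A)\bigr|\le C(D_\Theta+1)^2d^{4}n^{-1/2}\log n,$$ where $C>0$ is a constant depending on $c_1,c_4,c_5,\lambda_1,\lambda_2$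 and $\mu$.
   Context: $X,X_1,\dots,X_n$ are i.i.d. random variables taking values in a measurable space $\mathcal{X}$. $\Theta\subset\mathbb{R}^d$ is the parameter space; for each $\theta\in\Theta$, $h_\theta:\mathcal{X}\to\mathbb{R}^d$ with $j$-th coordinate $h_{\theta,j}$. Put $\Psi_n(\theta)=\frac1n\sum_{i=1}^nh_\theta(X_i)$ and $\Psi(\theta)=\mathbb{E}\{h_\theta(X)\}$. $\hat\theta_n,\theta^*\in\Theta$ satisfy $\Psi_n(\hat\theta_n)=0$ and $\Psi(\theta^* )=0$. For a random variable or vector $Y$, the Orlicz norm is $\|Y\|_{\psi_1}=\inf\{C>0:\mathbb{E}\{\psi_1(\|Y\|/C)\}\le1\}$ with $\psi_1(x)=e^x-1$ and $\|\cdot\|$ the Euclidean norm. $\lambda_{\min}$ is the smallest eigenvalue. $\mathcal{A}$ is the collection of all convex sets in $\mathbb{R}^d$, $Z\sim N(0,I_d)$.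
   Formalization: The bound is proved for n ≥ 2 only: for n = 1 the factor log n is 0 and the claim fails (e.g. h_θ(x) = θ − x with X = ±1 equally likely and Θ = [−1,1]). *)

(* Defs.v *)
From HB Require Import structures.
From mathcomp Require Import all_boot all_order all_algebra.
From mathcomp Require Import all_classical all_reals all_analysis.

Set Implicit Arguments.
Unset Strict Implicit.
Unset Printing Implicit Defensive.

Import Order.TTheory GRing.Theory Num.Theory.
Import numFieldNormedType.Exports.

Local Open Scope classical_set_scope.
Local Open Scope ring_scope.

(* The norm that MathComp-Analysis puts on matrices is the sup norm, hence
   the explicit Euclidean norm. *)
Definition dotv {R : realType} {d : nat} (u v : 'cV[R]_d) : R :=
  \sum_(i < d) u i 0 * v i 0.

Definition enorm {R : realType} {d : nat} (u : 'cV[R]_d) : R :=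
  Num.sqrt (dotv u u).

Definition posdef {R : realType} {d : nat} (A : 'M[R]_d) : Prop :=
  A^T = A /\ forall v : 'cV[R]_d, v != 0 -> 0 < dotv v (A *m v).

Definition lambda_min {R : realType} {d : nat} (A : 'M[R]_d) : R :=
  inf [set a : R | eigenvalue A a].

(* A^{-1/2}: the positive definite square root of A^-1. It exists and is
   unique when A is positive definite; the default 0 is junk otherwise. *)
Definition inv_sqrtmx {R : realType} {d : nat} (A : 'M[R]_d) : 'M[R]_d :=
  xget 0 [set S : 'M[R]_d | posdef S /\ S *m S = invmx A].

(* Extended-real valued: +oo for an unbounded set. *)
Definition ediam {R : realType} {d : nat} (S : set 'cV[R]_d) : \bar R :=
  ereal_sup [set (enorm (x - y))%:E | x in S & y in S].

(* Mutual independence of a finite family of random variables; subfamilies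
   are covered by taking B i = setT. *)
Definition mutually_independent {dO dE : measure_display}
    {Omega : measurableType dO} {E : measurableType dE} {R : realType}
    (P : probability Omega R) {I : finType} (Y : I -> {RV P >-> E}) : Prop :=
  forall B : I -> set E, (forall i, measurable (B i)) ->
    (P (\bigcap_(i in [set: I]) (Y i @^-1` B i))
     = \prod_(i : I) P (Y i @^-1` B i))%E.

Definition identically_distributed {dO dE : measure_display}
    {Omega : measurableType dO} {E : measurableType dE} {R : realType}
    (P : probability Omega R) {I : finType} (Y : I -> {RV P >-> E}) : Prop :=
  forall i j (B : set E), measurable B ->
    P (Y i @^-1` B) = P (Y j @^-1` B).

Definition iid {dO dE : measure_display}
    {Omega : measurableType dO} {E : measurableType dE} {R : realType}
    (P : probability Omega R) {I : finType} (Y : I -> {RV P >-> E}) : Prop :=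
  mutually_independent Y /\ identically_distributed Y.

Definition measurable_vec {dT : measure_display} {T : measurableType dT}
    {R : realType} {d : nat} (Y : T -> 'cV[R]_d) : Prop :=
  forall j, measurable_fun [set: T] (fun t => Y t j 0).

(* Junk for the entries that are not integrable. *)
Definition expectation_mx {dO : measure_display} {Omega : measurableType dO}
    {R : realType} (P : probability Omega R) {m k : nat}
    (Y : Omega -> 'M[R]_(m, k)) : 'M[R]_(m, k) :=
  \matrix_(i, j) fine ('E_P[fun w => Y w i j])%E.

(* The Orlicz norm for psi_1(x) = e^x - 1; the infimum of the empty set
   is +oo. *)
Definition psi1 {R : realType} (x : R) : R := expR x - 1.

Definition psi1_norm {dO : measure_display} {Omega : measurableType dO}
    {R : realType} (P : probability Omega R) (Y : Omega -> R) : \bar R :=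
  ereal_inf [set C%:E | C in
    [set C : R | 0 < C /\ ('E_P[fun w => psi1 (`|Y w| / C)] <= 1)%E]].

Definition psi1_norm_vec {dO : measure_display} {Omega : measurableType dO}
    {R : realType} (P : probability Omega R) {d : nat}
    (Y : Omega -> 'cV[R]_d) : \bar R :=
  psi1_norm P (fun w => enorm (Y w)).

Definition rvec {dO : measure_display} {Omega : measurableType dO}
    {R : realType} (P : probability Omega R) {d : nat}
    (Z : 'I_d -> {RV P >-> R}) : Omega -> 'cV[R]_d :=
  fun w => \col_j Z j w.

(* The vector with coordinates Z j has law N(0, I_d). *)
Definition std_normal_vec {dO : measure_display} {Omega : measurableType dO}
    {R : realType} (P : probability Omega R) {d : nat}
    (Z : 'I_d -> {RV P >-> R}) : Prop :=
  mutually_independent Z /\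
  forall j (B : set R), measurable B -> P (Z j @^-1` B) = normal_prob 0 1 B.

(* sup_A |P(W in A) - P'(Z in A)| over convex sets A. A convex set need not
   be Borel: A ranges over those for which both probabilities are defined.
   When W and Z have measurable coordinates this includes every Borel convex
   set. *)
Definition convex_distance {dO dO' : measure_display}
    {Omega : measurableType dO} {Omega' : measurableType dO'} {R : realType}
    (P : probability Omega R) (P' : probability Omega' R) {d : nat}
    (W : Omega -> 'cV[R]_d) (Z : Omega' -> 'cV[R]_d) : \bar R :=
  ereal_sup [set `|P (W @^-1` A) - P' (Z @^-1` A)|%E | A in
    [set A : set 'cV[R]_d | [/\ convex_set A,
      measurable (W @^-1` A) & measurable (Z @^-1` A)]]].

Definition Psi {dO dE : measure_display}
    {Omega : measurableType dO} {E : measurableType dE} {R : realType}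
    (P : probability Omega R) {d : nat} (h : 'cV[R]_d -> E -> 'cV[R]_d)
    (X : {RV P >-> E}) (theta : 'cV[R]_d) : 'cV[R]_d :=
  expectation_mx P (fun w => h theta (X w)).

Definition Psi_n {dO dE : measure_display}
    {Omega : measurableType dO} {E : measurableType dE} {R : realType}
    (P : probability Omega R) {d n : nat} (h : 'cV[R]_d -> E -> 'cV[R]_d)
    (Xs : 'I_n -> {RV P >-> E}) (w : Omega) (theta : 'cV[R]_d) : 'cV[R]_d :=
  n%:R^-1 *: \sum_(i < n) h theta (Xs i w).

(* Main.v *)
(* With W = n^(-1/2) sum_i Sigma^(-1/2) xi_i, the normalized error T equals - W + Delta.
   Exponential moments, a union bound over a grid of mesh 1 / n in Theta and the Lipschitz
   bound control Psi_n - Psi uniformly on Theta, off an event of probability O(1 / n);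
   strong monotonicity then puts the estimator at distance O(sqrt (ln n / n)) of theta_star,
   and the expansion (B1) gives |Delta| = O(ln n / sqrt n). A convex set lies between two
   convex sets, one eroded and one dilated by the size of Delta, whose Gaussian measures
   differ by a multiple of that size, so that it remains to compare W with a Gaussian vector
   over open convex sets. This is done by exchanging the steps of the walk for Gaussian ones,
   Girsanov's formula giving the smoothing, and bounding the Gaussian measure of shells of
   convex sets. No attention is paid to the dependence on d, because
   d lambda2 <= tr Sigma = E |xi|^2 bounds d in terms of c5 and lambda2; likewise the claim
   is trivial unless (D + 1)^2 ln n / sqrt n is small, which bounds the size of the grid. *)

Require Import Defs.
From HB Require Import structures.
From mathcomp Require Import all_boot all_order all_algebra.
From mathcomp Require Import all_classical all_reals all_analysis.
From mathcomp Require Import measurable_realfun.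
From mathcomp Require complex.
From mathcomp Require Import zify ring lra.

Set Implicit Arguments.
Unset Strict Implicit.
Unset Printing Implicit Defensive.

Import Order.TTheory GRing.Theory Num.Theory.
Import numFieldNormedType.Exports.

Local Open Scope classical_set_scope.
Local Open Scope ring_scope.

(** * Vector-valued random variables *)

Section bounded_measurable.
Context {d} {T : measurableType d} {R : realType}.

(** A convex indicator has no smoothness, and smoothing it once at a well-chosen scale would lose
    part of the rate. The comparison is therefore recursive. When the step that follows k walk steps
    is exchanged, the function it acts on is split into the difference between k walk steps and k
    Gaussian ones, bounded by the distance already known at k, and a purely Gaussian part. Matching
    mean and covariance leaves a remainder of order j^(-3/2), where j counts the Gaussian steps
    still available. Summing (k+1)^(-1/2) j^(-3/2) over k gives a multiple of (m n)^(-1/2), m being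
    the number of additional Gaussian steps: a large m, fixed independently of n, closes the
    induction, and removing these m steps costs only a shell of relative width sqrt (m / n). On the
    statistical side the increments of the score are normalised by the distance to [theta_star], so
    that they fluctuate by sqrt (n ln n) times this distance. After localisation the product is of
    order ln n, which keeps the linearisation error logarithmic. *)

Definition bmeas (f : T -> R) :=
  measurable_fun [set: T] f /\ exists M, forall x, `|f x| <= M.

Lemma bmeas_integrable (P : probability T R) (f : T -> R) :
  bmeas f -> P.-integrable [set: T] (EFin \o f).
Proof.
move=> [mf [M fM]]; apply: (@le_integrable _ _ _ _ _ measurableT _ (EFin \o cst M)).
- exact/measurable_EFinP.
- by move=> x _; rewrite /= lee_fin (le_trans (fM x))// ler_norm.
- exact: finite_measure_integrable_cst.
Qed.

Lemma bmeas_cst (c : R) : bmeas (fun=> c).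
Proof. by split; [exact: measurable_cst|exists `|c|]. Qed.

Lemma bmeasB f g : bmeas f -> bmeas g -> bmeas (fun x => f x - g x).
Proof.
move=> [mf [M fM]] [mg [N gN]]; split; first exact: measurable_funB.
by exists (M + N) => x; rewrite (le_trans (ler_normB _ _))// lerD.
Qed.

Lemma bmeasD f g : bmeas f -> bmeas g -> bmeas (fun x => f x + g x).
Proof.
move=> [mf [M fM]] [mg [N gN]]; split; first exact: measurable_funD.
by exists (M + N) => x; rewrite (le_trans (ler_normD _ _))// lerD.
Qed.

Lemma bmeas_indic (A : set T) : measurable A -> bmeas (\1_A : T -> R).
Proof.
move=> mA; split; first exact: measurable_indic.
by exists 1 => x; rewrite ger0_norm ?indicE//; case: (_ \in _).
Qed.

End bounded_measurable.

Lemma bmeas_comp {d d'} {T : measurableType d} {T' : measurableType d'}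
    {R : realType} (f : T' -> R) (g : T -> T') :
  bmeas f -> measurable_fun [set: T] g -> bmeas (f \o g).
Proof.
by move=> [mf [M fM]] mg; split; [exact: measurableT_comp|exists M => x; exact: fM].
Qed.

Section vectors.
Context {R : realType} {d : nat}.
Let coords : 'I_d -> 'cV[R]_d -> R := fun i x => x i 0.

Let vec_set0 : g_sigma_preimage coords set0.
Proof. exact: sigma_algebra0. Qed.
Let vec_setC A : g_sigma_preimage coords A -> g_sigma_preimage coords (~` A).
Proof. exact: sigma_algebraC. Qed.
Let vec_bigcup (F : (set 'cV[R]_d)^nat) : (forall i, g_sigma_preimage coords (F i)) ->
  g_sigma_preimage coords (\bigcup_i (F i)).
Proof. exact: sigma_algebra_bigcup. Qed.

(** The coordinates generate this sigma-algebra, so that a map into vectors is measurable exactly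
    when its components are: this is [measurable_vec]. *)
HB.instance Definition _ := @isMeasurable.Build default_measure_display
  'cV[R]_d (g_sigma_preimage coords) vec_set0 vec_setC vec_bigcup.

Lemma measurable_coord (i : 'I_d) :
  measurable_fun [set: 'cV[R]_d] (fun x : 'cV[R]_d => x i 0).
Proof.
move=> _ Y mY; rewrite setTI; apply: sub_sigma_algebra => /=.
rewrite -bigcup_seq/=; exists i => /=; first by rewrite mem_index_enum.
by exists Y => //; rewrite setTI.
Qed.

Definition box (B : 'I_d -> set R) : set 'cV[R]_d := [set x | forall i, B i (x i 0)].

Lemma measurable_box (B : 'I_d -> set R) :
  (forall i, measurable (B i)) -> measurable (box B).
Proof.
move=> mB; rewrite (_ : box B = \bigcap_(i in [set: 'I_d]) ((fun x : 'cV[R]_d => x i 0) @^-1` B i)).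
  apply: fin_bigcap_measurable => // i _.
  by rewrite -[X in measurable X]setTI; exact: measurable_coord.
by apply/seteqP; split => x /= h i; [move=> _|]; exact: h.
Qed.

(** Boxes, unlike cylinders over a single coordinate, are stable under intersection, as the
    uniqueness theorem for measures requires. *)
Lemma measurable_vecE : @measurable _ 'cV[R]_d =
  <<s [set A | exists2 B, (forall i, measurable (B i)) & A = box B] >>.
Proof.
apply/seteqP; split.
  apply: smallest_sub; first exact: smallest_sigma_algebra.
  rewrite -bigcup_seq; apply: bigcup_sub => i _ A [B mB <-].
  apply: sub_sigma_algebra; exists (fun j => if j == i then B else setT).
    by move=> j; case: ifP.
  apply/seteqP; split => x /=.
    by move=> [_ Bx] j; case: eqP => [->|].
  by move=> /(_ i); rewrite eqxx.
apply: smallest_sub; first exact: sigma_algebra_measurable.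
by move=> _ [B mB ->]; exact: measurable_box.
Qed.

Lemma measurable_vecP {d'} {T : measurableType d'} (f : T -> 'cV[R]_d) :
  measurable_fun [set: T] f <-> measurable_vec f.
Proof.
split => [mf j|mf].
  exact: (measurableT_comp (measurable_coord j) mf).
apply: (measurability _ measurable_vecE) => _ [_ [B mB ->] <-].
rewrite (_ : _ @^-1` _ = \bigcap_(i in [set: 'I_d]) ((fun t => f t i 0) @^-1` B i)).
  apply: measurableI => //; apply: fin_bigcap_measurable => // i _.
  by rewrite -[X in measurable X]setTI; exact: mf.
by apply/seteqP; split => x /= h i; [move=> _|]; exact: h.
Qed.

Lemma eq_vec_measure (m1 m2 : probability 'cV[R]_d R) :
  (forall B, (forall i, measurable (B i)) -> m1 (box B) = m2 (box B)) ->
  forall A, measurable A -> m1 A = m2 A.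
Proof.
move=> m12; apply: (measure_unique _ (fun=> setT) measurable_vecE).
- move=> _ _ [B mB ->] [C mC ->]; exists (fun i => B i `&` C i).
    by move=> i; exact: measurableI.
  by apply/seteqP; split => x /=; [move=> [a b] i; split|move=> a; split => i; case: (a i)].
- by move=> _; exists (fun=> setT) => //; apply/seteqP; split.
- by apply/seteqP; split => // x _; exists 0.
- by move=> _ [B mB ->]; exact: m12.
- by move=> _; apply: (le_lt_trans (probability_le1 m1 measurableT)); exact: ltry.
Qed.

End vectors.

Lemma integral_cst_probability {d} {T : measurableType d} {R : realType}
    (P : probability T R) (c : \bar R) : (\int[P]_x c = c)%E.
Proof. by rewrite -[RHS]mule1 -(probability_setT P) -integral_cst. Qed.

Lemma Rintegral_cst_probability {d} {T : measurableType d} {R : realType}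
    (P : probability T R) (c : R) : \int[P]_x c = c.
Proof. by rewrite /Rintegral integral_cst_probability. Qed.

(** * Measures with a density *)

Section density.
Local Open Scope ereal_scope.
Context {d} {T : measurableType d} {R : realType}.
Variables (mu nu : {measure set T -> \bar R}) (g : T -> R).
Hypotheses (mg : measurable_fun [set: T] g) (g0 : forall x, (0 <= g x)%R).
Hypothesis nuE : forall A, measurable A -> nu A = \int[mu]_(x in A) (g x)%:E.
Import HBNNSimple.

(** By monotone convergence it suffices to treat simple functions, where [nuE] applies to each level
    set. *)
Lemma integral_density (f : T -> \bar R) : (forall x, 0 <= f x) ->
  measurable_fun [set: T] f -> \int[nu]_x f x = \int[mu]_x (f x * (g x)%:E).
Proof.
move=> f0 mf; pose h := nnsfun_approx measurableT mf.
have mEg : measurable_fun [set: T] (EFin \o g) by exact/measurable_EFinP.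
have fE x : f x = lim ((EFin \o h n) x @[n --> \oo]).
  by apply/esym/cvg_lim => //; exact: cvg_nnsfun_approx.
have -> : \int[nu]_x f x = lim (\int[nu]_x (EFin \o h n) x @[n --> \oo]).
  under eq_integral => x _ do rewrite fE.
  apply: monotone_convergence => //.
  - by move=> n; apply/measurable_EFinP; exact/measurable_funP.
  - by move=> n x _ //=; rewrite lee_fin.
  - by move=> x _ a b ab; rewrite lee_fin; exact/lefP/nd_nnsfun_approx.
have -> : \int[mu]_x (f x * (g x)%:E) =
    lim (\int[mu]_x ((EFin \o h n) \* (EFin \o g)) x @[n --> \oo]).
  have fg x : f x * (g x)%:E = lim (((EFin \o h n) \* (EFin \o g)) x @[n --> \oo]).
    by apply/esym/cvg_lim => //; apply: cvgeZr => //; exact: cvg_nnsfun_approx.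
  under eq_integral => x _ do rewrite fg.
  apply: monotone_convergence => //.
  - by move=> n; apply/emeasurable_funM => //; exact/measurable_EFinP.
  - by move=> n x _ /=; rewrite mule_ge0 ?lee_fin.
  - by move=> x _ a b ab/=; rewrite lee_wpmul2r ?lee_fin//; exact/lefP/nd_nnsfun_approx.
suff suf n : \int[mu]_x ((EFin \o h n) x * (EFin \o g) x) = \int[nu]_x (EFin \o h n) x.
  by congr (lim (_ @ \oo)); apply/funext => n; exact/esym/suf.
have indich m r : measurable_fun [set: T] (fun x => (r * \1_(h m @^-1` [set r]) x)%:E).
  by apply: (measurable_comp measurableT) => //; exact: measurable_funM.
transitivity (\int[nu]_x
   (\sum_(y \in range (h n)) (y * \1_(h n @^-1` [set y]) x)%:E)); last first.
  by apply: eq_integral => t tE; rewrite /= fimfunE -fsumEFin.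
rewrite ge0_integral_fsum//; last by move=> m y Ey; exact: nnfun_muleindic_ge0.
transitivity (\int[mu]_x (\sum_(y \in range (h n))
    (y * \1_(h n @^-1` [set y]) x)%:E * (g x)%:E)).
  under [RHS]eq_integral => x xE.
    rewrite -ge0_mule_fsuml => [|y]; last exact: nnfun_muleindic_ge0.
    rewrite fsumEFin // -(fimfunE _ x); over.
  by [].
rewrite ge0_integral_fsum//; last 2 first.
  - by move=> y; apply: emeasurable_funM.
  - move=> m y Ey; apply: mule_ge0; last by rewrite lee_fin.
    exact: nnfun_muleindic_ge0.
apply: eq_fsbigr => r rhn.
under [RHS]eq_integral do rewrite EFinM.
rewrite integralZl_indic_nnsfun => //.
under eq_integral do rewrite EFinM -muleA.
have r0 : (0 <= r)%R by move: rhn; rewrite inE => -[x _ <-].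
rewrite ge0_integralZl//.
- under eq_integral do rewrite muleC.
  rewrite (eq_integral ((EFin \o g) \_ (h n @^-1` [set r]))); last first.
    by move=> x xE; rewrite epatch_indic.
  by rewrite -integral_mkcond /= -nuE// integral_indic// setIT.
- by apply: emeasurable_funM => //; exact/measurable_EFinP.
- by move=> t _; rewrite mule_ge0 ?lee_fin.
Qed.

End density.

Section density_measure.
Local Open Scope ereal_scope.
Context {d} {T : measurableType d} {R : realType}.
Variables (mu : {measure set T -> \bar R}) (g : T -> R).
Hypotheses (mg : measurable_fun [set: T] g) (g0 : forall x, (0 <= g x)%R).
Hypothesis g1 : \int[mu]_x (g x)%:E = 1.

(** The proofs of measurability, positivity and total mass 1 are arguments, so that the measure and
    probability structures can be attached to the term itself. *)
Definition density_measure & measurable_fun [set: T] g & (forall x, (0 <= g x)%R)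
    & \int[mu]_x (g x)%:E = 1 : set T -> \bar R :=
  fun A => \int[mu]_(x in A) (g x)%:E.

Let dm := density_measure mg g0 g1.
Let dm0 : dm set0 = 0. Proof. exact: integral_set0. Qed.
Let dm_ge0 A : 0 <= dm A.
Proof. by apply: integral_ge0 => x _; rewrite lee_fin. Qed.
Let dm_sigma_additive : semi_sigma_additive dm.
Proof.
apply: (@semi_sigma_additive_nng_induced _ _ _ mu (EFin \o g)).
  exact/measurable_EFinP.
by move=> x; rewrite lee_fin.
Qed.
HB.instance Definition _ := isMeasure.Build _ _ _ dm dm0 dm_ge0 dm_sigma_additive.
Let dm_setT : dm [set: T] = 1. Proof. exact: g1. Qed.
HB.instance Definition _ := @Measure_isProbability.Build _ _ R dm dm_setT.

Definition density_probability : probability T R := dm.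

Lemma density_probabilityE A : density_probability A = \int[mu]_(x in A) (g x)%:E.
Proof. by []. Qed.

End density_measure.

Section real_fubini.
Context {d1 d2} {T1 : measurableType d1} {T2 : measurableType d2} {R : realType}.
Variables (P1 : probability T1 R) (P2 : probability T2 R).

Lemma bmeas_integral (f : T1 * T2 -> R) :
  bmeas f -> bmeas (fun x => \int[P2]_y f (x, y)).
Proof.
move=> bf; have [mf [M fM]] := bf.
have bfx x : bmeas (fun y => f (x, y)).
  split; last by exists M.
  by apply: measurableT_comp => //; exact: pair1_measurable.
split.
  apply: (@measurableT_comp _ _ _ _ _ _ (@fine R)) => //.
  have bi : ((P1 \x P2)%E : probability _ R).-integrable [set: T1 * T2] (EFin \o f).
    exact: bmeas_integrable.
  exact: (measurable_fubini_F bi).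
exists M => x; rewrite (le_trans (le_normr_Rintegral _ _))//.
  exact: (bmeas_integrable P2 (bfx x)).
rewrite -[leRHS](Rintegral_cst_probability P2); apply: le_Rintegral => //.
- apply: (bmeas_integrable P2); split; last by exists M => y; rewrite normr_id.
  by apply: measurableT_comp => //; exact: (bfx x).1.
- exact: finite_measure_integrable_cst.
Qed.

Lemma real_fubini (f : T1 * T2 -> R) : bmeas f ->
  \int[P1]_x \int[P2]_y f (x, y) = \int[P2]_y \int[P1]_x f (x, y).
Proof.
move=> bf; have [mf [M fM]] := bf.
have bi : ((P1 \x P2)%E : probability _ R).-integrable [set: T1 * T2] (EFin \o f).
  exact: bmeas_integrable.
have bfx x : bmeas (fun y => f (x, y)).
  split; last by exists M.
  by apply: measurableT_comp => //; exact: pair1_measurable.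
have bfy y : bmeas (fun x => f (x, y)).
  split; last by exists M.
  by apply: measurableT_comp => //; exact: pair2_measurable.
rewrite /Rintegral; congr fine.
transitivity (\int[P1]_x \int[P2]_y (f (x, y))%:E)%E.
  apply: eq_integral => x _; rewrite fineK//.
  exact: (integrable_fin_num measurableT (bmeas_integrable P2 (bfx x))).
rewrite (Fubini bi); apply: eq_integral => y _; rewrite fineK//.
exact: (integrable_fin_num measurableT (bmeas_integrable P1 (bfy y))).
Qed.

End real_fubini.

(** * Independence and sums of independent vectors *)

Definition law {dO dT} {Omega : measurableType dO} {T : measurableType dT}
    {R : realType} (P : probability Omega R) (f : Omega -> T)
    (mf : measurable_fun [set: Omega] f) : probability T R :=
  distribution P (mfun_Sub (mem_set mf)).

Lemma lawE {dO dT} {Omega : measurableType dO} {T : measurableType dT}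
    {R : realType} (P : probability Omega R) (f : Omega -> T)
    (mf : measurable_fun [set: Omega] f) A : law P mf A = P (f @^-1` A).
Proof. by []. Qed.

Lemma ge0_integral_law {dO dT} {Omega : measurableType dO} {T : measurableType dT}
    {R : realType} (P : probability Omega R) (f : Omega -> T)
    (mf : measurable_fun [set: Omega] f) (F : T -> \bar R) :
  measurable_fun [set: T] F -> (forall x, 0 <= F x)%E ->
  (\int[law P mf]_x F x = \int[P]_w F (f w))%E.
Proof.
by move=> mF F0; rewrite (ge0_integral_distribution (mfun_Sub (mem_set mf))).
Qed.

Lemma Rintegral_law {dO dT} {Omega : measurableType dO} {T : measurableType dT}
    {R : realType} (P : probability Omega R) (f : Omega -> T)
    (mf : measurable_fun [set: Omega] f) (F : T -> R) : bmeas F ->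
  \int[law P mf]_x F x = \int[P]_w F (f w).
Proof.
move=> bF; rewrite /Rintegral (integral_distribution (X := mfun_Sub (mem_set mf)))//.
  by apply/measurable_EFinP; exact: bF.1.
exact: (bmeas_integrable P (bmeas_comp bF mf)).
Qed.

Section sequential_independence.
Local Open Scope ereal_scope.
Context {dO dE dT} {Omega : measurableType dO} {E : measurableType dE}
  {T : measurableType dT} {R : realType} {P : probability Omega R} {n : nat}.
Variables (Y : 'I_n -> {RV P >-> E}) (g : 'I_n -> T * E -> T)
  (S : nat -> Omega -> T) (t0 : T).
Hypotheses (iY : mutually_independent Y)
  (mg : forall i, measurable_fun [set: T * E] (g i))
  (S0 : S 0 = cst t0)
  (SS : forall (i : 'I_n) w, S i.+1 w = g i (S i w, Y i w)).

Lemma measurable_sequential k : (k <= n)%N -> measurable_fun [set: Omega] (S k).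
Proof.
elim: k => [_|k IH kn]; first by rewrite S0; exact: measurable_cst.
rewrite (_ : S k.+1 = g (Ordinal kn) \o (fun w => (S k w, Y (Ordinal kn) w))).
  apply: measurableT_comp => //; apply: measurable_fun_pair => //.
  exact/IH/ltnW.
by apply/funext => w; rewrite (SS (Ordinal kn)).
Qed.

Let tail k (B : 'I_n -> set E) := \bigcap_(i in [set i : 'I_n | (k <= i)%N]) (Y i @^-1` B i).

Let mpre (i : 'I_n) B : measurable B -> measurable (Y i @^-1` B).
Proof. by move=> mB; rewrite -[X in measurable X]setTI; exact: measurable_funP. Qed.

Let mtail k B : (forall i, measurable (B i)) -> measurable (tail k B).
Proof. by move=> mB; apply: fin_bigcap_measurable => // i _; exact: mpre. Qed.

(** [S k] is built from the first k variables only. The induction needs its independence from all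
    later variables together, since the step to [S k.+1] consumes one of them and must keep the
    others free. *)
Lemma sequential_independent_tail k (C : set T) (B : 'I_n -> set E) :
  (k <= n)%N -> measurable C -> (forall i, measurable (B i)) ->
  P (S k @^-1` C `&` tail k B) = P (S k @^-1` C) * \prod_(i < n | (k <= i)%N) P (Y i @^-1` B i).
Proof.
elim: k C B => [|k IH] C B kn mC mB.
  have -> : tail 0 B = \bigcap_(i in [set: 'I_n]) (Y i @^-1` B i).
    by apply/seteqP; split => x /= h i _; exact: h.
  rewrite S0 preimage_cst; case: ifP => _.
    by rewrite setTI probability_setT mul1e iY.
  by rewrite set0I measure0 mul0e.
have kn' := ltnW kn; pose i0 : 'I_n := Ordinal kn.
have mSY : measurable_fun [set: Omega] (fun w => (S k w, Y i0 w)).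
  by apply: measurable_fun_pair => //; exact: measurable_sequential.
have mSk := measurable_sequential kn'.
pose q (B' : 'I_n -> set E) := fine (\prod_(i < n | (k < i)%N) P (Y i @^-1` B' i)).
have qE B' : (forall i, measurable (B' i)) ->
    (q B')%:E = \prod_(i < n | (k < i)%N) P (Y i @^-1` B' i).
  move=> mB'; rewrite fineK//; apply: (big_ind (fun x => x \is a fin_num)) => //.
    by move=> ? ? ? ?; rewrite fin_numM.
  by move=> i _; apply: fin_num_measure; exact: mpre.
have q0 B' : (0 <= q B')%R.
  by apply: fine_ge0; apply: (big_ind (fun x => 0 <= x)) => // *; rewrite ?mule_ge0.
(* The law of the pair restricted to a tail event is a multiple of a product measure. Rectangles
   reduce this to the induction hypothesis, where the constraint on [Y i0] joins the tail. *)
have key B' D : (forall i, measurable (B' i)) -> measurable D ->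
    P ((fun w => (S k w, Y i0 w)) @^-1` D `&` tail k.+1 B') =
    (q B')%:E * (law P mSk \x law P (measurable_funP (Y i0))) D.
  move=> mB' mD; pose mF := mtail k.+1 mB'.
  pose m1 : {measure set (T * E) -> \bar R} :=
    pushforward (mrestr P mF) (fun w => (S k w, Y i0 w)).
  pose m2 : {measure set (T * E) -> \bar R} :=
    mscale (NngNum (q0 B')) (law P mSk \x law P (measurable_funP (Y i0)))%E.
  change (m1 mSY D = m2 D).
  apply: (measure_unique [set A `*` B | A in @measurable _ T & B in @measurable _ E]
    (fun=> setT)) => //.
  - exact: measurable_prod_measurableType.
  - move=> _ _ [A1 mA1 [A2 mA2 <-]] [A3 mA3 [A4 mA4 <-]].
    exists (A1 `&` A3); first exact: measurableI.
    by exists (A2 `&` A4); [exact: measurableI|rewrite setXI].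
  - by move=> _; exists setT => //; exists setT => //; rewrite setXTT.
  - by apply/seteqP; split => // x _; exists 0%N.
  - move=> _ [A1 mA1 [A2 mA2 <-]].
    have -> : m2 (A1 `*` A2) = (q B')%:E * (P (S k @^-1` A1) * P (Y i0 @^-1` A2)).
      by rewrite -[P (S k @^-1` A1)](lawE P mSk) -[P (Y i0 @^-1` A2)](lawE P (measurable_funP (Y i0))) -product_measure1E.
    change (P ((fun w => (S k w, Y i0 w)) @^-1` (A1 `*` A2) `&` tail k.+1 B') =
      (q B')%:E * (P (S k @^-1` A1) * P (Y i0 @^-1` A2))).
    pose B'' i := if i == i0 then A2 else B' i.
    rewrite (_ : _ `&` _ = S k @^-1` A1 `&` tail k B''); last first.
      apply/seteqP; split => w /=.
        move=> [[h1 h2] h3]; split => // i /=; rewrite leq_eqVlt => /orP[/eqP ki|ki].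
          by rewrite /B''; have -> : i = i0 by [apply/val_inj]; rewrite eqxx.
        rewrite /B'' ifF; first exact: h3.
        by apply/negbTE; apply: contraTN ki => /eqP ->; rewrite ltnn.
      move=> [h1 h3]; split.
        by split => //; have := h3 i0; rewrite /B'' /= eqxx; apply.
      move=> i /= ki; have := h3 i; rewrite /B'' /= ifF; first by apply; exact: ltnW.
      by apply/negbTE; apply: contraTN ki => /eqP ->; rewrite ltnn.
    rewrite IH//; last by move=> i; rewrite /B''; case: ifP.
    rewrite qE// (bigD1 i0)//= {1}/B'' eqxx [RHS]muleC -muleA; congr (_ * (_ * _)).
    apply: eq_big => [i|i /andP[_ /negbTE ii0]].
      by rewrite ltn_neqAle andbC eq_sym.
    by rewrite /B'' ii0.
  - move=> _; apply: (@le_lt_trans _ _ (P setT)); last by rewrite probability_setT ltry.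
    apply: le_measure; rewrite ?inE//.
    by apply: measurableI => //; rewrite preimage_setT.
have SkE : S k.+1 @^-1` C = (fun w => (S k w, Y i0 w)) @^-1` (g i0 @^-1` C).
  by apply/seteqP; split => w /=; rewrite -(SS i0).
have mgC : measurable (g i0 @^-1` C).
  by rewrite -[X in measurable X]setTI; exact: mg.
rewrite SkE key// qE// muleC; congr (_ * _).
(* A trivial tail identifies the product-measure factor as the probability that [S k.+1] lies in
   C. *)
have := @key (fun=> setT) _ (fun=> measurableT) mgC.
rewrite (_ : tail _ _ = setT) ?setIT; last by apply/seteqP; split.
move=> ->; rewrite qE// big1 ?mul1e// => i _.
by rewrite preimage_setT probability_setT.
Qed.

Lemma sequential_independent (i : 'I_n)
    (mSi : measurable_fun [set: Omega] (S i))
    (mSY : measurable_fun [set: Omega] (fun w => (S i w, Y i w))) :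
  forall D, measurable D ->
  law P mSY D = (law P mSi \x law P (measurable_funP (Y i))) D.
Proof.
move=> D mD; apply/esym; apply: (@product_measure_unique _ _ _ _ _ (law P mSi) (law P (measurable_funP (Y i))) (law P mSY)) => //.
move=> A B mA mB.
change (P ((fun w => (S i w, Y i w)) @^-1` (A `*` B)) = P (S i @^-1` A) * P (Y i @^-1` B)).
have := @sequential_independent_tail i A (fun j => if j == i then B else setT)
  (ltnW (ltn_ord i)) mA.
rewrite (bigD1 i)//= eqxx big1 ?mule1; last first.
  by move=> j /andP[_ /negbTE ->]; rewrite preimage_setT probability_setT.
move=> <-; last by move=> j; case: ifP.
congr (P _); apply/seteqP; split => w /= [h1 h2]; split => //.
  by move=> j /= _; case: eqP => [->|].
by have := h2 i; rewrite /= eqxx; apply.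
Qed.

End sequential_independence.

Section expectation_prod.
Local Open Scope ereal_scope.
Context {dO dE} {Omega : measurableType dO} {E : measurableType dE}
  {R : realType} {P : probability Omega R} {n : nat}.
Variables (Y : 'I_n -> {RV P >-> E}) (f : 'I_n -> E -> R).
Hypotheses (iY : mutually_independent Y)
  (mf : forall i, measurable_fun [set: E] (f i))
  (f0 : forall i x, (0 <= f i x)%R).

(** Partial products form a sequential process, so the last factor splits off by Tonelli's
    theorem. *)
Lemma expectation_prod_independent :
  \int[P]_w (\prod_(i < n) f i (Y i w))%:E = \prod_(i < n) \int[P]_w (f i (Y i w))%:E.
Proof.
pose S k w := (\prod_(i < n | (i < k)%N) f i (Y i w))%R.
pose g (i : 'I_n) (z : R * E) := (z.1 * f i z.2)%R.
have mg i : measurable_fun [set: R * E] (g i).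
  by apply: measurable_funM => //; exact: measurableT_comp.
have S0 : S 0%N = cst 1%R by apply/funext => w; rewrite /S big_pred0.
have SS (i : 'I_n) w : S i.+1 w = g i (S i w, Y i w).
  rewrite /S /g /= (bigD1 i) ?ltnSn//= mulrC; congr (_ * _)%R.
  by apply: eq_bigl => j; rewrite ltnS [RHS]ltn_neqAle andbC.
have S_ge0 k w : (0 <= S k w)%R by exact: prodr_ge0.
suff H k : (k <= n)%N ->
    \int[P]_w (S k w)%:E = \prod_(i < n | (i < k)%N) \int[P]_w (f i (Y i w))%:E.
  transitivity (\int[P]_w (S n w)%:E).
    by apply: eq_integral => w _; congr (_%:E); apply: eq_bigl => i; rewrite ltn_ord.
  by rewrite H//; apply: eq_bigl => i; rewrite ltn_ord.
elim: k => [_|k IH kn].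
  rewrite (eq_integral (cst 1)); last by move=> w _; rewrite S0.
  by rewrite integral_cst_probability big_pred0.
have mSk := measurable_sequential mg S0 SS (ltnW kn).
pose i0 : 'I_n := Ordinal kn.
have mSY : measurable_fun [set: Omega] (fun w => (S i0 w, Y i0 w)).
  exact: measurable_fun_pair.
(* The absolute value makes F nonnegative everywhere, as Tonelli's theorem asks; on the values of
   [S], which are nonnegative, it changes nothing. *)
pose F (z : R * E) : \bar R := (`|z.1| * f i0 z.2)%:E.
have mF : measurable_fun [set: R * E] F.
  apply/measurable_EFinP; apply: measurable_funM => //; exact: measurableT_comp.
have F0 z : 0 <= F z by rewrite lee_fin mulr_ge0.
transitivity (\int[P]_w F (S i0 w, Y i0 w)).
  apply: eq_integral => w _; rewrite (SS i0) /g /F /= ger0_norm//.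
rewrite -(ge0_integral_law P mSY mF F0).
transitivity (\int[(law P mSk \x law P (measurable_funP (Y i0)))]_z F z).
  apply: eq_measure_integral => A mA _.
  exact: (sequential_independent iY mg S0 SS (i := i0) mSk mSY mA).
rewrite fubini_tonelli1// /fubini_F.
have mfi : measurable_fun [set: E] (EFin \o f i0) by exact/measurable_EFinP.
have f0i x : 0 <= (EFin \o f i0) x by rewrite /= lee_fin.
transitivity (\int[law P mSk]_s (`|s|%:E * \int[P]_w (f i0 (Y i0 w))%:E)).
  apply: eq_integral => s _; rewrite -(ge0_integral_law P (measurable_funP (Y i0)) mfi f0i).
  by rewrite -ge0_integralZl.
have mabs : measurable_fun [set: R] (fun s : R => `|s|%:E).
  by apply/measurable_EFinP; exact: normr_measurable.
have fi_ge0 : 0 <= \int[P]_w (f i0 (Y i0 w))%:E.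
  by apply: integral_ge0 => w _; rewrite lee_fin.
rewrite ge0_integralZr// ge0_integral_law//.
under eq_integral do rewrite ger0_norm//.
rewrite (IH (ltnW kn)) [RHS](bigD1 i0) ?ltnSn//= muleC; congr (_ * _).
by apply: eq_bigl => j; rewrite ltnS [LHS]ltn_neqAle andbC.
Qed.

End expectation_prod.

(** * Convolution operators of random steps *)

Section translation_operator.
Context {R : realType} {d : nat}.
Local Notation V := 'cV[R]_d.
Implicit Types (mu nu : probability V R) (f : V -> R).

Lemma measurable_addv (x : V) : measurable_fun [set: V] (fun y : V => x + y).
Proof.
apply/measurable_vecP => j; under eq_fun do rewrite mxE.
by apply: measurable_funD => //; exact: measurable_coord.
Qed.

Lemma measurable_addv2 : measurable_fun [set: V * V] (fun z : V * V => z.1 + z.2).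
Proof.
apply/measurable_vecP => j; under eq_fun do rewrite mxE.
by apply: measurable_funD => //; (apply: (measurableT_comp (measurable_coord j))).
Qed.

Lemma measurable_scalev (c : R) : measurable_fun [set: V] (fun y : V => c *: y).
Proof.
apply/measurable_vecP => j; under eq_fun do rewrite mxE.
by apply: measurable_funM => //; exact: measurable_coord.
Qed.

(** The Markov operator of one random-walk step with law mu. These operators commute with each other
    and with translations, which turns the exchange of steps into algebra on iterates. *)
Definition transl mu f : V -> R := fun x => \int[mu]_y f (x + y).

Lemma bmeas_transl mu f : bmeas f -> bmeas (transl mu f).
Proof.
move=> bf; apply: (@bmeas_integral _ _ _ _ _ mu mu (fun z : V * V => f (z.1 + z.2))).
exact: (bmeas_comp bf measurable_addv2).
Qed.

Lemma translC mu nu f : bmeas f -> transl mu (transl nu f) = transl nu (transl mu f).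
Proof.
move=> bf; apply/funext => x; rewrite /transl.
rewrite (@real_fubini _ _ _ _ _ mu nu (fun z : V * V => f (x + z.1 + z.2))).
  by apply: eq_Rintegral => y _; apply: eq_Rintegral => z _; rewrite addrAC.
apply: (bmeas_comp bf (g := fun z : V * V => x + z.1 + z.2)).
under eq_fun do rewrite -addrA.
exact: (measurableT_comp (measurable_addv x) measurable_addv2).
Qed.

Lemma bmeas_shift f (x : V) : bmeas f -> bmeas (fun y => f (x + y)).
Proof. by move=> bf; exact: (bmeas_comp bf (measurable_addv x)). Qed.

Lemma transl_shift mu f (a x : V) : transl mu (fun y => f (a + y)) x = transl mu f (a + x).
Proof. by apply: eq_Rintegral => y _; rewrite addrA. Qed.

Lemma translB mu f g : bmeas f -> bmeas g ->
  transl mu (fun x => f x - g x) = fun x => transl mu f x - transl mu g x.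
Proof.
move=> bf bg; apply/funext => x; rewrite /transl RintegralB//.
- exact: (bmeas_integrable mu (bmeas_shift x bf)).
- exact: (bmeas_integrable mu (bmeas_shift x bg)).
Qed.

Lemma Rintegral_bound {dT} {T : measurableType dT} (P : probability T R) (f : T -> R) M :
  measurable_fun [set: T] f -> (forall x, `|f x| <= M) -> `|\int[P]_x f x| <= M.
Proof.
move=> mf fM; have bf : bmeas f by split => //; exists M.
rewrite (le_trans (le_normr_Rintegral _ _))//; first exact: (bmeas_integrable P bf).
rewrite -[leRHS](Rintegral_cst_probability P); apply: le_Rintegral => //.
- apply: (bmeas_integrable P); split; last by exists M => y; rewrite normr_id.
  exact: measurableT_comp.
- exact: finite_measure_integrable_cst.
Qed.

Lemma transl_bound mu f M : measurable_fun [set: V] f -> (forall x, `|f x| <= M) ->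
  forall x, `|transl mu f x| <= M.
Proof.
move=> mf fM x; apply: Rintegral_bound => //.
exact: (measurableT_comp mf (measurable_addv x)).
Qed.

Lemma bmeas_iter mu k f : bmeas f -> bmeas (iter k (transl mu) f).
Proof. by move=> bf; elim: k => [//|k IH]; rewrite iterS; exact: bmeas_transl. Qed.

Lemma iter_translC mu nu k f : bmeas f ->
  iter k (transl mu) (transl nu f) = transl nu (iter k (transl mu) f).
Proof.
by move=> bf; elim: k => [//|k IH]; rewrite !iterS IH translC//; exact: bmeas_iter.
Qed.

Lemma iter2_translC mu nu j k f : bmeas f ->
  iter k (transl mu) (iter j (transl nu) f) = iter j (transl nu) (iter k (transl mu) f).
Proof.
move=> bf; elim: j => [//|j IH]; rewrite !iterS iter_translC ?IH//.
exact: bmeas_iter.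
Qed.

Lemma iter_transl_shift mu k f (a x : V) :
  iter k (transl mu) (fun y => f (a + y)) x = iter k (transl mu) f (a + x).
Proof.
elim: k x => [//|k IH] x; rewrite !iterS -transl_shift; congr (transl mu _ x).
exact/funext.
Qed.

Lemma iter_translB mu k f g : bmeas f -> bmeas g ->
  iter k (transl mu) (fun x => f x - g x) =
  fun x => iter k (transl mu) f x - iter k (transl mu) g x.
Proof.
move=> bf bg; elim: k => [//|k IH].
by rewrite !iterS IH translB//; exact: bmeas_iter.
Qed.

End translation_operator.

Section sum_independent.
Context {R : realType} {d : nat} {dO dE} {Omega : measurableType dO}
  {E : measurableType dE} {P : probability Omega R} {n : nat}.
Local Notation V := 'cV[R]_d.
Variables (Y : 'I_n -> {RV P >-> E}) (phi : E -> V) (mu : probability V R).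
Hypotheses (iY : mutually_independent Y) (mphi : measurable_fun [set: E] phi)
  (muE : forall i A, measurable A -> P ((fun w => phi (Y i w)) @^-1` A) = mu A).

(** The last step is integrated out first and absorbed into the test function, which is why the
    induction quantifies over G. *)
Lemma expectation_sum_independent (F : V -> R) x : bmeas F ->
  \int[P]_w F (x + \sum_(i < n) phi (Y i w)) = iter n (transl mu) F x.
Proof.
pose S k w := \sum_(i < n | (i < k)%N) phi (Y i w).
pose g (i : 'I_n) (z : V * E) := z.1 + phi z.2.
have mg i : measurable_fun [set: V * E] (g i).
  apply: (@measurableT_comp _ _ _ _ _ _ (fun z : V * V => z.1 + z.2) setT
    (fun z : V * E => (z.1, phi z.2)) (@measurable_addv2 R d)).
  by apply: measurable_fun_pair => //; exact: measurableT_comp.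
have S0 : S 0%N = cst 0 by apply/funext => w; rewrite /S big_pred0.
have SS (i : 'I_n) w : S i.+1 w = g i (S i w, Y i w).
  rewrite /S /g /= (bigD1 i) ?ltnSn//= addrC; congr (_ + _).
  by apply: eq_bigl => j; rewrite ltnS [RHS]ltn_neqAle andbC.
suff H k G : (k <= n)%N -> bmeas G ->
    \int[P]_w G (x + S k w) = iter k (transl mu) G x.
  move=> bF; rewrite -H//; apply: eq_Rintegral => w _; congr (F (_ + _)).
  by apply: eq_bigl => i; rewrite ltn_ord.
elim: k G => [|k IH] G kn bG.
  rewrite (@eq_Rintegral _ _ _ _ _ (cst (G x))); last by move=> w _; rewrite S0 addr0.
  exact: Rintegral_cst_probability.
have mSk := measurable_sequential mg S0 SS (ltnW kn).
pose i0 : 'I_n := Ordinal kn.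
have mSY : measurable_fun [set: Omega] (fun w => (S i0 w, Y i0 w)).
  exact: measurable_fun_pair.
pose GG (z : V * E) := G (x + g i0 z).
have bGG : bmeas GG.
  exact: (bmeas_comp (bmeas_shift x bG) (mg i0)).
rewrite iterSr -(IH _ (ltnW kn)); last exact: bmeas_transl.
transitivity (\int[P]_w GG (S i0 w, Y i0 w)).
  by apply: eq_Rintegral => w _; rewrite (SS i0).
rewrite -(Rintegral_law P mSY bGG).
transitivity (\int[(law P mSk \x law P (measurable_funP (Y i0)))%E]_z GG z).
  congr fine; apply: eq_measure_integral => A mA _.
  exact: (sequential_independent iY mg S0 SS (i := i0) mSk mSY mA).
have iGG := bmeas_integrable ((law P mSk \x law P (measurable_funP (Y i0)))%E : probability _ R) bGG.
transitivity (\int[law P mSk]_s transl mu G (x + s)); last first.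
  by rewrite Rintegral_law//; apply: bmeas_shift; exact: bmeas_transl.
rewrite /Rintegral -(integral12_prod_meas1 iGG); congr fine.
apply: eq_integral => s _; rewrite /fubini_F.
have mphiY : measurable_fun [set: Omega] (fun w => phi (Y i0 w)).
  exact: measurableT_comp.
have bG' : bmeas (fun y => G (x + s + y)) by exact: bmeas_shift.
have bG2 : bmeas (fun y => GG (s, y)).
  split; first exact: (measurableT_comp bGG.1 (pair1_measurable s)).
  by have [_ [M hM]] := bG; exists M => y; exact: hM.
rewrite -[LHS]fineK; last first.
  exact: (integrable_fin_num measurableT (bmeas_integrable _ bG2)).
congr (_%:E); transitivity (\int[law P (measurable_funP (Y i0))]_y GG (s, y)) => //.
rewrite Rintegral_law// /GG /g /=.
under eq_Rintegral do rewrite addrA.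
transitivity (\int[law P mphiY]_y G (x + s + y)); first by rewrite Rintegral_law.
rewrite /transl; congr fine; apply: eq_measure_integral => A mA _.
exact: muE.
Qed.

End sum_independent.

(** * Gaussian measures *)

Section affine_lebesgue.
Local Open Scope ereal_scope.
Context {R : realType}.
Notation leb := (@lebesgue_measure R).

(** The image of Lebesgue measure under the affine map, multiplied by a, has the right value on
    intervals, hence is Lebesgue measure. *)
Lemma ge0_integral_affine (a b : R) (f : R -> \bar R) : (0 < a)%R ->
  measurable_fun [set: R] f -> (forall x, 0 <= f x) ->
  \int[leb]_x f (a * x + b)%R = (a^-1)%:E * \int[leb]_x f x.
Proof.
move=> a0 mf f0; pose h (x : measurableTypeR R) : measurableTypeR R := (a * x + b)%R.
have mh : measurable_fun [set: measurableTypeR R] h.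
  by apply: measurable_funD => //; apply: measurable_funM.
have mh' : measurable_fun [set: R] (h : R -> R) by [].
have a0' : (0 <= a)%R by exact: ltW.
pose m : {measure set (measurableTypeR R) -> \bar R} :=
  mscale (NngNum a0') (pushforward leb h : {measure set _ -> \bar R}).
have E A : measurable A -> leb A = m mh A.
  apply: lebesgue_measure_unique => _ [[p q]] _ <-.
  change (leb `]p, q]%classic = a%:E * leb (h @^-1` `]p, q]%classic)).
  rewrite (_ : h @^-1` _ = [set` `](a^-1 * (p - b))%R, (a^-1 * (q - b))%R]]); last first.
    apply/seteqP; split => x /=; rewrite !in_itv /= /h ltr_pdivrMl// ler_pdivlMl//;
      by move=> /andP[px xq]; apply/andP; split; lra.
  rewrite !lebesgue_measure_itv /= !lte_fin ltr_pM2l ?invr_gt0//.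
  rewrite ltrD2r; case: ifPn => _; last by rewrite mule0.
  by rewrite -!EFinD -EFinM; congr (_%:E); field; rewrite gt_eqF.
have -> : \int[leb]_x f x = a%:E * \int[leb]_x f (a * x + b)%R.
  transitivity (\int[m mh]_x f x).
    by apply: eq_measure_integral => A mA _; exact: E.
  by rewrite ge0_integral_mscale//= ge0_integral_pushforward.
by rewrite muleA -EFinM mulVf ?mul1e// gt_eqF.
Qed.

End affine_lebesgue.

Section normal_one_dim.
Local Open Scope ereal_scope.
Context {R : realType}.
Notation leb := (@lebesgue_measure R).
Notation n01 := (normal_prob 0 1 : probability (measurableTypeR R) R).
Let phi := @normal_pdf R 0 1.

Let phiE x : phi x = (normal_peak 1 * expR (- x ^+ 2 / 2))%R.
Proof.
by rewrite /phi normal_pdfE ?oner_eq0// /normal_fun subr0 expr1n.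
Qed.

Let mphi : measurable_fun [set: R] phi.
Proof. exact: measurable_normal_pdf. Qed.

Lemma integral_normal_prob01 (f : R -> \bar R) : (forall x, 0 <= f x) ->
  measurable_fun [set: R] f ->
  \int[normal_prob 0 1]_x f x = \int[leb]_x (f x * (normal_pdf 0 1 x)%:E).
Proof.
move=> f0 mf; apply: (@integral_density _ _ _ leb n01 phi) => //.
by move=> x; exact: normal_pdf_ge0.
Qed.

Lemma integral_normal_shift (u : R) (f : R -> \bar R) : (forall x, 0 <= f x) ->
  measurable_fun [set: R] f ->
  \int[normal_prob 0 1]_x f (x + u)%R =
  \int[normal_prob 0 1]_x (f x * (expR (u * x - u ^+ 2 / 2))%:E).
Proof.
move=> f0 mf.
have mfu : measurable_fun [set: R] (fun x => f (x + u)%R).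
  by apply: (measurableT_comp mf); exact: measurable_funD.
have me : measurable_fun [set: R] (fun x : R => (expR (u * x - u ^+ 2 / 2))%:E).
  apply/measurable_EFinP; apply: measurableT_comp => //.
  by apply: measurable_funB => //; exact: measurable_funM.
rewrite !integral_normal_prob01//; last 2 first.
- by move=> x; rewrite mule_ge0// lee_fin expR_ge0.
- exact: emeasurable_funM.
have mfp : measurable_fun [set: R] (fun x => f x * (phi (x - u)%R)%:E).
  apply: emeasurable_funM => //; apply/measurable_EFinP.
  by apply: (measurableT_comp mphi); exact: measurable_funB.
transitivity (\int[leb]_x (f (1 * x + u)%R * (phi (1 * x + u - u)%R)%:E)).
  by apply: eq_integral => x _; rewrite mul1r addrK.
rewrite (ge0_integral_affine u ltr01 mfp); last first.
  by move=> x; rewrite mule_ge0// lee_fin normal_pdf_ge0.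
rewrite invr1 mul1e; apply: eq_integral => x _.
rewrite -muleA; congr (_ * _); rewrite -EFinM -!/phi !phiE; congr (_%:E).
by rewrite mulrCA -expRD; congr (_ * expR _)%R; field.
Qed.

Lemma integral_normal_expR (u : R) :
  \int[normal_prob 0 1]_x (expR (u * x))%:E = (expR (u ^+ 2 / 2))%:E.
Proof.
have := @integral_normal_shift u (cst (expR (u ^+ 2 / 2))%:E).
rewrite (integral_cst_probability n01) => -> //=.
  by apply: eq_integral => x _; rewrite -EFinM -expRD; congr ((expR _)%:E); ring.
Qed.

(** Rotation invariance of the plane Gaussian: for fixed y, the variable z with s x + t y = r z
    replaces x, and then y is integrated out. *)
Lemma integral_normal_convolution (s t : R) (f : R -> \bar R) : (0 < s)%R ->
  (forall x, 0 <= f x) -> measurable_fun [set: R] f ->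
  \int[normal_prob 0 1]_y \int[normal_prob 0 1]_x f (s * x + t * y)%R =
  \int[normal_prob 0 1]_x f (Num.sqrt (s ^+ 2 + t ^+ 2) * x)%R.
Proof.
move=> s0 f0 mf; set r := Num.sqrt _.
have r2 : (r ^+ 2 = s ^+ 2 + t ^+ 2)%R.
  by rewrite sqr_sqrtr// addr_ge0// sqr_ge0.
have r0 : (0 < r)%R by rewrite sqrtr_gt0 ltr_pwDl ?exprn_gt0 ?sqr_ge0.
have phi0 x : 0 <= (phi x)%:E by rewrite lee_fin normal_pdf_ge0.
have rs0 : (0 < r / s)%R by rewrite divr_gt0.
have step1 y : \int[normal_prob 0 1]_x f (s * x + t * y)%R =
    \int[leb]_z ((r / s)%:E * (f (r * z)%R * (phi ((r * z - t * y) / s)%R)%:E)).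
  have m1 : measurable_fun [set: R] (fun x => f (s * x + t * y)%R).
    by apply: (measurableT_comp mf); apply: measurable_funD => //; exact: measurable_funM.
  rewrite integral_normal_prob01// ge0_integralZl//; last 3 first.
  - apply: emeasurable_funM.
      by apply: (measurableT_comp mf); exact: measurable_funM.
    apply/measurable_EFinP; apply: (measurableT_comp mphi).
    by apply: measurable_funM => //; apply: measurable_funB => //; exact: measurable_funM.
  - by move=> z _; rewrite mule_ge0.
  - by rewrite lee_fin ltW.
  have mh : measurable_fun [set: R] (fun x => f (s * x + t * y)%R * (phi x)%:E).
    by apply: emeasurable_funM => //; exact/measurable_EFinP.
  have h0 x : 0 <= f (s * x + t * y)%R * (phi x)%:E by rewrite mule_ge0.
  have aff := ge0_integral_affine (- (t * y / s)) rs0 mh h0.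
  transitivity ((r / s)%:E * ((r / s)^-1%:E * \int[leb]_x (f (s * x + t * y)%R * (phi x)%:E))).
    by rewrite muleA -EFinM divff ?mul1e// gt_eqF.
  congr (_ * _); rewrite -aff; apply: eq_integral => z _.
  by congr (f _ * (phi _)%:E); field; exact: lt0r_neq0.
have mphi1 : measurable_fun [set: R * R] (fun z : R * R => (phi z.1)%:E).
  by apply/measurable_EFinP; exact: measurableT_comp.
pose G (z : R * R) := (r / s)%:E * (f (r * z.2)%R * (phi ((r * z.2 - t * z.1) / s)%R)%:E).
have mG : measurable_fun [set: R * R] G.
  apply: emeasurable_funM => //; apply: emeasurable_funM.
    by apply: (measurableT_comp mf); exact: measurable_funM.
  apply/measurable_EFinP; apply: (measurableT_comp mphi).
  by apply: measurable_funM => //; apply: measurable_funB => //; exact: measurable_funM.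
have G0 z : 0 <= G z by rewrite !mule_ge0// lee_fin ltW.
have mG1 y : measurable_fun [set: R] (fun z => G (y, z)).
  exact: (measurableT_comp mG (pair1_measurable y)).
have mfr : measurable_fun [set: R] (fun x => f (r * x)%R).
  by apply: (measurableT_comp mf); exact: measurable_funM.
transitivity (\int[normal_prob 0 1]_y \int[leb]_z G (y, z)).
  by apply: eq_integral => y _; rewrite step1.
rewrite integral_normal_prob01//; last 2 first.
- by move=> y; exact: integral_ge0.
- exact: (measurable_fun_fubini_tonelli_F (m2 := leb) G mG G0).
transitivity (\int[leb]_y \int[leb]_z (G (y, z) * (phi y)%:E)).
  by apply: eq_integral => y _; rewrite -ge0_integralZr//; exact: mG1.
transitivity (\int[leb]_z \int[leb]_y (G (y, z) * (phi y)%:E)).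
  apply: (fubini_tonelli (m1 := leb) (m2 := leb) (fun z : R * R => G z * (phi z.1)%:E)).
    exact: emeasurable_funM.
  by move=> z; rewrite mule_ge0.
rewrite integral_normal_prob01//.
apply: eq_integral => z _.
have mp : measurable_fun [set: R] (fun y : R => (phi ((r / s) * y + (- (t * z / s)))%R)%:E).
  apply/measurable_EFinP; apply: (measurableT_comp mphi).
  by apply: measurable_funD => //; exact: measurable_funM.
(* The product of the two densities is regrouped by completing the square in y instead of in z,
   which isolates [phi z] and leaves a rescaled normal density in y. *)
transitivity (\int[leb]_y ((r / s)%:E * (f (r * z)%R * (phi z)%:E) *
    (phi ((r / s) * y + (- (t * z / s)))%R)%:E)).
  apply: eq_integral => y _; rewrite /G /= -!muleA; congr (_ * (_ * _)).
  rewrite -!EFinM !phiE; congr (_%:E).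
  rewrite mulrACA [RHS]mulrACA; congr (_ * _)%R; rewrite -!expRD; congr expR.
  apply: (@mulIf _ (2 * s ^+ 2)%R); first by rewrite mulf_neq0// ?expf_neq0// gt_eqF.
  transitivity (- ((r * z - t * y) ^+ 2 + s ^+ 2 * y ^+ 2))%R.
    by field; rewrite gt_eqF.
  transitivity (- (s ^+ 2 * z ^+ 2 + (r * y - t * z) ^+ 2))%R.
    transitivity (- (r ^+ 2 * z ^+ 2 - r * t * y * z *+ 2 + (s ^+ 2 + t ^+ 2) * y ^+ 2))%R.
      by ring.
    transitivity (- ((s ^+ 2 + t ^+ 2) * z ^+ 2 - r * t * y * z *+ 2 + r ^+ 2 * y ^+ 2))%R.
      by rewrite r2.
    by ring.
  by field; rewrite gt_eqF.
rewrite ge0_integralZl//; last by rewrite !mule_ge0// lee_fin ltW.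
have mphiE : measurable_fun [set: R] (EFin \o phi) by exact/measurable_EFinP.
have := @ge0_integral_affine R (r / s)%R (- (t * z / s))%R (EFin \o phi) rs0 mphiE phi0.
rewrite /= => ->; rewrite integral_normal_pdf mule1 muleAC -EFinM.
by rewrite divff ?mul1e// gt_eqF.
Qed.

Let idR : measurableTypeR R -> R := idfun.
Let midR : measurable_fun [set: measurableTypeR R] idR.
Proof. exact: measurable_id. Qed.

(* normal_prob lives on measurableTypeR R, whose measure display differs from
   the canonical one of R. *)
Definition normal01 : probability R R := law n01 midR.

Lemma normal01E (A : set R) : normal01 A = normal_prob 0 1 A.
Proof. by []. Qed.

Let integral_normal01 (f : R -> \bar R) : (forall x, 0 <= f x) ->
  measurable_fun [set: R] f -> \int[normal01]_x f x = \int[normal_prob 0 1]_x f x.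
Proof. by move=> f0 mf; rewrite (ge0_integral_law n01 midR mf f0). Qed.

Lemma integral_normal01_shift (u : R) (f : R -> \bar R) : (forall x, 0 <= f x) ->
  measurable_fun [set: R] f ->
  \int[normal01]_x f (x + u)%R =
  \int[normal01]_x (f x * (expR (u * x - u ^+ 2 / 2))%:E).
Proof.
move=> f0 mf; rewrite !integral_normal01//.
- exact: integral_normal_shift.
- by move=> x; rewrite mule_ge0// lee_fin expR_ge0.
- apply: emeasurable_funM => //; apply/measurable_EFinP; apply: measurableT_comp => //.
  by apply: measurable_funB => //; exact: measurable_funM.
- by apply: (measurableT_comp mf); exact: measurable_funD.
Qed.

Lemma integral_normal01_expR (u : R) :
  \int[normal01]_x (expR (u * x))%:E = (expR (u ^+ 2 / 2))%:E.
Proof.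
rewrite integral_normal01 ?integral_normal_expR//.
by apply/measurable_EFinP; apply: measurableT_comp => //; exact: measurable_funM.
Qed.

Lemma integral_normal01_convolution (s t : R) (f : R -> \bar R) : (0 < s)%R ->
  (forall x, 0 <= f x) -> measurable_fun [set: R] f ->
  \int[normal01]_y \int[normal01]_x f (s * x + t * y)%R =
  \int[normal01]_x f (Num.sqrt (s ^+ 2 + t ^+ 2) * x)%R.
Proof.
move=> s0 f0 mf.
have mst : measurable_fun [set: R * R] (fun z : R * R => f (s * z.2 + t * z.1)%R).
  by apply: (measurableT_comp mf); apply: measurable_funD => //; exact: measurable_funM.
have min y : measurable_fun [set: R] (fun x => f (s * x + t * y)%R).
  by apply: (measurableT_comp mf); apply: measurable_funD => //; exact: measurable_funM.
rewrite integral_normal01; last 2 first.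
- by move=> y; exact: integral_ge0.
- exact: (measurable_fun_fubini_tonelli_F (m2 := normal01) _ mst (fun=> f0 _)).
under eq_integral do rewrite integral_normal01//.
rewrite integral_normal_convolution// integral_normal01//.
by apply: (measurableT_comp mf); exact: measurable_funM.
Qed.

End normal_one_dim.
Arguments normal01 {R}.

(** A property of a law rather than of random variables: the comparison with the walk takes place
    between laws, and by [eq_vec_measure] boxes determine them. *)
Definition std_gaussian {R : realType} {d : nat} (N : probability 'cV[R]_d R) :=
  forall B : 'I_d -> set R, (forall i, measurable (B i)) ->
    N (box B) = (\prod_(i < d) normal01 (B i))%E.

Section gaussian.
Context {R : realType} {d : nat}.
Local Notation V := 'cV[R]_d.
Variable N : probability V R.
Hypothesis gN : std_gaussian N.
Notation n01 := (@normal01 R).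

Let coordRV (i : 'I_d) : {RV N >-> R} := mfun_Sub (mem_set (@measurable_coord R d i)).

Lemma gaussian_coord (i : 'I_d) (B : set R) : measurable B ->
  N ((fun x : V => x i 0) @^-1` B) = normal01 B.
Proof.
move=> mB; rewrite (_ : _ @^-1` _ = box (fun j => if j == i then B else setT)).
  rewrite gN; last by move=> j; case: ifP.
  rewrite (bigD1 i)//= eqxx big1 ?mule1// => j /negbTE ->.
  exact: (probability_setT n01).
apply/seteqP; split => x /=; first by move=> Bx j; case: eqP => [->|].
by move=> /(_ i); rewrite eqxx.
Qed.

Let icoord : mutually_independent coordRV.
Proof.
move=> B mB; rewrite (_ : \bigcap_(i in _) _ = box B).
  by rewrite gN//; apply: eq_bigr => i _; rewrite -(gaussian_coord i).
by apply/seteqP; split => x /= h i; [|move=> _]; exact: h.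
Qed.

Lemma gaussian_coord_integral (i : 'I_d) (f : R -> \bar R) :
  measurable_fun [set: R] f -> (forall x, 0 <= f x)%E ->
  (\int[N]_x f (x i 0%R) = \int[normal01]_x f x)%E.
Proof.
move=> mf f0; rewrite -(ge0_integral_law N (@measurable_coord R d i) mf f0).
by apply: eq_measure_integral => A mA _; exact: gaussian_coord.
Qed.

Lemma gaussian_prod (f : 'I_d -> R -> R) :
  (forall i, measurable_fun [set: R] (f i)) -> (forall i x, 0 <= f i x) ->
  (\int[N]_x (\prod_(i < d) f i (x i 0))%R%:E =
   \prod_(i < d) \int[normal01]_x (f i x)%:E)%E.
Proof.
move=> mf f0; rewrite (expectation_prod_independent icoord)//.
apply: eq_bigr => i _; rewrite (gaussian_coord_integral i (f := EFin \o f i))//.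
  exact/measurable_EFinP.
by move=> x; rewrite lee_fin.
Qed.

(** The density of N(u, I) with respect to N(0, I), written as a product so that integrals over
    boxes factor. *)
Definition girsanov (u z : V) : R :=
  \prod_(i < d) expR (u i 0 * z i 0 - u i 0 ^+ 2 / 2).

Lemma girsanovE (u z : V) : girsanov u z = expR (dotv u z - dotv u u / 2).
Proof.
by rewrite /girsanov -expR_sum /dotv mulr_suml -sumrB.
Qed.

Lemma girsanov_ge0 u z : 0 <= girsanov u z.
Proof. by rewrite girsanovE expR_ge0. Qed.

Lemma measurable_girsanov u : measurable_fun [set: V] (girsanov u).
Proof.
apply: measurable_prod => i _; apply: measurableT_comp => //.
by apply: measurable_funB => //; apply: measurable_funM => //; exact: measurable_coord.
Qed.

Let m1d (c : R) : measurable_fun [set: R] (fun x : R => expR (c * x - c ^+ 2 / 2)).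
Proof.
by apply: measurableT_comp => //; apply: measurable_funB => //; exact: measurable_funM.
Qed.

Let integral_1d (c : R) (f : R -> R) : (forall x, 0 <= f x) -> measurable_fun [set: R] f ->
  (\int[normal01]_x (f x * expR (c * x - c ^+ 2 / 2))%:E =
   \int[normal01]_x (f (x + c))%:E)%E.
Proof.
move=> f0 mf; rewrite (@integral_normal01_shift R c (EFin \o f))//.
exact/measurable_EFinP.
Qed.

Lemma integral_girsanov u : (\int[N]_z (girsanov u z)%:E = 1)%E.
Proof.
rewrite (gaussian_prod (f := fun i x => expR (u i 0 * x - u i 0 ^+ 2 / 2)))//.
rewrite big1// => i _.
have := @integral_1d (u i 0) (cst 1); rewrite /=.
under eq_integral do rewrite mul1r.
move=> ->//; exact: (integral_cst_probability n01).
Qed.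

Lemma gaussian_shift_set u A : measurable A ->
  law N (measurable_addv u) A =
  density_probability (measurable_girsanov u) (girsanov_ge0 u) (integral_girsanov u) A.
Proof.
apply: eq_vec_measure => B mB; rewrite density_probabilityE lawE.
rewrite (_ : _ @^-1` _ = box (fun i => (fun x => x + u i 0) @^-1` B i)); last first.
  by apply/seteqP; split => x /= h i; have := h i; rewrite /= mxE addrC.
have mBu i : measurable ((fun x : R => x + u i 0) @^-1` B i).
  by rewrite -[X in measurable X]setTI; exact: measurable_funD.
rewrite gN// integral_mkcond/=.
transitivity (\int[N]_z (\prod_(i < d) (\1_(B i) (z i 0) *
    expR (u i 0 * z i 0 - u i 0 ^+ 2 / 2)))%:E)%E; last first.
  apply: eq_integral => z _; rewrite patchE; case: ifPn => zB.
    congr (_%:E); apply: eq_bigr => i _.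
    by rewrite indicE mem_set ?mul1r//; move: zB; rewrite inE; apply.
  have [i Bi] : exists i, ~ B i (z i 0).
    by apply/existsNP; move: zB; rewrite notin_setE.
  by rewrite (bigD1 i)//= indicE memNset// !mul0r.
rewrite (gaussian_prod (f := fun i x => \1_(B i) x * expR (u i 0 * x - u i 0 ^+ 2 / 2))).
- apply: eq_bigr => i _.
  have mi : measurable_fun [set: R] (\1_(B i) : R -> R) by exact: measurable_indic.
  have i0 x : 0 <= (\1_(B i) : R -> R) x by rewrite indicE.
  rewrite (integral_1d (u i 0) i0 mi).
  under [RHS]eq_integral => x _.
    rewrite (_ : (\1_(B i) (x + u i 0)) = \1_((fun x : R => x + u i 0) @^-1` B i) x)//.
    over.
  by rewrite (@integral_indic _ _ _ n01)// setIT.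
- by move=> i; apply: measurable_funM => //; exact: measurable_indic.
- by move=> i x; rewrite mulr_ge0 ?expR_ge0.
Qed.

Lemma girsanov_integrable u : N.-integrable [set: V] (EFin \o girsanov u).
Proof.
apply/integrableP; split; first by apply/measurable_EFinP; exact: measurable_girsanov.
under eq_integral do rewrite /= ger0_norm ?girsanov_ge0//.
by rewrite integral_girsanov ltry.
Qed.

Lemma bmeasM_integrable {dT} {T : measurableType dT} (P : probability T R) (F g : T -> R) :
  bmeas F -> P.-integrable [set: T] (EFin \o g) ->
  P.-integrable [set: T] (EFin \o (fun z => F z * g z)).
Proof.
move=> [mF [M FM]] ig.
have ig' : P.-integrable [set: T] (fun x => M%:E * (EFin \o g) x)%E by exact: integrableZl.
apply: (le_integrable measurableT _ _ ig') => //.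
  apply/measurable_EFinP; apply: measurable_funM => //.
  by apply/measurable_EFinP; exact: measurable_int ig.
move=> x _ /=; rewrite lee_fin !normrM ler_wpM2r//.
by rewrite (le_trans (FM x))// ler_norm.
Qed.

Lemma gaussian_shift u F : bmeas F ->
  \int[N]_z F (u + z) = \int[N]_z (F z * girsanov u z).
Proof.
move=> bF; have [mF [M FM]] := bF.
rewrite -(Rintegral_law N (measurable_addv u) bF).
pose D := density_probability (measurable_girsanov u) (girsanov_ge0 u) (integral_girsanov u).
transitivity (\int[D]_z F z).
  by congr fine; apply: eq_measure_integral => A mA _; exact: gaussian_shift_set.
(* [integral_density] wants a nonnegative integrand. Adding M to F adds M to both sides, since the
   Girsanov density has integral 1. *)
have FM0 z : 0 <= F z + M by have := FM z; rewrite ler_norml => /andP[? _]; lra.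
have bFM : bmeas (fun z => F z + M) by apply: bmeasD => //; exact: bmeas_cst.
have E1 : \int[D]_z (F z + M) = \int[D]_z F z + M.
  rewrite RintegralD//; [|exact: bmeas_integrable|exact: finite_measure_integrable_cst].
  by rewrite Rintegral_cst_probability.
have E2 : \int[N]_z ((F z + M) * girsanov u z) = \int[N]_z (F z * girsanov u z) + M.
  under eq_Rintegral do rewrite mulrDl.
  rewrite RintegralD//; last 2 first.
  - exact: bmeasM_integrable (girsanov_integrable u).
  - exact: bmeasM_integrable (bmeas_cst M) (girsanov_integrable u).
  rewrite RintegralZl//; last exact: girsanov_integrable.
  by rewrite {2}/Rintegral integral_girsanov mulr1.
apply: (@addIr _ M); rewrite -E1 -E2 /Rintegral; congr fine.
rewrite (@integral_density _ _ _ N D (girsanov u))//.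
- exact: measurable_girsanov.
- exact: girsanov_ge0.
- by apply/measurable_EFinP; exact: bFM.1.
Qed.

Lemma gaussian_convolution (s t : R) F : 0 < s -> bmeas F ->
  \int[N]_y \int[N]_x F (s *: x + t *: y) =
  \int[N]_z F (Num.sqrt (s ^+ 2 + t ^+ 2) *: z).
Proof.
move=> s0 bF; set r := Num.sqrt _.
have mst : measurable_fun [set: V * V] (fun z : V * V => s *: z.2 + t *: z.1).
  apply: (measurableT_comp (@measurable_addv2 R d) (g := fun z : V * V => (s *: z.2, t *: z.1))).
  apply: measurable_fun_pair => //=.
    exact: (measurableT_comp (measurable_scalev s)).
  exact: (measurableT_comp (measurable_scalev t)).
have bG : bmeas (fun z : V * V => F (s *: z.2 + t *: z.1)) by exact: (bmeas_comp bF mst).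
pose NN : probability (V * V)%type R := (N \x N)%E.
transitivity (\int[NN]_z F (s *: z.2 + t *: z.1)).
  rewrite /Rintegral -(integral12_prod_meas1 (bmeas_integrable NN bG)); congr fine.
  apply: eq_integral => y _; rewrite /fubini_F fineK//=.
  apply: (integrable_fin_num measurableT (bmeas_integrable N _)).
  exact: (bmeas_comp bG (pair1_measurable y)).
rewrite -(Rintegral_law NN mst bF) -(Rintegral_law N (measurable_scalev r) bF).
congr fine; apply: eq_measure_integral => A mA _.
(* On boxes the coordinates separate, and each one is the one-dimensional convolution identity for
   an indicator. *)
apply: (@eq_vec_measure _ _ (law NN mst) (law N (measurable_scalev r)) _ A mA) => B mB.
change (NN ((fun z : V * V => s *: z.2 + t *: z.1) @^-1` box B) =
  N ((fun x : V => r *: x) @^-1` box B)).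
have mpre : measurable ((fun z : V * V => s *: z.2 + t *: z.1) @^-1` box B).
  by rewrite -[X in measurable X]setTI; apply: mst => //; exact: measurable_box.
have mBs c b i : measurable ((fun x : R => c * x + b) @^-1` B i).
  by rewrite -[X in measurable X]setTI; apply: measurable_funD => //; exact: measurable_funM.
pose pre (c b : R) i : set R := (fun x : R => c * x + b) @^-1` B i.
pose F2 (z : V * V) : V := s *: z.2 + t *: z.1.
pose q i (y : R) : R := fine (normal01 (pre s (t * y) i)).
transitivity (\int[N]_y (\prod_(i < d) q i (y i 0%R))%R%:E)%E.
  transitivity (\int[N]_y (N \o xsection (F2 @^-1` box B)) y)%E => //.
  apply: eq_integral => y _ /=; rewrite -prodEFin.
  rewrite (_ : xsection _ _ = box (fun i => pre s (t * y i 0) i)).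
    rewrite gN; last by move=> i; exact: mBs.
    by apply: eq_bigr => i _; rewrite fineK//; apply: (fin_num_measure n01); exact: mBs.
  by apply/seteqP; split => x; rewrite /xsection /= inE /= => h i; have := h i; rewrite /= !mxE.
have intpre c b i : (normal01 (pre c b i) = \int[normal01]_x (\1_(B i) (c * x + b)%R)%:E)%E.
  transitivity (\int[normal01]_x (\1_(pre c b i) x)%:E)%E => //.
  by rewrite (@integral_indic _ _ _ n01)// ?setIT//; exact: mBs.
have E i (y : R) : ((q i y)%:E =
    \int[normal01]_x (\1_(B i) (s * x + t * y)%R)%:E)%E.
  by rewrite -intpre fineK//; apply: (fin_num_measure n01); exact: mBs.
rewrite (gaussian_prod (f := q)).
- rewrite (_ : _ @^-1` _ = box (fun i => pre r 0 i)); last first.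
    by apply/seteqP; split => x /= h i; have := h i; rewrite /pre /= ?addr0 mxE.
  rewrite gN; last by move=> i; exact: mBs.
  apply: eq_bigr => i _; under eq_integral do rewrite E.
  rewrite (@integral_normal01_convolution R s t (fun x => (\1_(B i) x)%:E))//; last first.
    by apply/measurable_EFinP; exact: measurable_indic.
  by rewrite intpre; apply: eq_integral => x _; rewrite addr0.
- move=> i; apply/measurable_EFinP.
  rewrite (_ : EFin \o _ = fun y => (\int[normal01]_x (\1_(B i) (s * x + t * y)%R)%:E)%E).
    apply: (@measurable_fun_fubini_tonelli_F _ _ _ _ _ n01
      (fun z : R * R => (\1_(B i) (s * z.2 + t * z.1))%:E)) => //.
    apply/measurable_EFinP; apply: (@measurableT_comp _ _ _ _ _ _ (\1_(B i) : R -> R)).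
      exact: measurable_indic.
    by apply: measurable_funD => //; exact: measurable_funM.
  by apply/funext => y; rewrite /= E.
- by move=> i y; exact: fine_ge0.
Qed.

(** j Gaussian steps act as a single one of size sqrt j; this is the source of the powers of 1 /
    sqrt j in the smoothing estimates. *)
Lemma iter_gaussian j F x : bmeas F ->
  iter j (transl N) F x = \int[N]_z F (x + Num.sqrt j%:R *: z).
Proof.
elim: j F => [|j IH] F bF.
  under eq_Rintegral do rewrite sqrtr0 scale0r addr0.
  by rewrite Rintegral_cst_probability.
rewrite iterSr IH; last exact: bmeas_transl.
have := @gaussian_convolution 1 (Num.sqrt j%:R) (fun y => F (x + y)) ltr01 (bmeas_shift x bF).
rewrite expr1n sqr_sqrtr// -natr1 [1 + _]addrC => <-.
apply: eq_Rintegral => y _; apply: eq_Rintegral => z _.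
by rewrite scale1r addrA addrAC.
Qed.

Lemma expR_norm_integrable (c : R) :
  N.-integrable [set: V] (EFin \o (fun z : V => expR (c * \sum_(i < d) `|z i 0|))).
Proof.
have m1 e : measurable_fun [set: R] (fun x : R => expR (e * x)).
  by apply: measurableT_comp => //; exact: measurable_funM.
have mG : measurable_fun [set: V] (fun z : V => \prod_(i < d) (expR (c * z i 0) + expR (- c * z i 0))).
  apply: measurable_prod => i _.
  by apply: measurable_funD; apply: (measurableT_comp (m1 _)); exact: measurable_coord.
have iG : N.-integrable [set: V]
    (EFin \o (fun z : V => \prod_(i < d) (expR (c * z i 0) + expR (- c * z i 0)))).
  apply/integrableP; split; first exact/measurable_EFinP.
  have G0 (z : V) : 0 <= \prod_(i < d) (expR (c * z i 0) + expR (- c * z i 0)).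
    by apply: prodr_ge0 => i _; rewrite addr_ge0 ?expR_ge0.
  under eq_integral do rewrite /= ger0_norm//.
  rewrite (gaussian_prod (f := fun i x => expR (c * x) + expR (- c * x))).
    - rewrite (eq_bigr (fun=> ((expR (c ^+ 2 / 2)) + (expR ((- c) ^+ 2 / 2)))%:E)).
        by rewrite prodEFin ltry.
      move=> i _; under eq_integral do rewrite EFinD.
      have me e : measurable_fun [set: R] (fun x : R => (expR (e * x))%:E).
        exact/measurable_EFinP.
      have e0 e x : (0 <= (expR (e * x))%:E :> \bar R)%E by rewrite lee_fin expR_ge0.
      rewrite (@ge0_integralD _ _ _ n01 _ measurableT (fun x => (expR (c * x))%:E)
        (fun x => (expR (- c * x))%:E))//.
      by rewrite !integral_normal01_expR.
    - by move=> i; exact: measurable_funD.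
    - by move=> i x; rewrite addr_ge0 ?expR_ge0.
apply: (le_integrable measurableT _ _ iG).
  apply/measurable_EFinP; apply: measurableT_comp => //; apply: measurable_funM => //.
  by apply: measurable_sum => i; apply: measurableT_comp => //; exact: measurable_coord.
move=> z _; rewrite /= lee_fin ger0_norm ?expR_ge0// (le_trans _ (ler_norm _))//.
rewrite mulr_sumr expR_sum; apply: ler_prod => i _; rewrite expR_ge0/=.
have [z0|z0] := leP 0 (z i 0).
  by rewrite (ger0_norm z0) lerDl expR_ge0.
by rewrite (ltr0_norm z0) mulrN mulNr lerDr expR_ge0.
Qed.

End gaussian.

(** * Comparison of isotropic and Gaussian increments *)

Section real_integrability.
Context {dT} {T : measurableType dT} {R : realType} (P : probability T R).
Implicit Types f g : T -> R.

Definition rintegrable f := P.-integrable [set: T] (EFin \o f).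

Lemma rintegrable_measurable f : rintegrable f -> measurable_fun [set: T] f.
Proof. by move=> /measurable_int /measurable_EFinP. Qed.

Lemma rintegrable_cst c : rintegrable (fun=> c).
Proof. exact: finite_measure_integrable_cst. Qed.

Lemma rintegrableD f g : rintegrable f -> rintegrable g -> rintegrable (fun x => f x + g x).
Proof. by move=> hf hg; exact: (integrableD measurableT hf hg). Qed.

Lemma rintegrableB f g : rintegrable f -> rintegrable g -> rintegrable (fun x => f x - g x).
Proof. by move=> hf hg; exact: (integrableB measurableT hf hg). Qed.

Lemma rintegrableZl c f : rintegrable f -> rintegrable (fun x => c * f x).
Proof. by move=> hf; exact: (integrableZl measurableT c hf). Qed.

Lemma rintegrable_sum (I : Type) (r : seq I) (F : I -> T -> R) :
  (forall i, rintegrable (F i)) -> rintegrable (fun x => \sum_(i <- r) F i x).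
Proof.
move=> hF; elim: r => [|i r IH].
  by under eq_fun do rewrite big_nil; exact: rintegrable_cst.
by under eq_fun do rewrite big_cons; exact: rintegrableD.
Qed.

Lemma rintegrable_le f g : measurable_fun [set: T] f -> rintegrable g ->
  (forall x, `|f x| <= g x) -> rintegrable f.
Proof.
move=> mf ig fg; apply: (le_integrable measurableT _ _ ig); first exact/measurable_EFinP.
by move=> x _; rewrite /= lee_fin (le_trans (fg x))// ler_norm.
Qed.

Lemma rintD f g : rintegrable f -> rintegrable g ->
  \int[P]_x (f x + g x) = \int[P]_x f x + \int[P]_x g x.
Proof. by move=> hf hg; exact: RintegralD. Qed.

Lemma rintB f g : rintegrable f -> rintegrable g ->
  \int[P]_x (f x - g x) = \int[P]_x f x - \int[P]_x g x.
Proof. by move=> hf hg; exact: RintegralB. Qed.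

Lemma rintZl c f : rintegrable f -> \int[P]_x (c * f x) = c * \int[P]_x f x.
Proof. by move=> hf; exact: RintegralZl. Qed.

Lemma rintZr c f : rintegrable f -> \int[P]_x (f x * c) = \int[P]_x f x * c.
Proof. by move=> hf; exact: RintegralZr. Qed.

Lemma Rintegral_sum (I : Type) (r : seq I) (F : I -> T -> R) :
  (forall i, rintegrable (F i)) ->
  \int[P]_x (\sum_(i <- r) F i x) = \sum_(i <- r) \int[P]_x F i x.
Proof.
move=> hF; elim: r => [|i r IH].
  by under eq_Rintegral do rewrite big_nil; rewrite Rintegral_cst_probability big_nil.
under eq_Rintegral do rewrite big_cons.
by rewrite big_cons rintD ?IH//; exact: (rintegrable_sum r hF).
Qed.

Lemma Rintegral_dominated f g : measurable_fun [set: T] f -> rintegrable g ->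
  (forall x, `|f x| <= g x) -> `|\int[P]_x f x| <= \int[P]_x g x.
Proof.
move=> mf ig fg; have hf := rintegrable_le mf ig fg.
have hn : rintegrable (fun x => `|f x|).
  apply: (rintegrable_le _ ig) => [|x]; first exact: measurableT_comp.
  by rewrite normr_id.
apply: (le_trans (le_normr_Rintegral measurableT hf)).
by apply: (le_Rintegral measurableT hn ig) => x _; exact: fg.
Qed.

Lemma rintegrable_bmeasM F g : bmeas F -> rintegrable g -> rintegrable (fun z => F z * g z).
Proof. by move=> bF ig; exact: bmeasM_integrable. Qed.

End real_integrability.

Section taylor_exp.
Context {R : realType}.
Implicit Types x y : R.

Lemma expR_sub1_le x : `|expR x - 1| <= `|x| * expR `|x|.
Proof.
have e1 z : expR z - 1 <= z * expR z.
  have := expR_ge1Dx (- z); have := expR_gt0 z; rewrite expRN.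
  move=> e0 h; have : (1 - z) * expR z <= 1.
    rewrite -[leRHS](@mulVf _ (expR z)) ?gt_eqF//.
    by apply: ler_wpM2r => //; exact: ltW.
  lra.
rewrite ler_norml; apply/andP; split.
  have h := expR_ge1Dx x; have : - x <= `|x| by rewrite -normrN ler_norm.
  have : `|x| <= `|x| * expR `|x|.
    by rewrite ler_peMr// -expR0 ler_expR.
  lra.
have [x0|x0] := leP 0 x; first by rewrite ger0_norm// e1.
have : expR x <= 1 by rewrite -expR0 ler_expR ltW.
have : 0 <= `|x| * expR `|x| by rewrite mulr_ge0// expR_ge0.
lra.
Qed.

(** Each application raises the order of a Taylor remainder of exp by one; the factorials are given
    up. *)
Lemma mvt_bound (f df : R -> R) (M : R) y : f 0 = 0 ->
  (forall x, is_derive x 1 f (df x)) -> (forall x, `|x| <= `|y| -> `|df x| <= M) ->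
  `|f y| <= `|y| * M.
Proof.
move=> f0 hf hM.
have cf : continuous f.
  move=> x; apply: differentiable_continuous; apply/derivable1_diffP.
  exact: (@ex_derive _ _ _ _ _ _ _ (hf x)).
have [y0|y0] := leP 0 y.
  have [c cy] := MVT_segment y0 (fun x _ => hf x) (continuous_subspaceT cf).
  rewrite f0 !subr0 => ->; rewrite normrM mulrC ler_wpM2l// hM//.
  by move: cy; rewrite in_itv /= => /andP[c0 cy]; rewrite !ger0_norm.
have [c cy] := MVT_segment (ltW y0) (fun x _ => hf x) (continuous_subspaceT cf).
rewrite f0 !sub0r => /eqP; rewrite eqr_oppLR mulrN opprK => /eqP ->.
rewrite normrM mulrC ler_wpM2l// hM//.
move: cy; rewrite in_itv /= => /andP[yc c0].
by rewrite !ler0_norm ?lerN2// ltW.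
Qed.

Lemma expR_taylor1 y : `|expR y - 1 - y| <= `|y| * (`|y| * expR `|y|).
Proof.
apply: (@mvt_bound (fun x => expR x - 1 - x) (fun x => expR x - 1)).
- by rewrite expR0; lra.
- by move=> x; apply: is_derive_eq; rewrite subr0.
move=> x xy; rewrite (le_trans (expR_sub1_le x))//.
by apply: ler_pM => //; rewrite ?expR_ge0// ler_expR.
Qed.

Lemma expR_taylor2 y : `|expR y - 1 - y - y ^+ 2 / 2| <= `|y| ^+ 3 * expR `|y|.
Proof.
rewrite (_ : `|y| ^+ 3 * _ = `|y| * (`|y| * (`|y| * expR `|y|))); last by ring.
apply: (@mvt_bound (fun x => expR x - 1 - x - x ^+ 2 / 2) (fun x => expR x - 1 - x)).
- by rewrite expR0 expr0n /=; lra.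
- move=> x; apply: is_derive_eq; rewrite /= !scaler0 /GRing.scale /=; by field.
move=> x xy; rewrite (le_trans (expR_taylor1 x))//.
apply: ler_pM; [by []|by rewrite mulr_ge0 ?expR_ge0|exact: xy|].
by apply: ler_pM => //; rewrite ?expR_ge0// ler_expR.
Qed.

End taylor_exp.

Section third_order.
Context {R : realType} {d : nat}.
Local Notation V := 'cV[R]_d.

(** The l1 norm bounds scalar products and coordinates, and its exponential factors over the
    coordinates, so that Gaussian exponential moments are products. *)
Definition norm1 (x : V) : R := \sum_(i < d) `|x i 0|.

Lemma norm1_ge0 (x : V) : 0 <= norm1 x.
Proof. by apply: sumr_ge0. Qed.

Lemma norm1_coord (x : V) i : `|x i 0| <= norm1 x.
Proof. by rewrite /norm1 (bigD1 i)//= lerDl sumr_ge0. Qed.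

Lemma norm1Z (c : R) (x : V) : norm1 (c *: x) = `|c| * norm1 x.
Proof. by rewrite /norm1 mulr_sumr; apply: eq_bigr => i _; rewrite mxE normrM. Qed.

Lemma measurable_norm1 : measurable_fun [set: V] norm1.
Proof.
by apply: measurable_sum => i; apply: measurableT_comp => //; exact: measurable_coord.
Qed.

Lemma dotv_norm1 (x y : V) : `|dotv x y| <= norm1 x * norm1 y.
Proof.
rewrite (le_trans (ler_norm_sum _ _ _))// /norm1 mulr_suml; apply: ler_sum => i _.
by rewrite normrM ler_wpM2l// norm1_coord.
Qed.

Lemma dotv_ge0 (x : V) : 0 <= dotv x x.
Proof. by apply: sumr_ge0 => i _; rewrite -expr2 sqr_ge0. Qed.

(** The Taylor polynomial of degree 2 in u of [girsanov u z]; its homogeneous parts are Hermite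
    polynomials in z. *)
Definition quad_part (u z : V) : R := 1 + dotv u z + (dotv u z ^+ 2 - dotv u u) / 2.

(** The bound must hold for all u, as u will be a rescaled step of unbounded size. Large u is
    covered by the density itself on the right, which costs only 1 after integration. In 7 e^2 e^(2
    t), six parts come from (t + 1)^3 <= 6 e^(t + 1) and one from the terms of order at least 3 in u
    within y^2 / 2. *)
Lemma girsanov_taylor (u z : V) :
  `|girsanov u z - quad_part u z| <=
  norm1 u ^+ 3 * (girsanov u z + 7 * expR 2 * expR (2 * norm1 z)).
Proof.
have g0 := girsanov_ge0 u z.
have u0 := norm1_ge0 u; have z0 := norm1_ge0 z.
have huz := dotv_norm1 u z; have huu := dotv_norm1 u u; have uu0 := dotv_ge0 u.
set a := dotv u z in huz *; set b := dotv u u in huu uu0 *.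
set s := norm1 u in u0 huz huu *; set t := norm1 z in z0 huz *.
have et : 1 <= expR t by rewrite -expR0 ler_expR.
have ett : 1 + t <= expR t by exact: expR_ge1Dx.
have e2t : expR (2 * t) = expR t ^+ 2 by rewrite expr2 -expRD; congr expR; ring.
have e2 : 1 <= expR (2 : R) by rewrite -expR0 ler_expR.
have huu' : b <= s * s by rewrite (le_trans (ler_norm _)).
have [s1|s1] := leP s 1.
  pose y := a - b / 2.
  have ey : `|y| <= s * (t + 1).
    rewrite /y (le_trans (ler_normB _ _))// mulrDr lerD// mulr1 ger0_norm ?divr_ge0//.
    nra.
  have ey1 : `|y| <= t + 1 by nra.
  have t1 : 0 <= t + 1 by lra.
  have h := expR_taylor2 y.
  have t3 : (t + 1) ^+ 3 <= 6 * expR (t + 1).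
    have := @expR_ge1Dxn R (t + 1) 2 t1.
    rewrite (_ : 3`!%:R = 6 :> R)// => h3.
    have : (t + 1) ^+ 3 / 6 <= expR (t + 1) by lra.
    by rewrite ler_pdivrMr// mulrC.
  have h' : `|y| ^+ 3 * expR `|y| <= s ^+ 3 * (6 * expR 2 * expR (2 * t)).
    rewrite (_ : 6 * expR 2 * expR (2 * t) = 6 * expR (t + 1) * expR (t + 1)); last first.
      by rewrite -!mulrA -!expRD; congr (_ * expR _); ring.
    apply: (@le_trans _ _ ((s * (t + 1)) ^+ 3 * expR (t + 1))).
      apply: ler_pM; rewrite ?exprn_ge0 ?expR_ge0 ?ler_expR//.
      by rewrite lerXn2r ?nnegrE// mulr_ge0.
    rewrite exprMn -(mulrA (s ^+ 3)); apply: ler_wpM2l; first exact: exprn_ge0.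
    by apply: ler_wpM2r => //; exact: expR_ge0.
  have gE : girsanov u z = expR y by rewrite girsanovE.
  have -> : girsanov u z - quad_part u z =
      (expR y - 1 - y - y ^+ 2 / 2) + (- (a * (b / 2)) + (b / 2) ^+ 2 / 2).
    by rewrite gE /quad_part -/a -/b /y; field.
  apply: (le_trans (ler_normD _ _)).
  have h2 : `|- (a * (b / 2)) + (b / 2) ^+ 2 / 2| <= s ^+ 3 * (t + 1).
    rewrite (le_trans (ler_normD _ _))// normrN normrM mulrDr mulr1.
    rewrite [X in _ * X]ger0_norm ?divr_ge0// [X in _ + X]ger0_norm ?divr_ge0 ?sqr_ge0//.
    apply: lerD.
      rewrite (_ : s ^+ 3 * t = (s * t) * (s * s)); last by ring.
      by apply: ler_pM => //; [rewrite divr_ge0|lra].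
    have b2 : (b / 2) ^+ 2 <= (s * s) ^+ 2 by rewrite lerXn2r ?nnegrE ?divr_ge0 ?mulr_ge0//; lra.
    have : (s * s) ^+ 2 <= s ^+ 3.
      rewrite (_ : (s * s) ^+ 2 = s ^+ 3 * s); last by ring.
      by rewrite ler_piMr// exprn_ge0.
    have := sqr_ge0 (b / 2); lra.
  have h3 : t + 1 <= expR 2 * expR (2 * t).
    rewrite e2t; apply: (@le_trans _ _ (1 * expR t ^+ 2)); last by rewrite ler_wpM2r ?sqr_ge0.
    by rewrite mul1r expr2; nra.
  apply: (@le_trans _ _ (s ^+ 3 * (6 * expR 2 * expR (2 * t)) + s ^+ 3 * (t + 1))).
    by apply: lerD => //; exact: le_trans h'.
  rewrite -mulrDr ler_wpM2l ?exprn_ge0//; lra.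
(* For s > 1 there is no cancellation to exploit: the density and the polynomial are bounded
   separately, and lower powers of s by s^3. *)
have s3 : 1 <= s ^+ 3 by rewrite exprn_ege1// ltW.
have s13 : s <= s ^+ 3 by rewrite ler_eXnr// ltW.
have s23 : s ^+ 2 <= s ^+ 3 by rewrite ler_weXn2l// ltW.
rewrite mulrDr (le_trans (ler_normB _ _))// lerD//.
  by rewrite ger0_norm// ler_peMl.
apply: (@le_trans _ _ (s ^+ 3 * (1 + t + t ^+ 2 + 1))); last first.
  rewrite ler_wpM2l ?(le_trans _ s3)//.
  apply: (@le_trans _ _ (7 * 1 * expR (2 * t))); last first.
    by rewrite ler_wpM2r ?expR_ge0// ler_wpM2l.
  by rewrite e2t expr2 mulr1; nra.
rewrite /quad_part -/a -/b.
have a2 : a ^+ 2 <= s ^+ 2 * t ^+ 2.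
  by rewrite -exprMn -[X in X <= _]ger0_norm ?sqr_ge0// normrX lerXn2r ?nnegrE// mulr_ge0.
apply: (@le_trans _ _ (1 + `|a| + (a ^+ 2 + b))).
  rewrite (le_trans (ler_normD _ _))// lerD//.
    by rewrite (le_trans (ler_normD _ _))// normr1.
  have := sqr_ge0 a => a20.
  by rewrite ler_norml; apply/andP; split; lra.
have h1 : `|a| <= s ^+ 3 * t by apply: (le_trans huz); rewrite ler_wpM2r.
have h2 : a ^+ 2 <= s ^+ 3 * t ^+ 2.
  by apply: (le_trans a2); rewrite ler_wpM2r ?sqr_ge0.
have h3 : b <= s ^+ 3 by rewrite (le_trans huu')// -expr2.
rewrite !mulrDr !mulr1; lra.
Qed.

End third_order.

Section isotropic.
Context {R : realType} {d : nat}.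
Local Notation V := 'cV[R]_d.

Definition isotropic3 (mu : probability V R) :=
  [/\ rintegrable mu (fun x => norm1 x ^+ 3),
      forall i, \int[mu]_x x i 0 = 0 &
      forall i k, \int[mu]_x (x i 0 * x k 0) = (i == k)%:R].

Definition moment3 (mu : probability V R) := \int[mu]_x norm1 x ^+ 3.

Lemma moment3_ge0 mu : 0 <= moment3 mu.
Proof. by apply: Rintegral_ge0 => x _; rewrite exprn_ge0// norm1_ge0. Qed.

Section moments.
Variable mu : probability V R.
Hypothesis hmu : rintegrable mu (fun x => norm1 x ^+ 3).

Let dom : rintegrable mu (fun x => 1 + norm1 x ^+ 3).
Proof. by apply: rintegrableD => //; exact: rintegrable_cst. Qed.

Lemma rintegrable_coord i : rintegrable mu (fun x => x i 0).
Proof.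
apply: (rintegrable_le _ dom) => [|x]; first exact: measurable_coord.
rewrite (le_trans (norm1_coord x i))//; have s0 := norm1_ge0 x.
have [s1|s1] := leP (norm1 x) 1.
  by rewrite (le_trans s1)// lerDl exprn_ge0.
have s3 : norm1 x <= norm1 x ^+ 3 by rewrite ler_eXnr// ltW.
lra.
Qed.

Lemma rintegrable_coordM i k : rintegrable mu (fun x => x i 0 * x k 0).
Proof.
apply: (rintegrable_le _ dom) => [|x].
  by apply: measurable_funM; exact: measurable_coord.
rewrite normrM; have s0 := norm1_ge0 x.
apply: (@le_trans _ _ (norm1 x ^+ 2)); first by rewrite expr2 ler_pM// norm1_coord.
have [s1|s1] := leP (norm1 x) 1.
  by rewrite (@le_trans _ _ 1) ?exprn_ile1// lerDl exprn_ge0.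
by rewrite (@le_trans _ _ (norm1 x ^+ 3)) ?ler_weXn2l ?lerDr// ltW.
Qed.

End moments.

Lemma quad_partE (u z : V) : quad_part u z = 1 + \sum_(i < d) u i 0 * z i 0 +
  2^-1 * \sum_(i < d) \sum_(k < d) (u i 0 * u k 0) * (z i 0 * z k 0 - (i == k)%:R).
Proof.
rewrite /quad_part -/(dotv u z) [_ / 2]mulrC; congr (_ + _ * _).
rewrite expr2 {1}/dotv mulr_suml /dotv -sumrB; apply: eq_bigr => i _.
rewrite mulr_sumr (bigD1 i)//= [RHS](bigD1 i)//= eqxx mulr1n [LHS]addrAC; congr (_ + _).
  by ring.
apply: eq_bigr => k ki; rewrite eq_sym (negbTE ki) subr0; ring.
Qed.

Variable N : probability V R.
Hypothesis gN : std_gaussian N.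

Lemma expR_norm1_rintegrable (c : R) : rintegrable N (fun z => expR (c * norm1 z)).
Proof. exact: expR_norm_integrable. Qed.

Lemma norm1_exp_bound (x : R) : 0 <= x -> x ^+ 3 <= 6 * expR (1 * x).
Proof.
move=> x0; have := @expR_ge1Dxn R x 2 x0.
rewrite (_ : 3`!%:R = 6 :> R)// mul1r => h3.
have : x ^+ 3 / 6 <= expR x by lra.
by rewrite ler_pdivrMr// mulrC.
Qed.

Lemma gaussian_moment3 : rintegrable N (fun x => norm1 x ^+ 3).
Proof.
apply: (@rintegrable_le _ _ _ _ _ (fun z => 6 * expR (1 * norm1 z))).
- by apply: measurable_funX; exact: measurable_norm1.
- by apply: rintegrableZl; exact: expR_norm1_rintegrable.
- move=> x; rewrite ger0_norm ?exprn_ge0 ?norm1_ge0//.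
  exact: norm1_exp_bound (norm1_ge0 x).
Qed.

Lemma rintegrable_quad_part u : rintegrable N (quad_part u).
Proof.
rewrite (_ : quad_part u = fun z => 1 + \sum_(i < d) u i 0 * z i 0 +
  2^-1 * \sum_(i < d) \sum_(k < d) (u i 0 * u k 0) * (z i 0 * z k 0 - (i == k)%:R)); last first.
  by apply/funext => z; rewrite quad_partE.
have h := gaussian_moment3.
apply: rintegrableD.
  apply: rintegrableD; first exact: rintegrable_cst.
  by apply: rintegrable_sum => i; apply: rintegrableZl; exact: rintegrable_coord.
apply: rintegrableZl; apply: rintegrable_sum => i; apply: rintegrable_sum => k.
apply: rintegrableZl; apply: rintegrableB; last exact: rintegrable_cst.
exact: rintegrable_coordM.
Qed.

(** The Gaussian integral of the bracket in [girsanov_taylor]; the 1 is the mass of the Girsanov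
    density. *)
Definition taylor_const := 1 + 7 * expR 2 * \int[N]_z expR (2 * norm1 z).

Lemma taylor_const_ge0 : 0 <= taylor_const.
Proof.
apply: addr_ge0 => //; apply: mulr_ge0; first by apply: mulr_ge0 => //; exact: expR_ge0.
by apply: Rintegral_ge0 => z _; exact: expR_ge0.
Qed.

Lemma taylor_integral F b u : bmeas F -> (forall x, `|F x| <= b) ->
  `|\int[N]_z (F z * girsanov u z) - \int[N]_z (F z * quad_part u z)| <=
  b * norm1 u ^+ 3 * taylor_const.
Proof.
move=> bF Fb; have ig := girsanov_integrable gN u.
have iq := rintegrable_quad_part u.
have b0 : 0 <= b by rewrite (le_trans _ (Fb 0)).
have iFg : rintegrable N (fun z => F z * girsanov u z) by exact: rintegrable_bmeasM.
have iFq : rintegrable N (fun z => F z * quad_part u z) by exact: rintegrable_bmeasM.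
have ie := expR_norm1_rintegrable 2.
have ih : rintegrable N (fun z => girsanov u z + 7 * expR 2 * expR (2 * norm1 z)).
  by apply: rintegrableD => //; exact: rintegrableZl.
rewrite -rintB//.
apply: (@le_trans _ _ (\int[N]_z (b * norm1 u ^+ 3 *
    (girsanov u z + 7 * expR 2 * expR (2 * norm1 z))))).
  apply: Rintegral_dominated.
  - exact: (rintegrable_measurable (rintegrableB iFg iFq)).
  - exact: rintegrableZl.
  - move=> z; rewrite -mulrBr normrM -mulrA; apply: ler_pM => //.
    exact: girsanov_taylor.
rewrite rintZl// rintD//; last exact: rintegrableZl.
by rewrite rintZl// /taylor_const {1}/Rintegral integral_girsanov.
Qed.

Lemma small_quadratic (a b c : R) : 0 <= c ->
  (forall t, 0 < t -> t <= 1 -> `|t * a + t ^+ 2 * b| <= t ^+ 3 * c) -> a = 0 /\ b = 0.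
Proof.
move=> c0 h.
have small (x e : R) : 0 <= e -> (forall t, 0 < t -> t <= 1 -> `|x| <= t * e) -> x = 0.
  move=> e0 hx; apply/eqP; rewrite -normr_le0 leNgt; apply/negP => x0.
  pose t := Num.min 1 (`|x| / (2 * (e + 1))).
  have t0 : 0 < t by rewrite lt_min ltr01 divr_gt0// mulr_gt0//; lra.
  have t1 : t <= 1 by rewrite ge_min lexx.
  have t2 : t <= `|x| / (2 * (e + 1)) by rewrite ge_min lexx orbT.
  have := hx t t0 t1; rewrite ler_pdivlMr in t2; last lra.
  nra.
have a0 : a = 0.
  apply: (small _ (`|b| + c)) => [|t t0 t1]; first by rewrite addr_ge0.
  rewrite -(ler_pM2l t0) -{1}(gtr0_norm t0) -normrM.
  have -> : t * a = (t * a + t ^+ 2 * b) - t ^+ 2 * b by ring.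
  rewrite (le_trans (ler_normB _ _))// normrM [`|t ^+ 2|]ger0_norm ?sqr_ge0//.
  have := h t t0 t1 => ht.
  have : t ^+ 3 * c <= t ^+ 2 * c by rewrite ler_wpM2r// ler_wiXn2l// ltW.
  nra.
split => //; apply: (small _ c) => // t t0 t1.
have := h t t0 t1; rewrite a0 mulr0 add0r normrM [`|t ^+ 2|]ger0_norm ?sqr_ge0//.
rewrite (_ : t ^+ 3 * c = t ^+ 2 * (t * c)); last by ring.
by rewrite ler_pM2l// exprn_gt0.
Qed.

(** The moments are read off the Taylor expansion itself. With F = 1 the integral of the density is
    exactly 1, so along u = t v a polynomial t a + t^2 b is O(t^3), and both coefficients vanish. *)
Lemma gaussian_quad v :
  \int[N]_z dotv v z = 0 /\ \int[N]_z (dotv v z ^+ 2) = dotv v v.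
Proof.
have h3 := gaussian_moment3.
have id w : rintegrable N (dotv w).
  by apply: rintegrable_sum => i; apply: rintegrableZl; exact: rintegrable_coord.
have id2 w : rintegrable N (fun z => dotv w z ^+ 2).
  rewrite (_ : (fun z => dotv w z ^+ 2) = fun z =>
      \sum_(i < d) \sum_(k < d) (w i 0 * w k 0) * (z i 0 * z k 0)); last first.
    apply/funext => z; rewrite expr2 {1}/dotv mulr_suml; apply: eq_bigr => i _.
    by rewrite /dotv mulr_sumr; apply: eq_bigr => k _; ring.
  apply: rintegrable_sum => i; apply: rintegrable_sum => k; apply: rintegrableZl.
  exact: rintegrable_coordM.
have E w : \int[N]_z (1 * quad_part w z) =
    1 + \int[N]_z dotv w z + (\int[N]_z (dotv w z ^+ 2) - dotv w w) / 2.
  under eq_Rintegral do rewrite mul1r /quad_part.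
  have i1 := rintegrable_cst N 1.
  rewrite rintD//; last 2 first.
  - exact: rintegrableD.
  - under eq_fun do rewrite mulrC.
    by apply: rintegrableZl; apply: rintegrableB => //; exact: rintegrable_cst.
  rewrite rintD// Rintegral_cst_probability; congr (_ + _).
  rewrite rintZr//; last by apply: rintegrableB => //; exact: rintegrable_cst.
  by rewrite rintB ?Rintegral_cst_probability//; exact: rintegrable_cst.
have T w : `|\int[N]_z dotv w z + (\int[N]_z (dotv w z ^+ 2) - dotv w w) / 2| <=
    norm1 w ^+ 3 * taylor_const.
  have := @taylor_integral (fun=> 1) 1 w (bmeas_cst 1) (fun x => _).
  rewrite E; under eq_Rintegral do rewrite mul1r.
  rewrite {1}/Rintegral integral_girsanov//= mul1r => h.
  have := h (fun=> _); rewrite normr1 => {}h.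
  rewrite -normrN (le_trans _ (h _))// le_eqVlt; apply/orP; left; apply/eqP; congr `|_|; ring.
pose a := \int[N]_z dotv v z; pose b := (\int[N]_z (dotv v z ^+ 2) - dotv v v) / 2.
have [||a0 b0] := @small_quadratic a b (norm1 v ^+ 3 * taylor_const).
- by rewrite mulr_ge0 ?taylor_const_ge0// exprn_ge0// norm1_ge0.
- move=> t t0 t1; have := T (t *: v).
  have dv w : dotv (t *: v) w = t * dotv v w.
    by rewrite /dotv mulr_sumr; apply: eq_bigr => i _; rewrite mxE mulrA.
  have dvv : dotv (t *: v) (t *: v) = t ^+ 2 * dotv v v.
    by rewrite /dotv mulr_sumr; apply: eq_bigr => i _; rewrite !mxE; ring.
  rewrite dvv norm1Z exprMn (gtr0_norm t0).
  under eq_Rintegral do rewrite dv.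
  under [X in _ + (X - _) / _]eq_Rintegral do rewrite dv exprMn.
  rewrite rintZl// rintZl// => h; rewrite [leRHS]mulrA; apply: le_trans h.
  by rewrite /a /b le_eqVlt; apply/orP; left; apply/eqP; congr `|_|; ring.
split => //; move/eqP: b0; rewrite mulf_eq0 invr_eq0 pnatr_eq0 orbF subr_eq0.
by move/eqP.
Qed.

Lemma dotv_delta i (z : V) : dotv (delta_mx i 0) z = z i 0.
Proof.
rewrite /dotv (bigD1 i)//= mxE !eqxx mul1r big1 ?addr0// => k ki.
by rewrite mxE (negbTE ki) mul0r.
Qed.

Lemma gaussian_isotropic3 : isotropic3 N.
Proof.
have h3 := gaussian_moment3; split => //.
  move=> i; have [<- _] := gaussian_quad (delta_mx i 0).
  by apply: eq_Rintegral => z _; rewrite dotv_delta.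
have dii i : \int[N]_x (x i 0 * x i 0) = 1.
  have [_] := gaussian_quad (delta_mx i 0).
  under eq_Rintegral do rewrite dotv_delta expr2.
  by move=> ->; rewrite dotv_delta mxE !eqxx.
move=> i k; case: eqP => [->//|/eqP ik].
(* Polarisation: the variance of the sum of two coordinates determines their covariance. *)
have [_] := gaussian_quad (delta_mx i 0 + delta_mx k 0).
have dD (u v w : V) : dotv (u + v) w = dotv u w + dotv v w.
  by rewrite /dotv -big_split; apply: eq_bigr => j _; rewrite mxE mulrDl.
rewrite dD !dotv_delta !mxE !eqxx (negbTE ik) eq_sym (negbTE ik) /= addr0 add0r.
under eq_Rintegral => z _.
  rewrite dD !dotv_delta (_ : (_ + _) ^+ 2 = z i 0 * z i 0 +
    (2 * (z i 0 * z k 0) + z k 0 * z k 0)); last by ring.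
  over.
have hij a b := rintegrable_coordM h3 a b.
rewrite rintD//; last first.
  by apply: rintegrableD => //; exact: rintegrableZl.
rewrite rintD//; last exact: rintegrableZl.
rewrite rintZl// !dii /=; lra.
Qed.

(** The subtracted quantity does not involve nu: it is the nu-integral of the second-order
    polynomial, evaluated with mean 0 and covariance I. Two isotropic laws can thus be compared
    through it. *)
Lemma isotropic_smooth_bound (nu : probability V R) j F b : isotropic3 nu ->
  (0 < j)%N -> bmeas F -> (forall x, `|F x| <= b) ->
  `|\int[nu]_x (\int[N]_z F (x + Num.sqrt j%:R *: z)) -
    (\int[N]_z F (Num.sqrt j%:R *: z) + 2^-1 * \sum_(i < d)
      (Num.sqrt j%:R)^-1 ^+ 2 * \int[N]_z (F (Num.sqrt j%:R *: z) * (z i 0 * z i 0 - 1)))|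
  <= taylor_const * b * moment3 nu * (Num.sqrt j%:R)^-1 ^+ 3.
Proof.
move=> [n3 n1 n2] j0 bF Fb; set r := Num.sqrt j%:R.
have r0 : 0 < r by rewrite sqrtr_gt0 ltr0n.
have h3 := gaussian_moment3.
pose Fr z := F (r *: z).
have bFr : bmeas Fr by exact: (bmeas_comp bF (measurable_scalev r)).
pose q x := \int[N]_z F (x + r *: z).
(* Shifting r Z by x is shifting Z by x / r; the factor 1 / r inside Girsanov's density yields the
   gain r^(-3). *)
have qE x : q x = \int[N]_z (Fr z * girsanov (r^-1 *: x) z).
  rewrite -(gaussian_shift gN (r^-1 *: x) bFr); apply: eq_Rintegral => z _.
  by rewrite /Fr scalerDr scalerA mulfV ?scale1r// gt_eqF.
pose p x := \int[N]_z (Fr z * quad_part (r^-1 *: x) z).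
pose be i := \int[N]_z (Fr z * z i 0).
pose Q i k := \int[N]_z (Fr z * (z i 0 * z k 0 - (i == k)%:R)).
have ibe i : rintegrable N (fun z => Fr z * z i 0).
  by apply: rintegrable_bmeasM => //; exact: rintegrable_coord.
have iQ i k : rintegrable N (fun z => Fr z * (z i 0 * z k 0 - (i == k)%:R)).
  apply: rintegrable_bmeasM => //; apply: rintegrableB; last exact: rintegrable_cst.
  exact: rintegrable_coordM.
have pE x : p x = \int[N]_z Fr z + \sum_(i < d) (r^-1 * be i) * x i 0 +
    2^-1 * \sum_(i < d) \sum_(k < d) (r^-1 ^+ 2 * Q i k) * (x i 0 * x k 0).
  have i2 i k c : rintegrable N (fun z => c * (Fr z * (z i 0 * z k 0 - (i == k)%:R))).
    exact: rintegrableZl.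
  have i1 i c : rintegrable N (fun z => c * (Fr z * z i 0)) by exact: rintegrableZl.
  have i22 (c : 'I_d -> 'I_d -> R) : rintegrable N (fun z => \sum_(i < d) \sum_(k < d)
     c i k * (Fr z * (z i 0 * z k 0 - (i == k)%:R))).
    by apply: rintegrable_sum => i; apply: rintegrable_sum.
  transitivity (\int[N]_z (Fr z + \sum_(i < d) (r^-1 * x i 0) * (Fr z * z i 0) +
     2^-1 * \sum_(i < d) \sum_(k < d) (r^-1 ^+ 2 * (x i 0 * x k 0)) *
       (Fr z * (z i 0 * z k 0 - (i == k)%:R)))).
    apply: eq_Rintegral => z _; rewrite quad_partE !mulrDr mulr1; congr (_ + _ + _).
      by rewrite mulr_sumr; apply: eq_bigr => i _; rewrite !mxE; ring.
    rewrite mulrCA; congr (_ * _); rewrite mulr_sumr; apply: eq_bigr => i _.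
    by rewrite mulr_sumr; apply: eq_bigr => k _; rewrite !mxE; ring.
  have iF : rintegrable N Fr by exact: bmeas_integrable.
  have is1 : rintegrable N (fun z => \sum_(i < d) (r^-1 * x i 0) * (Fr z * z i 0)).
    by apply: rintegrable_sum.
  rewrite rintD//; last 2 first.
  - exact: rintegrableD.
  - by apply: rintegrableZl; exact: i22.
  rewrite rintD// rintZl; last exact: i22.
  congr (_ + _ + _ * _).
    rewrite Rintegral_sum//; apply: eq_bigr => i _; rewrite rintZl//.
    by rewrite /be; ring.
  rewrite Rintegral_sum => [|i]; last by apply: rintegrable_sum.
  apply: eq_bigr => i _; rewrite Rintegral_sum//; apply: eq_bigr => k _.
  by rewrite rintZl// /Q; ring.
have iq : rintegrable nu q.
  apply: bmeas_integrable.
  have := @bmeas_integral _ _ _ _ _ N N (fun z : V * V => F (z.1 + r *: z.2)); apply.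
  apply: (bmeas_comp bF); apply: (@measurableT_comp _ _ _ _ _ _ (fun z : V * V => z.1 + z.2) _
    (fun z : V * V => (z.1, r *: z.2)) (@measurable_addv2 R d)).
  by apply: measurable_fun_pair => //; exact: (measurableT_comp (measurable_scalev r)).
have ic c i : rintegrable nu (fun x => c * x i 0).
  by apply: rintegrableZl; exact: rintegrable_coord.
have ics (c : 'I_d -> R) : rintegrable nu (fun x => \sum_(i < d) c i * x i 0).
  exact: rintegrable_sum.
have icc c i k : rintegrable nu (fun x => c * (x i 0 * x k 0)).
  by apply: rintegrableZl; exact: rintegrable_coordM.
have iccs (c : 'I_d -> 'I_d -> R) :
    rintegrable nu (fun x => \sum_(i < d) \sum_(k < d) c i k * (x i 0 * x k 0)).
  by apply: rintegrable_sum => i; exact: rintegrable_sum.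
have ip : rintegrable nu p.
  rewrite (funext pE : p = _).
  apply: rintegrableD; last exact: rintegrableZl.
  by apply: rintegrableD => //; exact: rintegrable_cst.
have -> : \int[N]_z F (r *: z) + 2^-1 * \sum_(i < d)
    r^-1 ^+ 2 * \int[N]_z (F (r *: z) * (z i 0 * z i 0 - 1)) = \int[nu]_x p x.
  under [RHS]eq_Rintegral do rewrite pE.
  rewrite rintD//; last 2 first.
  - by apply: rintegrableD => //; exact: rintegrable_cst.
  - exact: rintegrableZl.
  rewrite rintD//; last exact: rintegrable_cst.
  (* Zero mean kills the linear terms; identity covariance then keeps only the diagonal ones. *)
  rewrite Rintegral_cst_probability Rintegral_sum// [X in _ + X + _]big1 ?addr0; last first.
    by move=> i _; rewrite rintZl ?n1 ?mulr0//; exact: rintegrable_coord.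
  congr (_ + _); rewrite rintZl//; congr (_ * _).
  rewrite Rintegral_sum => [|i]; last exact: rintegrable_sum.
  apply: eq_bigr => i _; rewrite Rintegral_sum// (bigD1 i)//= big1 ?addr0; last first.
    move=> k ki; rewrite rintZl ?n2 1?eq_sym ?(negbTE ki) ?mulr0//.
    exact: rintegrable_coordM.
  rewrite rintZl; last exact: rintegrable_coordM.
  by rewrite n2 eqxx mulr1 /Q; congr (_ * _); apply: eq_Rintegral => z _; rewrite eqxx.
rewrite -rintB//.
apply: (@le_trans _ _ (\int[nu]_x (taylor_const * b * r^-1 ^+ 3 * norm1 x ^+ 3))).
  apply: Rintegral_dominated.
  - exact: (rintegrable_measurable (rintegrableB iq ip)).
  - exact: rintegrableZl.
  - move=> x; rewrite -/(q x) qE /p.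
    apply: (le_trans (taylor_integral (r^-1 *: x) bFr (fun z => Fb _))).
    rewrite norm1Z gtr0_norm ?invr_gt0// exprMn le_eqVlt; apply/orP; left; apply/eqP; ring.
by rewrite rintZl// -/(moment3 nu) mulrAC.
Qed.

(* After Girsanov both sides are integrals over x of the same function
   E[F (sqrt j Z) girsanov (x / sqrt j) Z], whose second-order Taylor polynomial in x has
   the same integral under nu and N; F is only assumed bounded. *)
Lemma isotropic_gaussian_comparison (nu : probability V R) j F b : isotropic3 nu ->
  (0 < j)%N -> bmeas F -> (forall x, `|F x| <= b) ->
  `|transl nu (iter j (transl N) F) 0 - transl N (iter j (transl N) F) 0| <=
  taylor_const * b * (moment3 nu + moment3 N) * (Num.sqrt j%:R)^-1 ^+ 3.
Proof.
move=> inu j0 bF Fb.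
have E (m : probability V R) : transl m (iter j (transl N) F) 0 =
    \int[m]_x (\int[N]_z F (x + Num.sqrt j%:R *: z)).
  by apply: eq_Rintegral => x _; rewrite add0r iter_gaussian.
rewrite !E; set c := \int[N]_z F (Num.sqrt j%:R *: z) + 2^-1 * \sum_(i < d)
  (Num.sqrt j%:R)^-1 ^+ 2 * \int[N]_z (F (Num.sqrt j%:R *: z) * (z i 0 * z i 0 - 1)).
have h1 := isotropic_smooth_bound inu j0 bF Fb; rewrite -/c in h1.
have h2 := isotropic_smooth_bound gaussian_isotropic3 j0 bF Fb; rewrite -/c in h2.
rewrite mulrDr mulrDl; apply: le_trans (lerD h1 h2).
set q1 := \int[nu]_x _; set q2 := \int[N]_x _.
by rewrite (_ : q1 - q2 = (q1 - c) - (q2 - c)) ?ler_normB//; ring.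
Qed.

End isotropic.

(** * Convex sets and Gaussian shells *)

Section convex_open.
Context {R : realType} {d : nat}.
Local Notation V := 'cV[R]_d.
Implicit Types (A B : set V) (x y v : V) (h : R) (s : seq 'I_d).

Definition convexv A := forall x y t, A x -> A y -> 0 <= t -> t <= 1 ->
  A (t *: x + (1 - t) *: y).

Definition openv A := forall x, A x -> exists2 e : R, 0 < e &
  forall y, (forall i, `|y i 0 - x i 0| < e) -> A y.

Lemma convex_set_convexv A : convex_set A -> convexv A.
Proof.
move=> cA x y t Ax Ay t0 t1.
have tp : Itv.spec (Itv.num_sem (R:=R)) (Itv.Real `[0, 1]%Z) t.
  by rewrite /Itv.num_sem /= num_real /= in_itv /= t0 t1.
by have := cA x y (Itv.mk tp); rewrite !inE => /(_ Ax Ay).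
Qed.

(** A is the union of the cubes with rational centre and radius that it contains; [unpickle]
    enumerates them. *)
Lemma measurable_openv A : openv A -> measurable A.
Proof.
move=> oA.
pose cube (q : 'cV[rat]_d) (r : rat) : set V :=
  box (fun i => `]ratr (q i 0) - ratr r, ratr (q i 0) + ratr r[%classic).
pose F (n : nat) : set V := if @unpickle ('cV[rat]_d * rat)%type n is Some (q, r)
  then if `[< cube q r `<=` A >] then cube q r else set0 else set0.
rewrite (_ : A = \bigcup_n F n).
  apply: bigcupT_measurable => n; rewrite /F.
  by case: unpickle => [[q r]|]//; case: ifP => // _; exact: measurable_box.
apply/seteqP; split => x; last first.
  by move=> [n _]; rewrite /F; case: unpickle => [[q r]|]//; case: asboolP => // qA /qA.
move=> /oA[e e0 hA].
have e2 : 0 < e / 2 by rewrite divr_gt0.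
have [r] := rat_in_itvoo e2; rewrite in_itv /= => /andP[r0 re].
have hq i : exists q : rat, `|ratr q - x i 0| < ratr r.
  have xr : x i 0 - ratr r < x i 0 + ratr r by lra.
  have [q] := rat_in_itvoo xr; rewrite in_itv /= => /andP[h1 h2]; exists q.
  by rewrite ltr_norml; apply/andP; split; lra.
pose q : 'cV[rat]_d := \col_i xchoose (hq i).
have qx i : `|ratr (q i 0) - x i 0| < ratr r by rewrite mxE; exact: (xchooseP (hq i)).
exists (pickle (q, r)) => //; rewrite /F pickleK; case: asboolP => [_|[]].
  move=> i /=; rewrite in_itv /=.
  by have := qx i; rewrite ltr_norml => /andP[? ?]; apply/andP; split; lra.
move=> y yq; apply: hA => i; have := yq i; rewrite /= in_itv /= => /andP[h1 h2].
have := qx i; rewrite ltr_norml => /andP[h3 h4].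
by rewrite ltr_norml; apply/andP; split; lra.
Qed.

Lemma convexv_preimage_affine A (c : R) (b : V) : convexv A -> convexv [set x | A (b + c *: x)].
Proof.
move=> cA x y t /= Ax Ay t0 t1; have := cA _ _ t Ax Ay t0 t1; congr A.
by apply/matrixP => i j; rewrite !mxE; ring.
Qed.

Lemma openv_preimage_affine A (c : R) (b : V) : openv A -> openv [set x | A (b + c *: x)].
Proof.
move=> oA x /= /oA[e e0 h]; exists (e / (`|c| + 1)).
  by rewrite divr_gt0// ltr_wpDl.
move=> y yx; apply: h => i; rewrite !mxE.
rewrite (_ : _ - _ = c * (y i 0 - x i 0)); last by ring.
have := yx i; rewrite ltr_pdivlMr ?ltr_wpDl// => h.
rewrite normrM; have := normr_ge0 c; have := normr_ge0 (y i 0 - x i 0); nra.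
Qed.

Lemma convexvI A B : convexv A -> convexv B -> convexv (A `&` B).
Proof.
by move=> cA cB x y t [Ax Bx] [Ay By] t0 t1; split; [exact: cA|exact: cB].
Qed.

Lemma openvI A B : openv A -> openv B -> openv (A `&` B).
Proof.
move=> oA oB x [/oA[e e0 hA] /oB[f f0 hB]]; exists (Num.min e f).
  by rewrite lt_min e0.
by move=> y yx; split; [apply: hA|apply: hB] => i; have := yx i; rewrite lt_min => /andP[].
Qed.

(** For convex B, containing both ends of a segment amounts to containing the segment. Erosion by a
    cube can thus be composed of intersections of two translates, which keep convexity and openness
    and lose mass only in two shells. *)
Definition erode1 (j : 'I_d) h B : set V :=
  [set x | B (h *: delta_mx j 0 + 1 *: x)] `&` [set x | B (- h *: delta_mx j 0 + 1 *: x)].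

Definition erode s h B : set V := foldr (fun j X => erode1 j h X) B s.

Lemma convexv_erode s h B : convexv B -> convexv (erode s h B).
Proof.
move=> cB; elim: s => [//|j s IH] /=.
by apply: convexvI; exact: convexv_preimage_affine.
Qed.

Lemma openv_erode s h B : openv B -> openv (erode s h B).
Proof.
move=> oB; elim: s => [//|j s IH] /=.
by apply: openvI; exact: openv_preimage_affine.
Qed.

Lemma erodeS s h A B : A `<=` B -> erode s h A `<=` erode s h B.
Proof. by move=> AB; elim: s => [//|j s IH] x /= [h1 h2]; split; exact: IH. Qed.

(** Coordinate j of v is interpolated between -h and h; the remaining coordinates are left to the
    induction. *)
Lemma erode_cube s h B x v : 0 < h -> convexv B -> erode s h B x ->
  (forall i, `|v i 0| <= h) -> (forall i, i \notin s -> v i 0 = 0) -> B (x + v).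
Proof.
move=> h0 cB; elim: s x v => [|j s IH] x v /= hx hv v0.
  suff -> : v = 0 by rewrite addr0.
  by apply/matrixP => i k; rewrite mxE ord1; exact: v0.
case: hx => /= h1 h2.
pose w : V := \col_i (if i == j then 0 else v i 0).
have hw i : `|w i 0| <= h by rewrite mxE; case: ifP => // _; rewrite normr0 ltW.
have w0 i : i \notin s -> w i 0 = 0.
  by move=> si; rewrite mxE; case: eqVneq => // ij; apply: v0; rewrite inE negb_or ij.
have B1 := IH _ _ h1 hw w0; have B2 := IH _ _ h2 hw w0.
have := hv j; rewrite ler_norml => /andP[vj1 vj2].
have t0 : 0 <= (h + v j 0) / (2 * h) by rewrite divr_ge0//; lra.
have t1 : (h + v j 0) / (2 * h) <= 1 by rewrite ler_pdivrMr; lra.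
have := cB _ _ _ B1 B2 t0 t1; congr B; apply/matrixP => i k; rewrite !mxE ord1 eqxx andbT.
by case: eqVneq => [->|_]; rewrite ?mulr1n ?mulr0n; field; rewrite gt_eqF.
Qed.

(** Dilation in the directions of s only, so that dilation and erosion can be undone one coordinate
    at a time. *)
Definition dilate_on s h A : set V := [set x | exists2 a, A a &
  (forall i, i \in s -> `|x i 0 - a i 0| < h) /\ (forall i, i \notin s -> x i 0 = a i 0)].

Lemma convexv_dilate_on s h A : convexv A -> convexv (dilate_on s h A).
Proof.
move=> cA x y t [a Aa [xa1 xa2]] [b Ab [yb1 yb2]] t0 t1.
exists (t *: a + (1 - t) *: b); first exact: cA.
split => i si; rewrite !mxE; last by rewrite xa2// yb2.
rewrite (_ : _ - _ = t * (x i 0 - a i 0) + (1 - t) * (y i 0 - b i 0)); last by ring.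
set p := x i 0 - a i 0; set q := y i 0 - b i 0; pose M := Num.max `|p| `|q|.
have pM : `|p| <= M by rewrite le_max lexx.
have qM : `|q| <= M by rewrite le_max lexx orbT.
apply: (@le_lt_trans _ _ M); last by rewrite gt_max; apply/andP; split; [exact: xa1|exact: yb1].
rewrite (le_trans (ler_normD _ _))// !normrM (ger0_norm t0) (@ger0_norm _ (1 - t)); last lra.
nra.
Qed.

(** The points x + 2 h e_j and x - 2 h e_j lie within h, in direction j, of points a and b of A that
    agree with x elsewhere. Then a and b are on opposite sides of x, and convexity puts x in A. *)
Lemma erode_dilate_on s h A : 0 < h -> convexv A -> erode s (2 * h) (dilate_on s h A) `<=` A.
Proof.
move=> h0; elim: s A => [|j s IH] A cA x /=.
  move=> [a Aa [_ xa]]; suff -> : x = a by [].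
  by apply/matrixP => i k; rewrite ord1; exact: xa.
have sub : dilate_on (j :: s) h A `<=` dilate_on s h (dilate_on [:: j] h A).
  move=> y [a Aa [ya1 ya2]].
  exists (\col_i (if i == j then y j 0 else a i 0)).
    exists a => //; split => i; rewrite inE mxE.
      by move=> /eqP ->; rewrite eqxx; apply: ya1; rewrite inE eqxx.
    by move=> /negbTE ->.
  split => i si; rewrite mxE.
    by case: eqVneq => [->|_]; [rewrite subrr normr0|apply: ya1; rewrite inE si orbT].
  by case: eqVneq => [->//|ij]; apply: ya2; rewrite inE negb_or ij.
have cD : convexv (dilate_on [:: j] h A) by exact: convexv_dilate_on.
move=> [/= /(erodeS sub)/(IH _ cD)[a Aa [xa1 xa2]] /(erodeS sub)/(IH _ cD)[b Ab [xb1 xb2]]].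
have := xa1 j (mem_head _ _); have := xb1 j (mem_head _ _).
rewrite !mxE !eqxx !mulr1 !mul1r !ltr_norml => /andP[b1 b2] /andP[a1 a2].
have ab : 0 < a j 0 - b j 0 by lra.
pose t := (x j 0 - b j 0) / (a j 0 - b j 0).
have t0 : 0 <= t by rewrite divr_ge0//; lra.
have t1 : t <= 1 by rewrite ler_pdivrMr//; lra.
have := cA _ _ t Aa Ab t0 t1; congr A; apply/matrixP => i k; rewrite ord1 !mxE.
have [->|ij] := eqVneq i j; first by rewrite /t; field; rewrite gt_eqF.
have := xa2 i; have := xb2 i; rewrite !inE !mxE (negbTE ij) /= !mulr0 !add0r mul1r.
by move=> /(_ isT) <- /(_ isT) <-; ring.
Qed.

Definition dilate h A : set V := [set x | exists2 a, A a & forall i, `|x i 0 - a i 0| < h].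

Lemma dilateE h A : dilate h A = dilate_on (enum 'I_d) h A.
Proof.
apply/seteqP; split => x [a Aa].
  by move=> xa; exists a => //; split => i; rewrite mem_enum.
by move=> [xa _]; exists a => // i; apply: xa; rewrite mem_enum.
Qed.

Lemma convexv_dilate h A : convexv A -> convexv (dilate h A).
Proof. by move=> cA; rewrite dilateE; exact: convexv_dilate_on. Qed.

Lemma openv_dilate h A : 0 < h -> openv (dilate h A).
Proof.
move=> h0 x [a Aa xa].
have [e e0 he] : exists2 e : R, 0 < e & forall i, `|x i 0 - a i 0| + e <= h.
  exists (\big[Num.min/1]_(i < d) (h - `|x i 0 - a i 0|)).
    by apply/bigmin_gtP; split => // i _; rewrite subr_gt0.
  by move=> i; rewrite addrC -lerBrDr; exact: bigmin_le_cond.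
exists e => // y yx; exists a => // i.
rewrite -(subrKA (x i 0)) (le_lt_trans (ler_normD _ _))//.
by have := yx i; have := he i; lra.
Qed.

Lemma erode_dilate h A : 0 < h -> convexv A -> erode (enum 'I_d) (2 * h) (dilate h A) `<=` A.
Proof. by move=> h0 cA; rewrite dilateE; exact: erode_dilate_on. Qed.

Lemma sub_dilate h A : 0 < h -> A `<=` dilate h A.
Proof. by move=> h0 x Ax; exists x => // i; rewrite subrr normr0. Qed.

End convex_open.

Lemma sum_indicator_le1 {R : realType} (I : finType) (chi : I -> bool) :
  (forall i j, chi i -> chi j -> i = j) -> \sum_i (chi i)%:R <= 1 :> R.
Proof.
move=> h; have [/existsP[i ci]|/existsPn hn] := boolP [exists i, chi i].
  rewrite (bigD1 i)//= ci big1 ?addr0// => j ji.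
  by case: (boolP (chi j)) => // cj; rewrite (h _ _ ci cj) eqxx in ji.
by rewrite big1// => i _; rewrite (negbTE (hn i)).
Qed.

Lemma le_rint {dT} {T : measurableType dT} {R : realType} (P : probability T R) (f g : T -> R) :
  rintegrable P f -> rintegrable P g -> (forall x, f x <= g x) ->
  \int[P]_x f x <= \int[P]_x g x.
Proof. by move=> hf hg fg; apply: le_Rintegral => // x _; exact: fg. Qed.

Lemma eq_indic {S T : Type} {R : pzRingType} (A : set S) (B : set T) x y :
  (A x <-> B y) -> \1_A x = \1_B y :> R.
Proof.
move=> AB; rewrite !indicE; congr (_%:R); congr nat_of_bool.
by apply/idP/idP; rewrite !inE => /AB.
Qed.

Section gaussian_shell.
Context {R : realType} {d : nat}.
Local Notation V := 'cV[R]_d.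
Variable N : probability V R.
Hypothesis gN : std_gaussian N.
Implicit Types (A B : set V) (v : V) (h : R).

Let measurable_shift B v : measurable B -> measurable [set z | B (v + z)].
Proof.
by move=> mB; rewrite -[X in measurable X]setTI; exact: measurable_addv.
Qed.

Lemma dotvZZ (c : R) v : dotv (c *: v) (c *: v) = c ^+ 2 * dotv v v.
Proof. by rewrite /dotv mulr_sumr; apply: eq_bigr => i _; rewrite !mxE; ring. Qed.

(** exp (u.z) + exp (- u.z) is at least 2, and the common factor exp (- |u|^2 / 2) is at least 1 /
    2. *)
Lemma girsanov_pair (u z : V) : dotv u u <= 1 -> 1 <= girsanov u z + girsanov (- u) z.
Proof.
move=> u1; rewrite !girsanovE.
have -> : dotv (- u) (- u) = dotv u u by rewrite -scaleN1r dotvZZ sqrrN expr1n mul1r.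
have -> : dotv (- u) z = - dotv u z.
  by rewrite /dotv -sumrN; apply: eq_bigr => i _; rewrite mxE mulNr.
rewrite !expRD -mulrDl.
have h1 := expR_ge1Dx (dotv u z); have h2 := expR_ge1Dx (- dotv u z).
have h3 := expR_ge1Dx (- (dotv u u / 2)).
by nra.
Qed.

(* By convexity a line in direction v leaves B at most once, so the translates of the
   shell by multiples of v are disjoint; the Girsanov densities of the translations by
   u and - u add up to at least 1, so about 1 / h of these translates keep half its mass. *)
Lemma gaussian_shell v h B : 0 < h -> dotv v v <= h ^+ 2 -> convexv B -> measurable B ->
  \int[N]_z \1_(B `\` [set z | B (v + z)]) z <= 2 * h.
Proof.
move=> h0 vh cB mB; set E0 := B `\` _.
have mE0 : measurable E0 by apply: measurableD => //; exact: measurable_shift.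
have bE0 : bmeas (\1_E0 : V -> R) by exact: bmeas_indic.
set p0 := \int[N]_z _.
have p01 : p0 <= 1.
  rewrite -[leRHS](Rintegral_cst_probability N); apply: le_rint.
  - exact: bmeas_integrable.
  - exact: rintegrable_cst.
  - by move=> x; rewrite indicE; case: (_ \in _).
have [h1|h1] := leP 1 h; first lra.
pose K := Num.truncn (h^-1).
have /andP[Kh hK] : (K%:R <= h^-1 < K.+1%:R) by apply: Num.Theory.truncn_itv; rewrite invr_ge0 ltW.
have K0 : (0 < K)%N.
  rewrite lt0n; apply/eqP => K0; move: hK; rewrite K0 invf_lt1//; lra.
suff HK : K%:R * p0 <= 1.
  have K1 : 1 <= K%:R :> R by rewrite ler1n.
  have : h^-1 < 2 * K%:R by rewrite (lt_le_trans hK)// -natr1; lra.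
  rewrite invf_plt ?posrE ?mulr_gt0 ?ltr0n// => Kh2.
  have p0K : p0 <= K%:R^-1 by rewrite -[leRHS]mul1r ler_pdivlMr ?ltr0n// mulrC.
  rewrite invfM in Kh2; lra.
pose c (p : 'I_K * bool) : int := if p.2 then (p.1.+1)%:Z else - (p.1.+1)%:Z.
have cinj p q : c p = c q -> p = q.
  move: p q => [i b] [j b']; rewrite /c /=.
  move=> ij; have [bb ij'] : b = b' /\ (i = j :> nat) by move: ij; case: b; case: b' => /=; lia.
  by rewrite bb; congr (_, _); exact: val_inj.
have shiftE u : \int[N]_z \1_E0 (u + z) = \int[N]_z (\1_E0 z * girsanov u z).
  exact: (gaussian_shift gN u bE0).
have bsh (u : V) : bmeas (fun z : V => \1_E0 (u + z) : R) by exact: (bmeas_comp bE0 (measurable_addv u)).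
have step : \int[N]_z (\sum_(p : 'I_K * bool) \1_E0 ((c p)%:~R *: v + z)) <= 1.
  rewrite -[leRHS](Rintegral_cst_probability N); apply: le_rint.
  - by apply: rintegrable_sum => p; exact: bmeas_integrable.
  - exact: rintegrable_cst.
  - move=> z; under eq_bigr do rewrite indicE.
    apply: sum_indicator_le1 => p q; rewrite !inE => hp hq; apply: cinj.
    wlog pq : p q hp hq / (c p < c q)%R.
      move=> H; case: (ltgtP (c p) (c q)) => // pq; first exact: (H p q).
      by apply/esym; exact: (H q p).
    case: hp => Bp; case: hq => Bq _ /=; case.
    have hpq : (c p)%:~R + 1 <= (c q)%:~R :> R by rewrite -(@intrD R _ 1) ler_int; lia.
    set a : R := (c p)%:~R in Bp hpq *; set b : R := (c q)%:~R in Bq hpq *.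
    have t0 : 0 <= (b - a - 1) / (b - a) by rewrite divr_ge0//; lra.
    have t1 : (b - a - 1) / (b - a) <= 1 by rewrite ler_pdivrMr; lra.
    have := cB _ _ _ Bp Bq t0 t1; congr B; apply/matrixP => i j; rewrite !mxE; field.
    by rewrite gt_eqF//; lra.
apply: (le_trans _ step).
rewrite (Rintegral_sum (P := N)) => [|p]; last exact: bmeas_integrable.
rewrite -(pair_bigA _ (fun i b => \int[N]_z \1_E0 ((c (i, b))%:~R *: v + z)))/=.
rewrite -[K in leLHS]card_ord mulr_natl -sumr_const; apply: ler_sum => i _.
rewrite big_bool /= /c /= !shiftE.
set u := (i.+1)%:Z%:~R *: v.
have -> : (- (i.+1)%:Z)%:~R *: v = - u by rewrite /u intrN scaleNr.
have ig w : rintegrable N (fun z => \1_E0 z * girsanov w z).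
  by apply: rintegrable_bmeasM => //; exact: girsanov_integrable.
rewrite -(rintD (ig u) (ig (- u))).
apply: le_rint.
- exact: (bmeas_integrable N bE0).
- exact: rintegrableD.
move=> z; rewrite -mulrDr; apply: ler_peMr; first by rewrite indicE.
(* Multiples of v up to K <= 1 / h have length at most 1; this is what limits the number of
   translates. *)
apply: girsanov_pair; rewrite /u dotvZZ.
have iK : (i.+1)%:~R <= K%:R :> R by rewrite ler_nat ltn_ord.
have i0 : 0 <= (i.+1)%:~R :> R by rewrite ler0n.
apply: (@le_trans _ _ ((h^-1) ^+ 2 * h ^+ 2)).
  apply: ler_pM; [exact: sqr_ge0|exact: dotv_ge0| |exact: vh].
  by rewrite lerXn2r ?nnegrE ?invr_ge0 ?(ltW h0)// (le_trans iK).
by rewrite -exprMn mulVf ?expr1n// gt_eqF.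
Qed.

Definition gauss_sum n B : R := iter n (transl N) \1_B 0.

Lemma gauss_sumE n B : measurable B ->
  gauss_sum n B = \int[N]_z \1_B (Num.sqrt n%:R *: z).
Proof.
move=> mB; rewrite /gauss_sum (iter_gaussian gN); last exact: bmeas_indic.
by apply: eq_Rintegral => z _; rewrite add0r.
Qed.

Let bscale n B : measurable B -> bmeas (fun z : V => \1_B (Num.sqrt n%:R *: z) : R).
Proof.
by move=> mB; exact: (bmeas_comp (bmeas_indic mB) (measurable_scalev _)).
Qed.

(** Division by sqrt n turns a shell of width h for the n-step sum into one of width h / sqrt n for
    N. *)
Lemma gauss_sum_shell n v h B : (0 < n)%N -> 0 < h -> dotv v v <= h ^+ 2 ->
  convexv B -> measurable B ->
  \int[N]_z \1_(B `\` [set y | B (v + y)]) (Num.sqrt n%:R *: z) <= 2 * h / Num.sqrt n%:R.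
Proof.
move=> n0 h0 vh cB mB; set r := Num.sqrt n%:R.
have r0 : 0 < r by rewrite sqrtr_gt0 ltr0n.
have cBr : convexv [set z | B (0 + r *: z)] by exact: convexv_preimage_affine.
have mBr : measurable [set z | B (0 + r *: z)].
  rewrite -[X in measurable X]setTI; under eq_fun do rewrite add0r.
  exact: measurable_scalev.
have := @gaussian_shell (r^-1 *: v) (h / r) _ _ _ cBr mBr.
rewrite dotvZZ mulrA => H; apply: le_trans (H _ _).
- rewrite le_eqVlt; apply/orP; left; apply/eqP; apply: eq_Rintegral => z _.
  by apply: eq_indic; rewrite /= !add0r scalerDr scalerA divff ?scale1r// gt_eqF.
- by rewrite divr_gt0.
- by rewrite exprMn [leRHS]mulrC ler_wpM2l// sqr_ge0.
Qed.

(** A point lost by the erosion lies in the shell of B for h e_j or in the one for - h e_j, each of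
    mass at most 2 h / sqrt n. *)
Lemma gauss_sum_erode1 n j h B : (0 < n)%N -> 0 < h -> convexv B -> measurable B ->
  measurable (erode1 j h B) ->
  gauss_sum n B <= gauss_sum n (erode1 j h B) + 4 * h / Num.sqrt n%:R.
Proof.
move=> n0 h0 cB mB mE; rewrite !gauss_sumE//; set r := Num.sqrt n%:R.
pose e : V := h *: delta_mx j 0.
have he : dotv e e <= h ^+ 2 by rewrite dotvZZ dotv_delta mxE !eqxx mulr1.
have hNe : dotv (- e) (- e) <= h ^+ 2.
  by rewrite -scaleN1r dotvZZ sqrrN expr1n mul1r.
have S1 := gauss_sum_shell n0 h0 he cB mB.
have S2 := gauss_sum_shell n0 h0 hNe cB mB.
have b1 := bscale n (measurableD mB (measurable_shift e mB)).
have b2 := bscale n (measurableD mB (measurable_shift (- e) mB)).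
have b3 := bscale n mE.
apply: (@le_trans _ _ (\int[N]_z (\1_(erode1 j h B) (r *: z) +
  (\1_(B `\` [set y | B (e + y)]) (r *: z) + \1_(B `\` [set y | B (- e + y)]) (r *: z))))).
  apply: le_rint.
  - exact: (bmeas_integrable N (bscale n mB)).
  - by apply: bmeas_integrable; apply: bmeasD => //; exact: bmeasD.
  move=> z; rewrite !indicE.
  case: (boolP (r *: z \in B)) => zB; last by rewrite !addr_ge0.
  case: (boolP (r *: z \in B `\` [set y | B (e + y)])) => z1.
    by rewrite addrCA lerDl addr_ge0.
  case: (boolP (r *: z \in B `\` [set y | B (- e + y)])) => z2.
    by rewrite addrA lerDr addr_ge0.
  rewrite mem_set ?lerDl//; split => /=; rewrite scale1r ?scaleNr; apply: contrapT => h';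
    [move/negP: z1|move/negP: z2]; rewrite inE; apply; split => //; exact: set_mem.
rewrite (rintD (P := N)); [|exact: (bmeas_integrable N b3)|exact: (bmeas_integrable N (bmeasD b1 b2))].
rewrite (rintD (P := N)); [|exact: (bmeas_integrable N b1)|exact: (bmeas_integrable N b2)].
rewrite lerD2l; apply: (le_trans (lerD S1 S2)); rewrite -mulrDl -mulrDl.
by rewrite le_eqVlt; apply/orP; left; apply/eqP; congr (_ * _ / _); ring.
Qed.

Lemma gauss_sum_erode n s h B : (0 < n)%N -> 0 < h -> convexv B -> openv B ->
  gauss_sum n B <= gauss_sum n (erode s h B) + (size s)%:R * (4 * h / Num.sqrt n%:R).
Proof.
move=> n0 h0 cB oB; elim: s => [|j s IH] /=; first by rewrite mul0r addr0.
apply: (le_trans IH).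
have ce : convexv (erode s h B) by exact: convexv_erode.
have oe : openv (erode s h B) by exact: openv_erode.
have := @gauss_sum_erode1 n j h _ n0 h0 ce (measurable_openv oe)
  (measurable_openv (openv_erode (s := [:: j]) (h := h) oe)).
rewrite -natr1 mulrDl mul1r; lra.
Qed.

Lemma gauss_sum_transl_ge n v h B : (0 < n)%N -> 0 < h -> dotv v v <= h ^+ 2 ->
  convexv B -> measurable B ->
  gauss_sum n B - 2 * h / Num.sqrt n%:R <= iter n (transl N) \1_B v.
Proof.
move=> n0 h0 vh cB mB; have S1 := gauss_sum_shell n0 h0 vh cB mB.
rewrite lerBlDr gauss_sumE// (iter_gaussian gN); last exact: bmeas_indic.
apply: le_trans (lerD (lexx _) S1); set r := Num.sqrt n%:R.
have b1 := bscale n (measurableD mB (measurable_shift v mB)).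
have b2 : bmeas (fun z : V => \1_B (v + r *: z) : R).
  exact: (bmeas_comp (bmeas_shift v (bmeas_indic mB)) (measurable_scalev r)).
rewrite -(rintD (P := N)); [|exact: (bmeas_integrable N b2)|exact: (bmeas_integrable N b1)].
apply: le_rint.
- exact: (bmeas_integrable N (bscale n mB)).
- exact: (bmeas_integrable N (bmeasD b2 b1)).
move=> z; rewrite !indicE.
case: (boolP (r *: z \in B)) => zB; last by rewrite addr_ge0.
case: (boolP (v + r *: z \in B)) => z1; first by rewrite lerDl.
by rewrite mem_set ?lerDr//; split; [exact: set_mem|move=> /= /mem_set; exact/negP].
Qed.

(** The opposite inequality for the translated set, shifted back by - v. *)
Lemma gauss_sum_transl_le n v h B : (0 < n)%N -> 0 < h -> dotv v v <= h ^+ 2 ->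
  convexv B -> measurable B ->
  iter n (transl N) \1_B v <= gauss_sum n B + 2 * h / Num.sqrt n%:R.
Proof.
move=> n0 h0 vh cB mB; pose B' := [set y | B (v + 1 *: y)].
have cB' : convexv B' by exact: convexv_preimage_affine.
have mB' : measurable B'.
  by rewrite /B'; under eq_fun do rewrite scale1r; exact: measurable_shift.
have hNv : dotv (- v) (- v) <= h ^+ 2 by rewrite -scaleN1r dotvZZ sqrrN expr1n mul1r.
have := gauss_sum_transl_ge n0 h0 hNv cB' mB'.
have E : (\1_B' : V -> R) = fun y => \1_B (v + y).
  by apply/funext => y; apply: eq_indic; rewrite /B' /= scale1r.
rewrite /gauss_sum E !iter_transl_shift addr0 subrr; lra.
Qed.

End gaussian_shell.

(** * Berry-Esseen bound over convex sets *)

Section smoothing.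
Context {R : realType} {d : nat}.
Local Notation V := 'cV[R]_d.
Variables N mu : probability V R.
Hypotheses (gN : std_gaussian N) (hd : (0 < d)%N).
Implicit Types (A B : set V).

Lemma iter_transl_mono (nu : probability V R) n (f g : V -> R) : bmeas f -> bmeas g ->
  (forall x, f x <= g x) -> forall x, iter n (transl nu) f x <= iter n (transl nu) g x.
Proof.
move=> bf bg fg; elim: n => [//|n IH] x; rewrite !iterS; apply: le_rint => //.
- by apply: bmeas_integrable; apply: bmeas_shift; exact: bmeas_iter.
- by apply: bmeas_integrable; apply: bmeas_shift; exact: bmeas_iter.
Qed.

Lemma iter_transl_bound (nu : probability V R) n (f : V -> R) M : bmeas f ->
  (forall x, `|f x| <= M) -> forall x, `|iter n (transl nu) f x| <= M.
Proof.
move=> bf fM; elim: n => [//|n IH] x; rewrite iterS; apply: transl_bound => //.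
exact: (bmeas_iter nu n bf).1.
Qed.

Definition walk_sum n A : R := iter n (transl mu) \1_A 0.

Definition walk_dist n A : R := `|walk_sum n A - gauss_sum N n A|.

Lemma noise_tail (r : R) : 0 < r ->
  \int[N]_z (1 - \1_[set z : V | forall i, `|z i 0| <= r] z) <= d%:R / r ^+ 2.
Proof.
move=> r0; set H := [set z | _].
have mH : measurable H.
  rewrite (_ : H = box (fun=> `[- r, r]%classic)); first exact: measurable_box.
  by apply/seteqP; split => z h i; have := h i; rewrite /= in_itv /= ler_norml.
have [g3 _ g2] := gaussian_isotropic3 gN.
have ic i : rintegrable N (fun z : V => (r ^+ 2)^-1 * (z i 0 * z i 0)).
  by apply: rintegrableZl; exact: rintegrable_coordM.
apply: (@le_trans _ _ (\int[N]_z (\sum_(i < d) (r ^+ 2)^-1 * (z i 0 * z i 0)))).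
  apply: le_rint.
  - by apply: bmeas_integrable; apply: bmeasB; [exact: bmeas_cst|exact: bmeas_indic].
  - exact: rintegrable_sum.
  move=> z; rewrite indicE.
  have s0 : 0 <= \sum_(i < d) (r ^+ 2)^-1 * (z i 0 * z i 0).
    by apply: sumr_ge0 => i _; rewrite mulr_ge0 ?invr_ge0 ?sqr_ge0// -expr2 sqr_ge0.
  case: (boolP (z \in H)) => zH; first by rewrite subrr.
  have [i] : exists i, ~ `|z i 0| <= r by apply/existsNP; move: zH; rewrite notin_setE.
  move=> /negP; rewrite -ltNge subr0 => zi.
  rewrite (bigD1 i)//= ler_wpDr//.
    by apply: sumr_ge0 => k _; rewrite mulr_ge0 ?invr_ge0 ?sqr_ge0// -expr2 sqr_ge0.
  rewrite mulrC ler_pdivlMr ?exprn_gt0// mul1r -expr2 -(real_normK (num_real (z i 0))).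
  by apply: lerXn2r; rewrite ?nnegrE// ltW.
rewrite Rintegral_sum// (eq_bigr (fun=> (r ^+ 2)^-1)).
  by rewrite sumr_const card_ord -[leLHS]mulr_natl.
by move=> i _; rewrite rintZl ?g2 ?eqxx ?mulr1//; exact: rintegrable_coordM.
Qed.

(** Removes m Gaussian steps of noise. Where the noise is moderate, enlarging or shrinking A by its
    size gives a one-sided comparison; elsewhere only delta is available, but with weight 1 / 4. The
    resulting coefficient 1 / 2 of delta is below 1, so delta can later be absorbed. *)
Lemma smoothing n m (delta D : R) : (0 < n)%N -> (0 < m)%N ->
  (forall A, convexv A -> openv A -> walk_dist n A <= delta) ->
  (forall A, convexv A -> openv A ->
    `|iter n (transl mu) (iter m (transl N) \1_A) 0 - iter (n + m) (transl N) \1_A 0| <= D) ->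
  forall A, convexv A -> openv A ->
    walk_dist n A <= D + 36 * d%:R ^+ 2 * (Num.sqrt m%:R / Num.sqrt n%:R) + delta / 2.
Proof.
move=> n0 m0 hdelta hD A cA oA.
set sm := Num.sqrt m%:R; set sn := Num.sqrt n%:R.
have sm0 : 0 < sm by rewrite sqrtr_gt0 ltr0n.
have sn0 : 0 < sn by rewrite sqrtr_gt0 ltr0n.
have d1 : 1 <= d%:R :> R by rewrite ler1n.
(* If all coordinates of z are at most 2 d, the noise sm z stays in the cube of half-side eta. By
   Chebyshev the exceptional mass is at most d / (2 d)^2 <= 1 / 4. *)
pose eta := 2 * d%:R * sm.
have eta0 : 0 < eta by rewrite !mulr_gt0// lt_neqAle; lra.
pose r : R := 2 * d%:R.
have r0 : 0 < r by rewrite mulr_gt0//; lra.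
pose H := [set z : V | forall i, `|z i 0| <= r].
have mA := measurable_openv oA.
have mH : measurable H.
  rewrite (_ : H = box (fun=> `[- r, r]%classic)); first exact: measurable_box.
  by apply/seteqP; split => z h i; have := h i; rewrite /= in_itv /= ler_norml.
have Hv z : H z -> forall i, `|(sm *: z) i 0| <= eta.
  by move=> Hz i; rewrite mxE normrM gtr0_norm// /eta mulrC ler_wpM2r ?(ltW sm0).
have Hdot z : H z -> dotv (sm *: z) (sm *: z) <= (d%:R * eta) ^+ 2.
  move=> Hz; rewrite /dotv; apply: (@le_trans _ _ (\sum_(i < d) eta ^+ 2)).
    apply: ler_sum => i _; rewrite -expr2 -(real_normK (num_real _)).
    by rewrite lerXn2r ?nnegrE ?(ltW eta0)//; exact: Hv.
  rewrite sumr_const card_ord -[leLHS]mulr_natl [leRHS]exprMn ler_wpM2r ?sqr_ge0// expr2; nra.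
have deta0 : 0 < d%:R * eta by rewrite mulr_gt0//; lra.
have tail : \int[N]_z (1 - \1_H z) <= 1 / 4.
  apply: (le_trans (noise_tail r0)); rewrite /r exprMn.
  have d0 : 0 < d%:R :> R by lra.
  have dd0 : 0 < (2 : R) ^+ 2 * d%:R ^+ 2 by rewrite mulr_gt0 ?exprn_gt0.
  rewrite ler_pdivrMr//; nra.
have delta0 : 0 <= delta by apply: le_trans (hdelta A cA oA); exact: normr_ge0.
pose X B y := iter n (transl mu) \1_B y - iter n (transl N) \1_B y.
have bX B : measurable B -> bmeas (X B).
  by move=> mB; apply: bmeasB; apply: bmeas_iter; exact: bmeas_indic.
have bXs B : measurable B -> bmeas (fun z : V => X B (sm *: z)).
  by move=> mB; exact: (bmeas_comp (bX B mB) (measurable_scalev sm)).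
have Xdelta B y : convexv B -> openv B -> `|X B y| <= delta.
  move=> cB oB; pose B' := [set x | B (y + 1 *: x)].
  have cB' : convexv B' by exact: convexv_preimage_affine.
  have oB' : openv B' by exact: openv_preimage_affine.
  have := hdelta B' cB' oB'.
  rewrite /walk_dist /walk_sum /gauss_sum.
  have -> : (\1_B' : V -> R) = fun x => \1_B (y + x).
    by apply/funext => x; apply: eq_indic; rewrite /B' /= scale1r.
  by rewrite !iter_transl_shift addr0.
have XE B : convexv B -> openv B -> `|\int[N]_z X B (sm *: z)| <= D.
  move=> cB oB; have := hD B cB oB; have bB := bmeas_indic (R := R) (measurable_openv oB).
  rewrite addnC iterD iter2_translC//.
  have -> : iter m (transl N) (iter n (transl mu) \1_B) 0 -
      iter m (transl N) (iter n (transl N) \1_B) 0 = iter m (transl N) (X B) 0.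
    by rewrite iter_translB//; exact: bmeas_iter.
  rewrite (iter_gaussian gN); last by apply: bX; exact: measurable_openv.
  by under eq_Rintegral do rewrite add0r.
have i1H : rintegrable N (fun z : V => 1 - \1_H z).
  by apply: bmeas_integrable; apply: bmeasB; [exact: bmeas_cst|exact: bmeas_indic].
pose x := walk_sum n A - gauss_sum N n A.
have xdelta : `|x| <= delta by exact: hdelta.
pose kap := d%:R * (eta / sn).
have kap0 : 0 < kap by rewrite mulr_gt0 ?divr_gt0//; lra.
have kapE : 2 * (d%:R * eta) / sn = 2 * kap by rewrite /kap; ring.
have kap36 : 36 * d%:R ^+ 2 * (sm / sn) = 18 * kap by rewrite /kap /eta; ring.
have H01 z : 0 <= 1 - \1_H z :> R by rewrite indicE; case: (_ \in _); rewrite ?subrr ?subr0.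
have up : x <= D + 18 * kap + delta / 2.
  (* Dilation is strict, so 2 eta leaves room for noise of size eta. Returning from B to A is an
     erosion by 4 eta, which costs 16 kap; the shift by the noise costs 2 kap more, whence 18
     kap. *)
  pose B := dilate (2 * eta) A.
  have eta20 : 0 < 2 * eta by lra.
  have cB : convexv B by exact: convexv_dilate.
  have oB : openv B by exact: openv_dilate.
  have mB := measurable_openv oB.
  have gB : gauss_sum N n B <= gauss_sum N n A + 16 * kap.
    apply: (le_trans (gauss_sum_erode gN (enum 'I_d) n0 (_ : 0 < 2 * (2 * eta)) cB oB)); first lra.
    apply: lerD.
      apply: iter_transl_mono; [| |].
      - by apply: bmeas_indic; apply: measurable_openv; exact: openv_erode.
      - exact: bmeas_indic.
      - move=> y; rewrite !indicE; case: (boolP (y \in erode _ _ _)) => // /set_mem yB.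
        by rewrite mem_set//; exact: (erode_dilate eta20 cA).
    by rewrite size_enum_ord /kap le_eqVlt; apply/orP; left; apply/eqP; ring.
  (* A bound for every z: on H a walk ending in A ends in B after the noise is added; off H, x - 2
     delta <= - delta bounds X from below. *)
  have key z : (x - 18 * kap) - 2 * delta * (1 - \1_H z) <= X B (sm *: z).
    case: (boolP (z \in H)) => zH; last first.
      have := Xdelta B (sm *: z) cB oB; rewrite ler_norml => /andP[h1 _].
      have := xdelta; rewrite ler_norml => /andP[_ h2].
      rewrite indicE (negbTE zH) /= subr0; lra.
    rewrite indicE zH subrr mulr0 subr0 /X.
    have h1 : walk_sum n A <= iter n (transl mu) \1_B (sm *: z).
      rewrite /walk_sum -[sm *: z]addr0 -iter_transl_shift.
      apply: iter_transl_mono; [exact: bmeas_indic|by apply: bmeas_shift; exact: bmeas_indic|].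
      move=> y; rewrite !indicE; case: (boolP (y \in A)) => // /set_mem yA.
      rewrite mem_set//; exists y => // i; rewrite mxE addrK.
      by rewrite (le_lt_trans (Hv z (set_mem zH) i))//; lra.
    have := gauss_sum_transl_le gN n0 deta0 (Hdot z (set_mem zH)) cB mB.
    rewrite kapE /x; lra.
  have := XE B cB oB; rewrite ler_norml => /andP[_ XD].
  have : \int[N]_z ((x - 18 * kap) - 2 * delta * (1 - \1_H z)) <= \int[N]_z X B (sm *: z).
    apply: le_rint => //.
    - by apply: rintegrableB; [exact: rintegrable_cst|exact: rintegrableZl].
    - by apply: bmeas_integrable; exact: bXs.
  rewrite rintB; [|exact: rintegrable_cst|exact: rintegrableZl].
  rewrite rintZl// Rintegral_cst_probability.
  have : 2 * delta * \int[N]_z (1 - \1_H z) <= 2 * delta * (1 / 4).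
    by rewrite ler_wpM2l// mulr_ge0.
  lra.
have low : - x <= D + 18 * kap + delta / 2.
  (* The mirror argument: a noisy walk ending in the eroded set has its noiseless end in A. *)
  pose B := erode (enum 'I_d) eta A.
  have cB : convexv B by exact: convexv_erode.
  have oB : openv B by exact: openv_erode.
  have mB := measurable_openv oB.
  have gB : gauss_sum N n A <= gauss_sum N n B + 4 * kap.
    apply: (le_trans (gauss_sum_erode gN (enum 'I_d) n0 eta0 cA oA)).
    rewrite lerD2l size_enum_ord /kap le_eqVlt; apply/orP; left; apply/eqP; ring.
  have key z : X B (sm *: z) <= (x + 18 * kap) + 2 * delta * (1 - \1_H z).
    case: (boolP (z \in H)) => zH; last first.
      have := Xdelta B (sm *: z) cB oB; rewrite ler_norml => /andP[_ h1].
      have := xdelta; rewrite ler_norml => /andP[h2 _].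
      rewrite indicE (negbTE zH) /= subr0; lra.
    rewrite indicE zH subrr mulr0 addr0 /X.
    have h1 : iter n (transl mu) \1_B (sm *: z) <= walk_sum n A.
      rewrite /walk_sum -[sm *: z]addr0 -iter_transl_shift.
      apply: iter_transl_mono; [by apply: bmeas_shift; exact: bmeas_indic|exact: bmeas_indic|].
      move=> y; rewrite !indicE; case: (boolP (sm *: z + y \in B)) => // /set_mem yB.
      rewrite mem_set// -(addKr (sm *: z) y) addrC.
      apply: (erode_cube eta0 cA yB) => i; last by rewrite mem_enum.
      by rewrite mxE normrN; exact: Hv (set_mem zH) i.
    have := gauss_sum_transl_ge gN n0 deta0 (Hdot z (set_mem zH)) cB mB.
    rewrite kapE /x; lra.
  have := XE B cB oB; rewrite ler_norml => /andP[XD _].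
  have : \int[N]_z X B (sm *: z) <= \int[N]_z ((x + 18 * kap) + 2 * delta * (1 - \1_H z)).
    apply: le_rint => //.
    - by apply: bmeas_integrable; exact: bXs.
    - by apply: rintegrableD; [exact: rintegrable_cst|exact: rintegrableZl].
  rewrite rintD; [|exact: rintegrable_cst|exact: rintegrableZl].
  rewrite rintZl// Rintegral_cst_probability.
  have : 2 * delta * \int[N]_z (1 - \1_H z) <= 2 * delta * (1 / 4).
    by rewrite ler_wpM2l// mulr_ge0.
  lra.
by rewrite kap36 /walk_dist -/x ler_norml; apply/andP; split; lra.
Qed.

End smoothing.

Section inverse_sqrt_sums.
Context {R : realType}.
Local Notation sq n := (Num.sqrt n%:R : R).

Lemma sqrt_nat_gt0 n : (0 < n)%N -> 0 < sq n.
Proof. by move=> n0; rewrite sqrtr_gt0 ltr0n. Qed.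

Lemma sqr_sqrt_nat n : sq n ^+ 2 = n%:R.
Proof. by rewrite sqr_sqrtr. Qed.

Lemma sum_inv_sqrt n : \sum_(k < n) (sq k.+1)^-1 <= 2 * sq n.
Proof.
elim: n => [|n IH]; first by rewrite big_ord0 mulr_ge0// sqrtr_ge0.
rewrite big_ord_recr /= (le_trans (lerD IH (lexx _)))//.
have b0 := @sqrt_nat_gt0 n.+1 isT; have a0 : 0 <= sq n by exact: sqrtr_ge0.
have ab : sq n.+1 ^+ 2 = sq n ^+ 2 + 1 by rewrite !sqr_sqrt_nat -natr1.
set a := sq n in a0 ab *; set b := sq n.+1 in b0 ab *.
suff : b^-1 <= 2 * (b - a) by lra.
rewrite -[b^-1]mul1r ler_pdivrMr//.
have : 0 <= (b - a) ^+ 2 by exact: sqr_ge0.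
nra.
Qed.

(** A telescoping majorant for j^(-3/2). *)
Lemma inv_sqrt_cube_step j : (0 < j)%N ->
  (sq j.+1)^-1 ^+ 3 <= 2 * ((sq j)^-1 - (sq j.+1)^-1).
Proof.
move=> j0; have a0 := sqrt_nat_gt0 j0; have b0 := @sqrt_nat_gt0 j.+1 isT.
have ab : sq j.+1 ^+ 2 = sq j ^+ 2 + 1 by rewrite !sqr_sqrt_nat -natr1.
set a := sq j in a0 ab *; set b := sq j.+1 in b0 ab *.
have leab : a <= b by nra.
have h1 : (b - a) * (b + a) = 1 by rewrite -subr_sqr ab addrAC subrr add0r.
have h2 : 1 <= (b - a) * (2 * b).
  by rewrite -[leLHS]h1 ler_wpM2l ?subr_ge0//; lra.
have h3 : a <= 2 * b ^+ 2 * (b - a) by apply: (le_trans leab); rewrite expr2; nra.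
have -> : 2 * (a^-1 - b^-1) = (2 * b ^+ 2 * (b - a)) / (a * b ^+ 3).
  by field; rewrite !gt_eqF.
rewrite ler_pdivlMr ?mulr_gt0 ?exprn_gt0//.
by rewrite mulrCA -exprMn mulVf ?gt_eqF// expr1n mulr1.
Qed.

Lemma sum_inv_sqrt_cube n m : (0 < m)%N ->
  \sum_(l < n) (sq (l + m.+1))^-1 ^+ 3 <= 2 * (sq m)^-1.
Proof.
move=> m0; suff : \sum_(l < n) (sq (l + m.+1))^-1 ^+ 3 <= 2 * ((sq m)^-1 - (sq (n + m))^-1).
  move=> h; apply: (le_trans h).
  have : 0 <= (sq (n + m))^-1 by rewrite invr_ge0 sqrtr_ge0.
  lra.
elim: n => [|n IH]; first by rewrite big_ord0 add0n subrr mulr0.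
rewrite big_ord_recr /= (le_trans (lerD IH (lexx _)))//.
have := @inv_sqrt_cube_step (n + m) (ltn_addl n m0).
rewrite addnS addSn; lra.
Qed.

Lemma inv_sqrt_le i j : (0 < i)%N -> (i <= j)%N -> (sq j)^-1 <= (sq i)^-1.
Proof.
move=> i0 ij; rewrite lef_pV2 ?posrE ?sqrt_nat_gt0// ?(leq_trans i0)//.
by rewrite ler_wsqrtr// ler_nat.
Qed.

(** For k.+1 >= n / 2 the first factor is at most 2 / sqrt n and the cubes sum to O(1 / sqrt m);
    otherwise the cube is at most 2 / (n sqrt m) and the inverse square roots sum to O(sqrt n). The
    factor 1 / sqrt m is what makes the recursion contract. *)
Lemma sum_inv_sqrt_convolution n m : (0 < n)%N -> (0 < m)%N ->
  \sum_(k < n) (sq k.+1)^-1 * (sq (n - k.+1 + m.+1))^-1 ^+ 3 <= 8 * (sq m)^-1 * (sq n)^-1.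
Proof.
move=> n0 m0; have sn0 := sqrt_nat_gt0 n0.
apply: (@le_trans _ _ (\sum_(k < n) (2 * (sq n)^-1 * (sq (n - k.+1 + m.+1))^-1 ^+ 3 +
    2 * (sq n)^-1 ^+ 2 * (sq m)^-1 * (sq k.+1)^-1))).
  apply: ler_sum => k _; set l := (n - k.+1)%N.
  have k0 := @sqrt_nat_gt0 k.+1 isT.
  have l0 : 0 < sq (l + m.+1) by apply: sqrt_nat_gt0; lia.
  have p0 : 0 <= (sq (l + m.+1))^-1 ^+ 3 by rewrite exprn_ge0// invr_ge0 ltW.
  have p1 : 0 <= 2 * (sq n)^-1 ^+ 2 * (sq m)^-1 * (sq k.+1)^-1.
    by rewrite !mulr_ge0// ?exprn_ge0 ?invr_ge0 ?sqrtr_ge0.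
  have p2 : 0 <= 2 * (sq n)^-1 * (sq (l + m.+1))^-1 ^+ 3.
    by rewrite !mulr_ge0// ?exprn_ge0 ?invr_ge0 ?sqrtr_ge0.
  have [h|h] := leqP n (2 * k.+1).
    apply: (@le_trans _ _ (2 * (sq n)^-1 * (sq (l + m.+1))^-1 ^+ 3)); last by rewrite lerDl.
    apply: ler_wpM2r => //; rewrite -[2]invrK -invfM lef_pV2 ?posrE ?mulr_gt0 ?invr_gt0//.
    rewrite -ler_sqr ?nnegrE ?mulr_ge0 ?invr_ge0 ?(ltW k0) ?(ltW sn0)//.
    rewrite exprMn !sqr_sqrt_nat; have : n%:R <= (2 * k.+1)%:R :> R by rewrite ler_nat.
    rewrite natrM; have : 0 <= n%:R :> R by []. lra.
  apply: (@le_trans _ _ (2 * (sq n)^-1 ^+ 2 * (sq m)^-1 * (sq k.+1)^-1)); last by rewrite lerDr.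
  rewrite mulrC; apply: ler_wpM2r; first by rewrite invr_ge0 ltW.
  rewrite exprSr; apply: ler_pM.
  - by rewrite exprn_ge0// invr_ge0 ltW.
  - by rewrite invr_ge0 ltW.
  - rewrite !exprVn !sqr_sqrt_nat -[2]invrK -invfM lef_pV2 ?posrE ?mulr_gt0 ?invr_gt0 ?ltr0n//; last by lia.
    rewrite mulrC ler_pdivrMr// -natrM ler_nat /l; lia.
  - by apply: inv_sqrt_le => //; lia.
rewrite big_split /= -!mulr_sumr.
have -> : \sum_(k < n) (sq (n - k.+1 + m.+1))^-1 ^+ 3 = \sum_(l < n) (sq (l + m.+1))^-1 ^+ 3.
  by rewrite [RHS](reindex_inj rev_ord_inj).
have S1 := @sum_inv_sqrt_cube n m m0; have S2 := @sum_inv_sqrt n.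
have m0' : 0 <= (sq m)^-1 by rewrite invr_ge0 sqrtr_ge0.
have n0' : 0 <= (sq n)^-1 by rewrite invr_ge0 sqrtr_ge0.
apply: (@le_trans _ _ (2 * (sq n)^-1 * (2 * (sq m)^-1) + 2 * (sq n)^-1 ^+ 2 * (sq m)^-1 * (2 * sq n))).
  by apply: lerD; apply: ler_wpM2l => //; rewrite !mulr_ge0// exprn_ge0.
rewrite le_eqVlt; apply/orP; left; apply/eqP; field; rewrite !gt_eqF//; exact: sqrt_nat_gt0.
Qed.

End inverse_sqrt_sums.

Section gaussian_bounds.
Context {R : realType} {d : nat}.
Local Notation V := 'cV[R]_d.
Variable N : probability V R.
Hypothesis gN : std_gaussian N.

(** An explicit bound in d and c lets the Berry-Esseen constant be chosen before N. *)
Lemma expR_norm1_le (c : R) : \int[N]_z expR (c * norm1 z) <= (2 * expR (c ^+ 2 / 2)) ^+ d.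
Proof.
have m1 e : measurable_fun [set: R] (fun x : R => expR (e * x)).
  by apply: measurableT_comp => //; exact: measurable_funM.
have me e : measurable_fun [set: R] (fun x : R => (expR (e * x))%:E) by exact/measurable_EFinP.
have e0 e x : (0 <= (expR (e * x))%:E :> \bar R)%E by rewrite lee_fin expR_ge0.
have mG : measurable_fun [set: V] (fun z : V => \prod_(i < d) (expR (c * z i 0) + expR (- c * z i 0))).
  apply: measurable_prod => i _.
  by apply: measurable_funD; apply: (measurableT_comp (m1 _)); exact: measurable_coord.
have G0 (z : V) : 0 <= \prod_(i < d) (expR (c * z i 0) + expR (- c * z i 0)).
  by apply: prodr_ge0 => i _; rewrite addr_ge0 ?expR_ge0.
have EG : (\int[N]_z (\prod_(i < d) (expR (c * z i 0%R) + expR (- c * z i 0%R)))%R%:E =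
    ((2 * expR (c ^+ 2 / 2)) ^+ d)%:E)%E.
  rewrite (gaussian_prod gN (f := fun i x => expR (c * x) + expR (- c * x))).
  - rewrite (eq_bigr (fun=> (2 * expR (c ^+ 2 / 2))%:E)).
      by rewrite prodEFin prodr_const card_ord.
    move=> i _; under eq_integral do rewrite EFinD.
    rewrite (@ge0_integralD _ _ _ (@normal01 R) _ measurableT (fun x => (expR (c * x))%:E)
        (fun x => (expR (- c * x))%:E))//.
    by rewrite !integral_normal01_expR sqrrN -EFinD; congr (_%:E); ring.
  - by move=> i; exact: measurable_funD.
  - by move=> i x; rewrite addr_ge0 ?expR_ge0.
rewrite -[leRHS]/(fine ((2 * expR (c ^+ 2 / 2)) ^+ d)%:E) -EG; apply: le_rint.
- exact: expR_norm1_rintegrable.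
- apply/integrableP; split; first exact/measurable_EFinP.
  under eq_integral do rewrite /= ger0_norm//.
  by rewrite EG ltry.
move=> z; rewrite mulr_sumr expR_sum; apply: ler_prod => i _; rewrite expR_ge0/=.
have [z0|z0] := leP 0 (z i 0).
  by rewrite (ger0_norm z0) lerDl expR_ge0.
by rewrite (ltr0_norm z0) mulrN mulNr lerDr expR_ge0.
Qed.

Lemma gaussian_moment3_le : moment3 N <= 6 * (2 * expR (1 / 2)) ^+ d.
Proof.
have := expR_norm1_le 1; rewrite expr1n => h.
apply: (@le_trans _ _ (\int[N]_z (6 * expR (1 * norm1 z)))).
  apply: le_rint.
  - exact: gaussian_moment3.
  - by apply: rintegrableZl; exact: expR_norm1_rintegrable.
  - by move=> z; apply: norm1_exp_bound; exact: norm1_ge0.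
by rewrite rintZl ?ler_wpM2l//; exact: expR_norm1_rintegrable.
Qed.

Lemma taylor_const_le : taylor_const N <= 1 + 7 * expR 2 * (2 * expR (2 ^+ 2 / 2)) ^+ d.
Proof.
by rewrite lerD2l ler_wpM2l ?mulr_ge0 ?expR_ge0//; exact: expR_norm1_le.
Qed.

End gaussian_bounds.

(** * Exchange of steps and induction on their number *)

Section composition.
Context {R : realType} {d : nat}.
Local Notation V := 'cV[R]_d.
Local Notation sq n := (Num.sqrt n%:R : R).
Variables N mu : probability V R.
Hypotheses (gN : std_gaussian N) (hd : (0 < d)%N) (imu : isotropic3 mu).
Implicit Types (A : set V).

Let c0 := taylor_const N * (moment3 mu + moment3 N).

Let c0_ge0 : 0 <= c0.
Proof. by rewrite mulr_ge0 ?taylor_const_ge0// addr_ge0// moment3_ge0. Qed.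

Lemma walk_dist_shift n A (delta : R) y :
  (forall A, convexv A -> openv A -> walk_dist N mu n A <= delta) ->
  convexv A -> openv A ->
  `|iter n (transl mu) \1_A y - iter n (transl N) \1_A y| <= delta.
Proof.
move=> hdelta cA oA; pose A' := [set x | A (y + 1 *: x)].
have cA' : convexv A' by exact: convexv_preimage_affine.
have oA' : openv A' by exact: openv_preimage_affine.
have := hdelta A' cA' oA'; rewrite /walk_dist /walk_sum /gauss_sum.
have -> : (\1_A' : V -> R) = fun x => \1_A (y + x).
  by apply/funext => x; apply: eq_indic; rewrite /A' /= scale1r.
by rewrite !iter_transl_shift addr0.
Qed.

(* Steps are exchanged one at a time. In the k-th exchange the first k steps are
   Gaussian up to an error delta k, controlled by induction, and the remaining Gaussian
   steps do the smoothing. *)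
Lemma composition_bound n m (delta : nat -> R) A : (0 < m)%N ->
  (forall k, (k < n)%N -> forall A, convexv A -> openv A -> walk_dist N mu k A <= delta k) ->
  convexv A -> openv A ->
  `|iter n (transl mu) (iter m (transl N) \1_A) 0 - iter (n + m) (transl N) \1_A 0| <=
  c0 * (\sum_(k < n) delta k * (sq (n - k.+1 + m))^-1 ^+ 3 +
        n%:R * (sq (n - 1 + m))^-1 ^+ 3).
Proof.
move=> m0 hdelta cA oA; have bA := bmeas_indic (R := R) (measurable_openv oA).
pose a k := iter k (transl mu) (iter (n - k + m) (transl N) \1_A) 0.
have -> : iter n (transl mu) (iter m (transl N) \1_A) 0 = a n by rewrite /a subnn.
have -> : iter (n + m) (transl N) \1_A 0 = a 0%N by rewrite /a subn0.
rewrite -(telescope_sumr a (leq0n n)) big_mkord.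
apply: (le_trans (ler_norm_sum _ _ _)).
have -> : n%:R * (sq (n - 1 + m))^-1 ^+ 3 = \sum_(k < n) (sq (n - 1 + m))^-1 ^+ 3.
  by rewrite sumr_const card_ord -[RHS]mulr_natl.
rewrite -big_split mulr_sumr /=; apply: ler_sum => -[k kn] _ /=.
set j := (n - k.+1 + m)%N.
have j0 : (0 < j)%N by rewrite /j; lia.
pose T F := transl mu (iter j (transl N) F) 0 - transl N (iter j (transl N) F) 0.
(* Commutation moves the exchanged step and the Gaussian steps outside, leaving the k walk steps
   next to the indicator. *)
have aE : a k.+1 - a k = T (iter k (transl mu) \1_A).
  rewrite /a /T -/j (_ : (n - k + m = j.+1)%N); last by rewrite /j; lia.
  have E := @iter2_translC _ _ mu N j k _ bA.
  have bj : bmeas (iter j (transl N) \1_A) by exact: bmeas_iter.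
  have E' := @iter_translC _ _ mu N k _ bj.
  by rewrite iterS -/j E (iterS j) E' E.
have bU : bmeas (iter k (transl mu) \1_A) by exact: bmeas_iter.
have bG : bmeas (iter k (transl N) \1_A) by exact: bmeas_iter.
pose F1 x := iter k (transl mu) \1_A x - iter k (transl N) \1_A x.
have bF1 : bmeas F1 by exact: bmeasB.
have TE : T (iter k (transl mu) \1_A) = T F1 + T (iter k (transl N) \1_A).
  rewrite /T /F1 iter_translB// !translB; try exact: bmeas_iter.
  by ring.
have T1 : `|T F1| <= c0 * (delta k * (sq j)^-1 ^+ 3).
  have := isotropic_gaussian_comparison gN imu j0 bF1
    (fun x => walk_dist_shift x (hdelta k kn) cA oA).
  by move=> h; apply: (le_trans h); rewrite /c0 le_eqVlt; apply/orP; left; apply/eqP; ring.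
(* Here the k inner steps are Gaussian too and join the smoothing, so all n - 1 + m of them
   count. *)
have T2 : `|T (iter k (transl N) \1_A)| <= c0 * (sq (n - 1 + m))^-1 ^+ 3.
  rewrite /T -iterD (_ : (j + k = n - 1 + m)%N); last by rewrite /j; lia.
  have jk0 : (0 < n - 1 + m)%N by lia.
  have i1 x : `|(\1_A : V -> R) x| <= 1 by rewrite indicE; case: (_ \in _); rewrite ?normr1 ?normr0.
  have := isotropic_gaussian_comparison gN imu jk0 bA i1.
  by rewrite mulr1.
rewrite aE TE (le_trans (ler_normD _ _))// mulrDr lerD//.
Qed.

Lemma walk_dist_le2 n A : convexv A -> openv A -> walk_dist N mu n A <= 2.
Proof.
move=> cA oA; have bA := bmeas_indic (R := R) (measurable_openv oA).
have i1 x : `|(\1_A : V -> R) x| <= 1 by rewrite indicE; case: (_ \in _); rewrite ?normr1 ?normr0.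
rewrite /walk_dist /walk_sum /gauss_sum (le_trans (ler_normB _ _))//.
have := iter_transl_bound mu n bA i1 0; have := iter_transl_bound N n bA i1 0; lra.
Qed.

(** [smoothing] with delta the supremum of the distance over all open convex sets: it is finite,
    being at most 2, so delta / 2 moves to the left. *)
Lemma smoothing_sup n m (D : R) : (0 < n)%N -> (0 < m)%N ->
  (forall A, convexv A -> openv A ->
    `|iter n (transl mu) (iter m (transl N) \1_A) 0 - iter (n + m) (transl N) \1_A 0| <= D) ->
  forall A, convexv A -> openv A ->
    walk_dist N mu n A <= 2 * D + 72 * d%:R ^+ 2 * (sq m / sq n).
Proof.
move=> n0 m0 hD A cA oA.
pose S : set R := [set walk_dist N mu n A | A in [set A | convexv A /\ openv A]].
have S2 : ubound S 2 by move=> _ [B [cB oB] <-]; exact: walk_dist_le2.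
have SA B : convexv B -> openv B -> walk_dist N mu n B <= sup S.
  by move=> cB oB; apply: ub_le_sup; [exists 2|exists B].
have : sup S <= D + 36 * d%:R ^+ 2 * (sq m / sq n) + sup S / 2.
  apply: ge_sup; first by exists (walk_dist N mu n A); exists A.
  by move=> _ [B [cB oB] <-]; exact: (smoothing gN hd n0 m0 SA hD).
have := SA A cA oA; lra.
Qed.

(** With m = M^2 + 1 noise steps the inductive contribution is 8 c0 K / (M sqrt n), at most K / (8
    sqrt n) by the choice of M. [smoothing_sup] doubles it and passing from n to n + 1 doubles it
    again; K is the solution of K = K / 2 + 4 c0 + 144 d^2 sqrt m. The n + 1 under the root gives
    the case n = 0 a meaning. *)
Lemma walk_dist_bound (M : nat) : 64 * c0 <= M%:R -> (0 < M)%N ->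
  forall n A, convexv A -> openv A ->
  walk_dist N mu n A <= (8 * c0 + 288 * d%:R ^+ 2 * sq (M ^ 2).+1) / sq n.+1.
Proof.
move=> cM M0; set K := 8 * c0 + _.
have c00 : 0 <= c0 by exact: c0_ge0.
have dd0 : 0 <= d%:R ^+ 2 :> R by exact: sqr_ge0.
have K0 : 0 <= K.
  have := mulr_ge0 dd0 (sqrtr_ge0 ((M ^ 2).+1%:R : R)); rewrite /K -mulrA.
  by move: c0 c00 => c c0'; lra.
have KE : K = 8 * c0 + 288 * d%:R ^+ 2 * sq (M ^ 2).+1 by [].
clearbody K; elim/ltn_ind => -[|n'] IH A cA oA.
  rewrite /walk_dist /walk_sum /gauss_sum /= subrr normr0.
  by rewrite divr_ge0// sqrtr_ge0.
set n := n'.+1 in IH *.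
have n0 : (0 < n)%N by [].
have sn0 := @sqrt_nat_gt0 R n n0; have sn1 := @sqrt_nat_gt0 R n.+1 isT.
pose m := (M ^ 2).+1.
have sM : sq (M ^ 2) = M%:R by rewrite natrX sqrtr_sqr ger0_norm.
have M2 : (0 < M ^ 2)%N by rewrite expn_gt0 M0.
have D1 B : convexv B -> openv B ->
    `|iter n (transl mu) (iter m (transl N) \1_B) 0 - iter (n + m) (transl N) \1_B 0| <=
    (K / 8 + c0) / sq n.
  move=> cB oB; have IH' k : (k < n)%N -> forall B, convexv B -> openv B ->
      walk_dist N mu k B <= K / sq k.+1 by move=> kn; exact: IH.
  apply: (le_trans (@composition_bound n m (fun k => K / sq k.+1) B isT IH' cB oB)).
  have S1 := @sum_inv_sqrt_convolution R n (M ^ 2) n0 M2.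
  have -> : \sum_(k < n) K / sq k.+1 * (sq (n - k.+1 + m))^-1 ^+ 3 =
      K * \sum_(k < n) (sq k.+1)^-1 * (sq (n - k.+1 + (M ^ 2).+1))^-1 ^+ 3.
    by rewrite mulr_sumr /m; apply: eq_bigr => k _; rewrite -[LHS]mulrA.
  have h2 : n%:R * (sq (n - 1 + m))^-1 ^+ 3 <= (sq n)^-1.
    apply: (@le_trans _ _ (n%:R * (sq n)^-1 ^+ 3)).
      rewrite ler_wpM2l// lerXn2r ?nnegrE ?invr_ge0 ?sqrtr_ge0//.
      by apply: inv_sqrt_le => //; rewrite /m /n; lia.
    by rewrite exprS exprVn sqr_sqrt_nat mulrCA divff ?mulr1// pnatr_eq0.
  have M0' : 0 < M%:R :> R by rewrite ltr0n.
  have h1 : c0 * (K * (8 * M%:R^-1 * (sq n)^-1)) <= K / 8 / sq n.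
    rewrite (_ : _ * _ = (64 * c0 * M%:R^-1) * (K / 8 / sq n)); last first.
      by field; rewrite !gt_eqF.
    apply: ler_piMl; last by rewrite ler_pdivrMr// mul1r.
    by rewrite divr_ge0 ?sqrtr_ge0// divr_ge0.
  rewrite mulrDr [leRHS]mulrDl; apply: lerD; last by rewrite ler_wpM2l.
  apply: le_trans h1; rewrite ler_wpM2l// ler_wpM2l//.
  by rewrite -sM.
apply: (le_trans (smoothing_sup n0 (isT : (0 < m)%N) D1 cA oA)).
have sn2 : (sq n)^-1 <= 2 * (sq n.+1)^-1.
  rewrite -[2]invrK -invfM lef_pV2 ?posrE ?mulr_gt0 ?invr_gt0//.
  rewrite mulrC ler_pdivrMr// -ler_sqr ?nnegrE ?mulr_ge0 ?sqrtr_ge0//.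
  by rewrite exprMn !sqr_sqrt_nat -natrX -natrM ler_nat /n; lia.
have -> : 2 * ((K / 8 + c0) / sq n) + 72 * d%:R ^+ 2 * (sq m / sq n) =
    (K / 4 + 2 * c0 + 72 * d%:R ^+ 2 * sq m) * (sq n)^-1 by field; rewrite gt_eqF.
apply: (@le_trans _ _ ((K / 4 + 2 * c0 + 72 * d%:R ^+ 2 * sq m) * (2 * (sq n.+1)^-1))).
  rewrite ler_wpM2l//; have := mulr_ge0 dd0 (sqrtr_ge0 (m%:R : R)); rewrite -mulrA.
  by move: K0 c00; lra.
rewrite mulrA; apply: ler_wpM2r; first by rewrite invr_ge0 sqrtr_ge0.
rewrite -/m in KE.
have Q0 : 0 <= 72 * d%:R ^+ 2 * sq m by rewrite !mulr_ge0 ?exprn_ge0 ?sqrtr_ge0.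
lra.
Qed.

End composition.

(* The walk need not be normalized: walk_sum n A - gauss_sum N n A compares the sum of n
   steps with a Gaussian vector of covariance n I, and the class of open convex sets is
   invariant under scaling. *)
Theorem berry_esseen {R : realType} (d : nat) (beta : R) : (0 < d)%N ->
  exists2 K : R, 0 <= K & forall (N mu : probability 'cV[R]_d R),
    std_gaussian N -> isotropic3 mu -> moment3 mu <= beta ->
    forall n A, convexv A -> openv A -> walk_dist N mu n A <= K / Num.sqrt n.+1%:R.
Proof.
move=> hd.
pose t : R := 1 + 7 * expR 2 * (2 * expR (2 ^+ 2 / 2)) ^+ d.
pose b : R := `|beta| + 6 * (2 * expR (1 / 2)) ^+ d.
have t0 : 0 <= t by rewrite addr_ge0 ?mulr_ge0 ?exprn_ge0 ?mulr_ge0 ?expR_ge0.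
have b0 : 0 <= b by rewrite addr_ge0 ?mulr_ge0 ?exprn_ge0 ?mulr_ge0 ?expR_ge0.
pose M := (Num.truncn (64 * (t * b))).+1.
have tb0 : 0 <= 64 * (t * b) by rewrite !mulr_ge0.
have hM : 64 * (t * b) <= M%:R by have /andP[_ /ltW] := Num.Theory.truncn_itv tb0.
exists (8 * (t * b) + 288 * d%:R ^+ 2 * Num.sqrt (M ^ 2).+1%:R).
  apply: addr_ge0; first by apply: mulr_ge0 => //; exact: mulr_ge0.
  by apply: mulr_ge0; [apply: mulr_ge0 => //; exact: sqr_ge0|exact: sqrtr_ge0].
move=> N mu gN imu hbeta n A cA oA.
have ctb : taylor_const N * (moment3 mu + moment3 N) <= t * b.
  apply: ler_pM; rewrite ?taylor_const_ge0// ?addr_ge0 ?moment3_ge0//.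
    exact: taylor_const_le.
  apply: lerD; last exact: gaussian_moment3_le.
  by rewrite (le_trans hbeta)// ler_norm.
apply: (le_trans (walk_dist_bound gN hd imu (M := M) _ isT n cA oA)).
  by rewrite (le_trans _ hM)// ler_wpM2l.
by apply: ler_wpM2r; rewrite ?invr_ge0 ?sqrtr_ge0// lerD2r ler_wpM2l.
Qed.

(** * Inverse square roots of symmetric matrices *)

Section real_spectral.
Import complex.
Context {R : realType} {n : nat}.
Local Notation C := (complex R).
Local Notation toC := (real_complex R).
Variable A : 'M[R]_n.+1.
Hypothesis symA : A^T = A.

Let AC : 'M[C]_n.+1 := map_mx toC A.

Let toC_real (x : R) : toC x \is Num.real.
Proof. by rewrite realE -[0 : C]/(toC 0) !lecR le_total. Qed.

Let hermAC : AC \is hermsymmx.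
Proof.
apply: realsym_hermsym; first by apply/is_hermitianmxP; rewrite expr0 scale1r map_mx_id//;
  apply/matrixP => i j; rewrite !mxE -{1}symA mxE.
by apply/mxOverP => i j; rewrite mxE.
Qed.

Let P : 'M[C]_n.+1 := spectralmx AC.
Let D : 'rV[C]_n.+1 := spectral_diag AC.

Let ACE : AC = invmx P *m diag_mx D *m P.
Proof. exact/orthomx_spectralP/hermitian_normalmx. Qed.

Let Punit : P \in unitmx. Proof. exact: spectral_unit. Qed.

(** A is diagonalised as a complex Hermitian matrix; the eigenvalues are real, so taking real parts
    loses nothing. *)
Definition spectral_value (i : 'I_n.+1) : R := Re (D 0 i).

Let DE i : D 0 i = toC (spectral_value i).
Proof.
rewrite /spectral_value RRe_real//.
by have /mxOverP := hermitian_spectral_diag_real hermAC; apply.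
Qed.

Lemma spectral_value_eigenvalue i : eigenvalue A (spectral_value i).
Proof.
rewrite eigenvalue_root_char -(fmorph_root toC) map_char_poly -/AC -eigenvalue_root_char.
apply/eigenvalueP; exists (row i P).
  rewrite -row_mul ACE !mulmxA mulmxV// mul1mx; apply/rowP => j.
  rewrite !mxE (bigD1 i)//= big1 ?addr0; first by rewrite !mxE eqxx mulr1n DE.
  by move=> k ki; rewrite !mxE eq_sym (negbTE ki) mulr0n mul0r.
apply/negP => /eqP P0; have := Punit; rewrite -row_free_unit => /row_free_inj.
move=> /(_ 1%N (delta_mx 0 i) 0); rewrite /= mul0mx -rowE => /(_ P0) /matrixP /(_ 0 i).
by rewrite !mxE !eqxx => /eqP; rewrite oner_eq0.
Qed.

Let horner_AC p : map_mx toC (horner_mx A p) =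
  invmx P *m diag_mx (\row_i toC p.[spectral_value i]) *m P.
Proof.
rewrite map_horner_mx; have := horner_mx_uconjC (map_poly toC p) (diag_mx D) Punit.
rewrite -ACE => ->; rewrite horner_mx_diag.
apply: (congr1 (fun X : 'rV[C]_n.+1 => invmx P *m diag_mx X *m P)).
apply/rowP => i; rewrite [LHS]mxE [RHS]mxE DE.
exact: horner_map.
Qed.

Lemma horner_mx_eq0 p : (forall i, p.[spectral_value i] = 0) -> horner_mx A p = 0.
Proof.
move=> p0; apply: (@map_mx_inj _ _ toC); rewrite horner_AC map_mx0.
have -> : \row_i toC p.[spectral_value i] = 0 by apply/rowP => i; rewrite !mxE p0.
by rewrite linear0 mulmx0 mul0mx.
Qed.

(** The weights are the squared moduli of the coordinates of v in the eigenbasis. They serve all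
    polynomials at once, so different functions of A can be compared at the same v. *)
Lemma quadratic_form_spectral (v : 'cV[R]_n.+1) : exists2 w : 'I_n.+1 -> R,
  (forall i, 0 <= w i) & forall p,
  dotv v (horner_mx A p *m v) = \sum_i p.[spectral_value i] * w i.
Proof.
pose vC : 'cV[C]_n.+1 := map_mx toC v; pose u := P *m vC.
pose w i : R := Re (`|u i 0| ^+ 2).
have wE i : toC (w i) = `|u i 0| ^+ 2.
  by rewrite /w RRe_real// ger0_real// exprn_ge0.
exists w => [i|p]; first by rewrite -lecR wE exprn_ge0.
apply: complexI; rewrite [RHS]rmorph_sum.
transitivity ((vC^T *m map_mx toC (horner_mx A p) *m vC) 0 0).
  rewrite -mulmxA -map_mxM /dotv rmorph_sum !mxE; apply: eq_bigr => i _.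
  by rewrite rmorphM !mxE.
rewrite horner_AC invmx_unitary ?spectral_unitarymx// !mulmxA -mulmxA -/u.
have -> : vC^T *m map_mx Num.conj P^T = map_mx Num.conj u^T.
  rewrite /u trmx_mul map_mxM; congr (_ *m _); apply/matrixP => i j.
  by rewrite !mxE; exact/esym/CrealP.
rewrite !mxE; apply: eq_bigr => i _.
rewrite !mxE (bigD1 i)//= big1 ?addr0; last first.
  by move=> k ki; rewrite !mxE (negbTE ki) mulr0n mulr0.
transitivity (toC p.[spectral_value i] * toC (w i)); last by rewrite -rmorphM.
by rewrite wE normCKC !mxE eqxx mulr1n; ring.
Qed.

Lemma horner_mx_sym p : (horner_mx A p)^T = horner_mx A p.
Proof.
elim/poly_ind: p => [|p c IH]; first by rewrite rmorph0 trmx0.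
rewrite !(rmorphD, rmorphM)/= !(horner_mx_X, horner_mx_C) linearD /= tr_scalar_mx.
congr (_ + _); rewrite -[_ * _]/(_ *m _) trmx_mul IH symA.
by have := comm_mx_horner p (erefl (A *m A)).
Qed.

End real_spectral.

(** Newton's scheme. It makes any function of a symmetric matrix a polynomial in it, hence symmetric
    and commuting with it. *)
Lemma interpolation {F : fieldType} (f : F -> F) (s : seq F) :
  exists p : {poly F}, forall x, x \in s -> p.[x] = f x.
Proof.
elim: s => [|x s [p hp]]; first by exists 0.
have [xs|xs] := boolP (x \in s).
  by exists p => y; rewrite inE => /orP[/eqP ->|]; exact: hp.
pose q : {poly F} := \prod_(y <- s) ('X - y%:P).
have qx : q.[x] != 0 by rewrite -rootE root_prod_XsubC.
exists (p + ((f x - p.[x]) / q.[x])%:P * q) => y; rewrite inE => /orP[/eqP ->|ys].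
  by rewrite !hornerE divfK// addrC subrK.
have /eqP q0 : q.[y] == 0 by rewrite -rootE root_prod_XsubC.
by rewrite !hornerE q0 mulr0 addr0; exact: hp.
Qed.

Section positive_definite.
Context {R : realType}.

Lemma lambda_min_le {d} (A : 'M[R]_d) (l a : R) : 0 < l -> l <= lambda_min A ->
  eigenvalue A a -> l <= a.
Proof.
(* Without an infimum [inf] would take its default value 0, which 0 < l excludes. *)
move=> l0 lA Aa; have hi : has_inf [set a : R | eigenvalue A a].
  apply: contrapT => /inf_out h; move: lA; rewrite /lambda_min h; lra.
by apply: (le_trans lA); apply: inf_lbound => //; exact: hi.2.
Qed.

Lemma quadratic_form_ge {d} (A : 'M[R]_d) (l : R) (v : 'cV[R]_d) : A^T = A -> 0 < l ->
  l <= lambda_min A -> l * dotv v v <= dotv v (A *m v).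
Proof.
case: d A v => [|d] A v symA l0 lA.
  by rewrite /dotv !big_ord0 mulr0.
have [w w0 hw] := quadratic_form_spectral symA v.
have := hw 1; rewrite rmorph1 mul1mx => ->.
have := hw 'X; rewrite horner_mx_X => ->.
rewrite mulr_sumr; apply: ler_sum => i _; rewrite hornerX hornerC mul1r.
apply: ler_wpM2r => //; apply: lambda_min_le lA _ => //.
exact: spectral_value_eigenvalue.
Qed.

Lemma dotv_eq0 {d} (v : 'cV[R]_d) : dotv v v = 0 -> v = 0.
Proof.
move=> /eqP; rewrite psumr_eq0 => [/allP h|i _]; last by rewrite -expr2 sqr_ge0.
apply/matrixP => i j; rewrite ord1 mxE; apply/eqP.
by have := h i (mem_index_enum _); rewrite mulf_eq0 orbb.
Qed.

Lemma posdef_unitmx {d} (A : 'M[R]_d) : posdef A -> A \in unitmx.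
Proof.
move=> [symA pA]; rewrite -row_free_unit -kermx_eq0; apply/eqP/row_matrixP => i.
rewrite row0; set u := row i _; apply: contrapT => /eqP u0.
have uA : u *m A = 0 by apply/sub_kermxP; exact: row_sub.
have uT : u^T != 0 by rewrite -(inj_eq (@trmx_inj _ _ _)) trmxK trmx0.
have := pA _ uT; rewrite (_ : A *m u^T = 0) ?/dotv; last first.
  by rewrite -{1}symA -trmx_mul uA trmx0.
by rewrite big1 ?ltxx// => k _; rewrite [X in _ * X]mxE mulr0.
Qed.

(** S is p(A), with p interpolating 1 / sqrt x at the eigenvalues. The polynomial p^2 X - 1 vanishes
    on the spectrum, hence at A. *)
Lemma posdef_inv_sqrt {d} (A : 'M[R]_d) (l : R) : A^T = A -> 0 < l -> l <= lambda_min A ->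
  exists S : 'M[R]_d, posdef S /\ S *m S = invmx A.
Proof.
case: d A => [|d] A symA l0 lA.
  exists 0; split; last by apply/matrixP => -[].
  by split; [apply/matrixP => -[]|move=> v; rewrite (flatmx0 v) eqxx].
have r0 i : 0 < spectral_value A i.
  by rewrite (lt_le_trans l0)//; apply: lambda_min_le lA _ => //; exact: spectral_value_eigenvalue.
have [p hp] := interpolation (fun x : R => (Num.sqrt x)^-1)
  [seq spectral_value A i | i <- enum 'I_d.+1].
have pE i : p.[spectral_value A i] = (Num.sqrt (spectral_value A i))^-1.
  by apply: hp; apply: map_f; rewrite mem_enum.
have E : horner_mx A p *m horner_mx A p *m A = 1%:M.
  have : horner_mx A (p * p * 'X - 1) = 0.
    apply: horner_mx_eq0 => // i; rewrite !hornerE pE -invfM -expr2 sqr_sqrtr ?(ltW (r0 i))//.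
    by rewrite mulVf ?subrr// gt_eqF.
  by rewrite rmorphB !rmorphM rmorph1 /= horner_mx_X => /eqP; rewrite subr_eq0 => /eqP.
exists (horner_mx A p); split; last first.
  have Au : A \in unitmx by have [] := mulmx1_unit E.
  by rewrite -[LHS]mulmx1 -(mulmxV Au) mulmxA E mul1mx.
split; first exact: horner_mx_sym.
move=> v v0; have [w w0 hw] := quadratic_form_spectral symA v.
rewrite hw lt_neqAle; apply/andP; split; last first.
  by apply: sumr_ge0 => i _; rewrite pE mulr_ge0// invr_ge0 sqrtr_ge0.
apply: contraNN v0; rewrite eq_sym psumr_eq0 => [/allP h|i _]; last first.
  by rewrite pE mulr_ge0// invr_ge0 sqrtr_ge0.
apply/eqP/dotv_eq0; have := hw 1; rewrite rmorph1 mul1mx => ->.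
rewrite big1// => i _; rewrite hornerC mul1r.
have := h i (mem_index_enum _); rewrite pE mulf_eq0 invr_eq0 sqrtr_eq0 leNgt r0 /=.
by move/eqP.
Qed.

Lemma inv_sqrtmxP {d} (A : 'M[R]_d) (l : R) : A^T = A -> 0 < l -> l <= lambda_min A ->
  posdef (inv_sqrtmx A) /\ inv_sqrtmx A *m inv_sqrtmx A = invmx A.
Proof.
move=> symA l0 lA; have [S hS] := posdef_inv_sqrt symA l0 lA.
by rewrite /inv_sqrtmx; case: xgetP => [x _ //|/(_ S)].
Qed.

End positive_definite.

(** * Sub-exponential deviations *)

Section exponential_moments.
Context {dE} {E : measurableType dE} {R : realType} (Q : probability E R).
Implicit Types (f g : E -> R) (K : R).

(** An Orlicz bound with the scale moved into f: for f divided by its scale the exponential moment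
    is at most 2. *)
Definition subexp f K := [/\ measurable_fun [set: E] f,
  rintegrable Q (fun x => expR `|f x|) & \int[Q]_x expR `|f x| <= K].

Lemma subexp_measurable f K : subexp f K -> measurable_fun [set: E] f.
Proof. by case. Qed.

Lemma subexp_ge1 f K : subexp f K -> 1 <= K.
Proof.
move=> [_ fi fK]; apply: le_trans fK.
rewrite -{1}(@Rintegral_cst_probability _ _ _ Q 1).
apply: le_Rintegral => //; first exact: (rintegrable_cst Q 1).
by move=> x _; rewrite -expR0 ler_expR.
Qed.

Lemma subexp_dominated f K g c : subexp f K -> measurable_fun [set: E] g ->
  (forall x, `|g x| <= c * expR `|f x|) ->
  rintegrable Q g /\ `|\int[Q]_x g x| <= c * \int[Q]_x expR `|f x|.
Proof.
move=> [mf fi fK] mg gf; have ci := rintegrableZl c fi.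
split; first exact: rintegrable_le ci gf.
by rewrite -rintZl//; apply: Rintegral_dominated.
Qed.

Lemma le_expR (x : R) : x <= expR x.
Proof. by have := expR_ge1Dx x; lra. Qed.

Lemma sqr_le_expR (x : R) : 0 <= x -> x ^+ 2 <= 4 * expR x.
Proof.
move=> x0; have h := le_expR (x / 2).
rewrite (_ : x = x / 2 + x / 2) ?expRD; last by field.
have -> : (x / 2 + x / 2) ^+ 2 = 4 * ((x / 2) * (x / 2)) by field.
by rewrite ler_wpM2l// ler_pM// divr_ge0.
Qed.

Lemma cube_le_expR (x : R) : 0 <= x -> x ^+ 3 <= 27 * expR x.
Proof.
move=> x0; have h := le_expR (x / 3).
rewrite {2}(_ : x = x / 3 + x / 3 + x / 3) ?expRD; last by field.
have -> : x ^+ 3 = 27 * ((x / 3) * (x / 3) * (x / 3)) by field.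
by rewrite ler_wpM2l// ler_pM ?mulr_ge0 ?ler_pM// divr_ge0.
Qed.

(** For |t| <= 1 / 2 the remainder t^2 f^2 e^(|t f|) is at most 16 t^2 e^|f|: half of the exponent
    absorbs f^2, the other half e^(|t f|). *)
Lemma subexp_mgf f K t : subexp f K -> \int[Q]_x f x = 0 -> `|t| <= 1 / 2 ->
  rintegrable Q (fun x => expR (t * f x)) /\
  \int[Q]_x expR (t * f x) <= expR (16 * K * t ^+ 2).
Proof.
move=> sf f0 t12; have [mf fi fK] := sf.
have t0 : 0 <= `|t| by [].
have rf : rintegrable Q f.
  by apply: (subexp_dominated (c := 1) sf mf _).1 => x; rewrite mul1r le_expR.
have mt : measurable_fun [set: E] (fun x => expR (t * f x)).
  by apply: measurableT_comp => //; exact: measurable_funM.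
have ri : rintegrable Q (fun x => expR (t * f x)).
  apply: (subexp_dominated (c := 1) sf mt _).1 => x.
  rewrite mul1r ger0_norm ?expR_ge0// ler_expR (le_trans (ler_norm _))// normrM.
  by rewrite ler_piMl//; lra.
split => //.
have pw x : expR (t * f x) <= 1 + t * f x + 16 * t ^+ 2 * expR `|f x|.
  have := ler_normlW (expR_taylor1 (t * f x)); rewrite normrM.
  set y := `|f x|; have y0 : 0 <= y by rewrite /y.
  have h1 : `|t| * y * (`|t| * y * expR (`|t| * y)) <= 16 * t ^+ 2 * expR y.
    rewrite -[t ^+ 2]real_normK ?num_real//.
    have -> : `|t| * y * (`|t| * y * expR (`|t| * y)) = `|t| ^+ 2 * (y ^+ 2 * expR (`|t| * y)) by ring.
    have -> : 16 * `|t| ^+ 2 * expR y = `|t| ^+ 2 * (16 * expR (y / 2) * expR (y / 2)).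
      by rewrite {1}[y in expR y]splitr expRD; ring.
    apply: ler_wpM2l; first exact: exprn_ge0.
    apply: ler_pM; rewrite ?exprn_ge0 ?expR_ge0//.
      by have := @sqr_le_expR (y / 2); rewrite divr_ge0// => /(_ isT); lra.
    by rewrite ler_expR; nra.
  lra.
have rt : rintegrable Q (fun x => 1 + t * f x).
  by apply: rintegrableD; [exact: rintegrable_cst|exact: rintegrableZl].
have re := rintegrableZl (16 * t ^+ 2) fi.
apply: (@le_trans _ _ (1 + 16 * K * t ^+ 2)); last exact: expR_ge1Dx.
apply: (@le_trans _ _ (\int[Q]_x (1 + t * f x + 16 * t ^+ 2 * expR `|f x|))).
  by apply: le_Rintegral => //; exact: rintegrableD.
rewrite rintD// rintD; [|exact: rintegrable_cst|exact: rintegrableZl].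
rewrite Rintegral_cst_probability !rintZl// f0 mulr0 addr0 lerD2l.
by rewrite [leRHS]mulrAC ler_wpM2l// mulr_ge0// sqr_ge0.
Qed.

End exponential_moments.

(** Lets terms without a logarithm be absorbed into multiples of ln n. *)
Lemma half_le_ln {R : realType} n : (1 < n)%N -> 1 / 2 <= ln n%:R :> R.
Proof.
move=> n1; have e : expR (1 / 2) <= 2 :> R.
  have h1 := expR_ge1Dx (- (1 / 2) : R); have h2 := expR_gt0 (1 / 2 : R).
  have h3 : expR (1 / 2) * expR (- (1 / 2)) = 1 :> R by rewrite -expRD subrr expR0.
  nra.
rewrite -(expRK (1 / 2)) ler_ln ?posrE ?expR_gt0 ?ltr0n ?(ltnW n1)//.
by apply: (le_trans e); rewrite ler_nat.
Qed.

Section chernoff.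
Context {dO dE} {Omega : measurableType dO} {E : measurableType dE} {R : realType}
  (P : probability Omega R) (Q : probability E R) {n : nat}.
Variable Y : 'I_n -> {RV P >-> E}.
Hypotheses (iY : mutually_independent Y)
  (YQ : forall i A, measurable A -> P (Y i @^-1` A) = Q A).

Lemma integral_sample (i : 'I_n) (f : E -> R) : measurable_fun [set: E] f ->
  (forall x, 0 <= f x) -> (\int[P]_w (f (Y i w))%:E = \int[Q]_x (f x)%:E)%E.
Proof.
move=> mf f0.
have mY : measurable_fun [set: Omega] (Y i) by [].
have mF : measurable_fun [set: E] (EFin \o f) by apply/measurable_EFinP.
have F0 x : (0 <= (EFin \o f) x)%E by rewrite lee_fin.
rewrite -(ge0_integral_law P mY mF F0).
by apply: eq_measure_integral => A mA _; exact: YQ.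
Qed.

Lemma chernoff (f : E -> R) K t y : subexp Q f K -> \int[Q]_x f x = 0 -> `|t| <= 1 / 2 ->
  (P [set w | (y <= t * \sum_(i < n) f (Y i w))%R] <= (expR (16 * K * t ^+ 2 *+ n - y))%:E)%E.
Proof.
move=> sf f0 t12; have [mf _ _] := sf; have [ri rle] := subexp_mgf sf f0 t12.
set A := [set w | _]; pose W w := expR (t * \sum_(i < n) f (Y i w)).
have mS : measurable_fun [set: Omega] (fun w => t * \sum_(i < n) f (Y i w)).
  by apply: measurable_funM => //; apply: measurable_sum => i; exact: measurableT_comp.
have mA : measurable A.
  rewrite (_ : A = (fun w => t * \sum_(i < n) f (Y i w)) @^-1` `[y, +oo[%classic); last first.
    by apply/seteqP; split => w /=; rewrite in_itv /= andbT.
  by rewrite -[X in measurable X]setTI; exact: mS.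
have EW : (\int[P]_w (W w)%:E <= (expR (16 * K * t ^+ 2 *+ n))%:E)%E.
  have -> : (\int[P]_w (W w)%:E = \int[P]_w (\prod_(i < n) expR (t * f (Y i w)))%:E)%E.
    by apply: eq_integral => w _; rewrite /W mulr_sumr expR_sum.
  have mtf : measurable_fun [set: E] (fun x => expR (t * f x)).
    by apply: measurableT_comp => //; exact: measurable_funM.
  rewrite (expectation_prod_independent (f := fun _ x => expR (t * f x)) iY)//.
  have Ei (i : 'I_n) : (\int[P]_w (expR (t * f (Y i w)))%:E =
      (\int[Q]_x expR (t * f x))%R%:E)%E.
    rewrite (integral_sample i mtf); last by move=> x; exact: expR_ge0.
    by rewrite /Rintegral fineK//; exact: (integrable_fin_num measurableT ri).
  under eq_bigr do rewrite Ei.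
  rewrite prodEFin lee_fin prodr_const card_ord.
  rewrite -mulr_natl expRM_natl lerXn2r// ?nnegrE ?expR_ge0//.
  by apply: Rintegral_ge0 => x _; exact: expR_ge0.
rewrite expRB -(@lee_pmul2r _ (expR y)%:E) ?lte_fin ?expR_gt0//.
rewrite -EFinM divfK ?gt_eqF ?expR_gt0//; apply: le_trans EW.
rewrite muleC -integral_cst//= integral_mkcond.
apply: ge0_le_integral => //.
- by move=> w _; rewrite /patch; case: ifP => // _; rewrite lee_fin expR_ge0.
- apply/(measurable_restrictT _ mA); exact: measurable_cst.
- apply/measurable_EFinP; exact: measurableT_comp.
- move=> w _; rewrite /patch; case: ifPn => [|_]; last by rewrite lee_fin expR_ge0.
  by rewrite inE => Aw; rewrite lee_fin ler_expR.
Qed.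

Lemma sub_union_bound (I : eqType) (s : seq I) (A : I -> set Omega) (e : R) : 0 <= e ->
  (forall k, measurable (A k)) -> (forall k, (P (A k) <= e%:E)%E) ->
  exists F, [/\ measurable F, (P F <= ((size s)%:R * e)%:E)%E &
    forall k, k \in s -> A k `<=` F].
Proof.
move=> e0 mA Ae; elim: s => [|k s [F [mF PF sF]]].
  by exists set0; split; rewrite ?measure0 ?mul0r.
exists (A k `|` F); split; first exact: measurableU.
  apply: (le_trans (measureU2 _ _ _)) => //.
  by rewrite /= -natr1 mulrDl mul1r addrC EFinD leeD.
move=> j; rewrite inE => /orP[/eqP ->|/sF]; first exact: subsetUl.
by move/subset_trans; apply; exact: subsetUr.
Qed.

Let L : R := ln n%:R.
Let s : R := Num.sqrt (n%:R * L).
Hypothesis n1 : (1 < n)%N.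

Let n0 : 0 < n%:R :> R. Proof. by rewrite ltr0n ltnW. Qed.
Let L0 : 0 <= L. Proof. by rewrite ln_ge0// ler1n ltnW. Qed.
Let Ln : L <= n%:R.
Proof. by rewrite /L ltW// ln_sublinear. Qed.

Let t := 2^-1 * (s / n%:R).

Let t0 : 0 <= t. Proof. by rewrite mulr_ge0// divr_ge0// sqrtr_ge0. Qed.

Let ss : s ^+ 2 = n%:R * L.
Proof. by rewrite sqr_sqrtr// mulr_ge0// ltW. Qed.

Let t12 : t <= 1 / 2.
Proof.
rewrite /t mul1r ler_piMr// ler_pdivrMr// mul1r.
rewrite -[leRHS](ger0_norm (ltW n0)) -sqrtr_sqr expr2 ler_wsqrtr//.
by rewrite ler_pM2l.
Qed.

(** Chernoff's bound with t = s / (2 n), half of sqrt (L / n): then 16 K t^2 n = 4 K L, and the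
    level y = (p + 4 K) L leaves exp (- p L) = n^(-p). The exponent p stays free to beat the size of
    the family. *)
Lemma deviation (f : E -> R) K p : subexp Q f K -> \int[Q]_x f x = 0 ->
  (P [set w | (2 * (p%:R + 4 * K) * s < `|\sum_(i < n) f (Y i w)|)%R] <=
    (2 * n%:R ^- p)%:E)%E.
Proof.
move=> sf f0; have [mf _ _] := sf.
have K1 := subexp_ge1 sf.
pose y := (p%:R + 4 * K) * L.
have tt : t ^+ 2 = (4 * n%:R)^-1 * L.
  by rewrite /t !exprMn ss; field; rewrite gt_eqF.
have ts : t * s = 2^-1 * L.
  by rewrite /t -mulrA mulrAC -expr2 ss; field; rewrite gt_eqF.
have ee : expR (16 * K * t ^+ 2 *+ n - y) = n%:R ^- p.
  rewrite (_ : _ - y = - (p%:R * L)); last first.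
    by rewrite tt /y -mulr_natr; field; rewrite gt_eqF.
  by rewrite expRN expRM_natl lnK// posrE.
have tn : `|t| <= 1 / 2 by rewrite ger0_norm.
have tn' : `|- t| <= 1 / 2 by rewrite normrN ger0_norm.
have c1 := chernoff y sf f0 tn; have c2 := chernoff y sf f0 tn'.
rewrite sqrrN in c2; rewrite ee in c1; rewrite ee in c2.
have mS : measurable_fun [set: Omega] (fun w => \sum_(i < n) f (Y i w)).
  by apply: measurable_sum => i; exact: measurableT_comp.
have mS' r : measurable_fun [set: Omega] (fun w => r * \sum_(i < n) f (Y i w)).
  exact: measurable_funM.
have mA r : measurable [set w | y <= r * \sum_(i < n) f (Y i w)].
  rewrite (_ : [set _ | _] = (fun w => r * \sum_(i < n) f (Y i w)) @^-1` `[y, +oo[%classic).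
    by rewrite -[X in measurable X]setTI; exact: mS'.
  by apply/seteqP; split => w /=; rewrite in_itv /= andbT.
have mD : measurable [set w | 2 * (p%:R + 4 * K) * s < `|\sum_(i < n) f (Y i w)|].
  rewrite (_ : [set _ | _] = (fun w => `|\sum_(i < n) f (Y i w)|) @^-1`
      `]2 * (p%:R + 4 * K) * s, +oo[%classic).
    by rewrite -[X in measurable X]setTI; apply: measurableT_comp.
  by apply/seteqP; split => w /=; rewrite in_itv /= andbT.
rewrite (_ : 2 * n%:R ^- p = n%:R ^- p + n%:R ^- p) ?EFinD; last by ring.
apply: le_trans (leeD c1 c2); apply: le_trans (measureU2 _ (mA _) (mA _)).
apply: le_measure; rewrite ?inE//; first exact: measurableU.
move=> w /=; set S := \sum_(i < n) _ => hS.
have h : y <= t * `|S|.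
  have -> : y = t * (2 * (p%:R + 4 * K) * s).
    by rewrite mulrCA ts /y; field.
  by rewrite ler_wpM2l// ltW.
have [S0|S0] := leP 0 S; [left|right].
  by rewrite ger0_norm in h.
by rewrite ltr0_norm// mulrN in h; rewrite mulNr.
Qed.

Lemma deviations (I : finType) (f : I -> E -> R) K p : 
  (forall k, subexp Q (f k) K) -> (forall k, \int[Q]_x f k x = 0) ->
  exists F, [/\ measurable F, (P F <= (#|I|%:R * (2 * n%:R ^- p))%:E)%E &
    forall w, ~ F w -> forall k,
      `|\sum_(i < n) f k (Y i w)| <= 2 * (p%:R + 4 * K) * s].
Proof.
move=> sf f0.
have mD k : measurable [set w | 2 * (p%:R + 4 * K) * s < `|\sum_(i < n) f k (Y i w)|].
  rewrite (_ : [set _ | _] = (fun w => `|\sum_(i < n) f k (Y i w)|) @^-1`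
      `]2 * (p%:R + 4 * K) * s, +oo[%classic).
    rewrite -[X in measurable X]setTI; apply: measurableT_comp => //.
    by apply: measurable_sum => i; apply: measurableT_comp => //; have [] := sf k.
  by apply/seteqP; split => w /=; rewrite in_itv /= andbT.
have e0 : 0 <= 2 * n%:R ^- p :> R by rewrite mulr_ge0// invr_ge0 exprn_ge0.
have [F [mF PF sF]] := sub_union_bound (enum I) e0 mD (fun k => deviation p (sf k) (f0 k)).
exists F; split; rewrite ?cardE// => w Fw k; rewrite leNgt; apply/negP => h.
by apply: Fw; apply: (sF k) => //; rewrite mem_enum.
Qed.

End chernoff.

(** * Linearisation of the estimating equation *)

Section euclidean_norm.
Context {R : realType} {d : nat}.
Local Notation V := 'cV[R]_d.
Implicit Types u v : V.

Lemma enorm_ge0 v : 0 <= enorm v. Proof. exact: sqrtr_ge0. Qed.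

Lemma sqr_enorm v : enorm v ^+ 2 = dotv v v.
Proof. by rewrite sqr_sqrtr// dotv_ge0. Qed.

Lemma dotvC u v : dotv u v = dotv v u.
Proof. by apply: eq_bigr => i _; rewrite mulrC. Qed.

Lemma dotvDl u u' v : dotv (u + u') v = dotv u v + dotv u' v.
Proof. by rewrite /dotv -big_split; apply: eq_bigr => i _; rewrite mxE mulrDl. Qed.

Lemma dotvZl c u v : dotv (c *: u) v = c * dotv u v.
Proof. by rewrite /dotv mulr_sumr; apply: eq_bigr => i _; rewrite mxE mulrA. Qed.

Lemma cauchy_schwarz u v : dotv u v <= enorm u * enorm v.
Proof.
have Hu : enorm u = 0 -> u = 0 by move=> e0; apply: dotv_eq0; rewrite -sqr_enorm e0 expr0n.
have Hv : enorm v = 0 -> v = 0 by move=> e0; apply: dotv_eq0; rewrite -sqr_enorm e0 expr0n.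
have d0 w : dotv 0 w = 0 by rewrite /dotv big1// => i _; rewrite mxE mul0r.
have [u0|u0] := eqVneq (enorm u) 0; first by rewrite u0 (Hu u0) d0 mul0r.
have [v0|v0] := eqVneq (enorm v) 0; first by rewrite v0 (Hv v0) dotvC d0 mulr0.
have := dotv_ge0 (enorm v *: u + (- enorm u) *: v).
rewrite !(dotvDl, dotvZl) !(dotvC _ (_ + _)) !(dotvDl, dotvZl) -!sqr_enorm (dotvC v u).
set a := enorm u in u0 *; set b := enorm v in v0 *; set c := dotv u v.
have a0 : 0 < a by rewrite lt_neqAle eq_sym u0 enorm_ge0.
have b0 : 0 < b by rewrite lt_neqAle eq_sym v0 enorm_ge0.
have -> : b * (b * a ^+ 2 + - a * c) + - a * (b * c + - a * b ^+ 2) =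
  2 * (a * b) * (a * b - c) by ring.
by rewrite pmulr_rge0 ?subr_ge0// mulr_gt0// mulr_gt0.
Qed.

Lemma enormD u v : enorm (u + v) <= enorm u + enorm v.
Proof.
rewrite -(@ler_pXn2r _ 2)// ?nnegrE ?addr_ge0 ?enorm_ge0// sqr_enorm dotvDl.
rewrite !(dotvC _ (_ + _)) !dotvDl -!sqr_enorm (dotvC v u).
have := cauchy_schwarz u v; lra.
Qed.

Lemma enorm_norm1 v : enorm v <= norm1 v.
Proof.
rewrite -(@ler_pXn2r _ 2)// ?nnegrE ?norm1_ge0 ?enorm_ge0// sqr_enorm expr2.
exact: le_trans (ler_norm _) (dotv_norm1 v v).
Qed.

Lemma coord_enorm v j : `|v j 0| <= enorm v.
Proof.
rewrite -sqrtr_sqr /enorm ler_wsqrtr// /dotv (bigD1 j)//= expr2 lerDl.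
by apply: sumr_ge0 => i _; rewrite -expr2 sqr_ge0.
Qed.

Lemma norm1_le v c : (forall j, `|v j 0| <= c) -> norm1 v <= d%:R * c.
Proof.
move=> vc; rewrite mulr_natl -[d in leRHS]card_ord -sumr_const.
by apply: ler_sum => j _; exact: vc.
Qed.

Lemma enormB u v : enorm (u - v) = enorm (v - u).
Proof. by rewrite /enorm -opprB -scaleN1r dotvZl dotvC dotvZl !mulN1r opprK. Qed.

End euclidean_norm.

Section grid.
Context {R : realType} {d : nat}.
Local Notation V := 'cV[R]_d.
Variables (m n : nat) (Theta : set V) (o : V).

(** The shift by n makes coordinates within n of o nonnegative. The mesh is 1 / (n d) in each
    coordinate, so that d coordinates add up to 1 / n. *)
Definition grid_cell (v : V) : {ffun 'I_d -> 'I_m.+1} :=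
  [ffun j => inord (Num.truncn ((v j 0 - o j 0 + n%:R) * (n * d)%:R))].

(** The representative is a point of Theta, where the Lipschitz bound holds, and not a centre of the
    cell; a cell that misses Theta gets o. *)
Definition grid_rep (k : {ffun 'I_d -> 'I_m.+1}) : V :=
  xget o [set v | Theta v /\ grid_cell v = k].

Hypotheses (To : Theta o) (n0 : (0 < n)%N) (mn : (2 * n ^ 2 * d <= m)%N).

Lemma grid_rep_in k : Theta (grid_rep k).
Proof. by rewrite /grid_rep; case: xgetP => // v _ []. Qed.

Lemma grid_rep_close v : Theta v -> (forall u, Theta u -> enorm (u - o) <= n%:R) ->
  enorm (v - grid_rep (grid_cell v)) <= n%:R^-1.
Proof.
move=> Tv Tn; rewrite /grid_rep; case: xgetP => [u _ [Tu uv]|/(_ v)[]//].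
have n0' : 0 < n%:R :> R by rewrite ltr0n.
have [d0|d0] := posnP d.
  rewrite (le_trans (enorm_norm1 _))// /norm1 big1 ?invr_ge0 ?ltW// => j _.
  by exfalso; have := ltn_ord j; lia.
have d0' : 0 < d%:R :> R by rewrite ltr0n.
have nd : 0 < (n * d)%:R :> R by rewrite ltr0n muln_gt0 n0.
pose f (w : V) (j : 'I_d) : R := (w j 0 - o j 0 + n%:R) * (n * d)%:R.
have tr w : Theta w -> forall j, (grid_cell w j)%:R <= f w j < (grid_cell w j)%:R + 1.
  move=> Tw j; set y := f w j; have := le_trans (coord_enorm (w - o) j) (Tn _ Tw).
  rewrite !mxE ler_norml => /andP[h1 h2].
  have y0 : 0 <= y by apply: mulr_ge0; [lra|exact: ltW].
  have ym : y <= m%:R.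
    apply: (@le_trans _ _ (2 * n ^ 2 * d)%:R); last by rewrite ler_nat.
    rewrite (_ : (2 * n ^ 2 * d)%:R = (2 * n%:R) * (n * d)%:R :> R); last first.
      by rewrite !natrM; ring.
    by apply: ler_wpM2r; [exact: ltW|lra].
  have /andP[t1 t2] := truncn_itv y0.
  have tm : (Num.truncn y < m.+1)%N.
    by rewrite ltnS -(ler_nat R); exact: le_trans t1 ym.
  by rewrite ffunE inordK// t1 /= natr1.
apply: (le_trans (enorm_norm1 _)).
have -> : n%:R^-1 = d%:R * (n * d)%:R^-1 :> R.
  by rewrite natrM; field; rewrite !gt_eqF.
apply: norm1_le => j; rewrite !mxE.
rewrite -(@ler_pM2r _ (n * d)%:R)// mulVf ?gt_eqF//.
rewrite -(ger0_norm (ltW nd)) -normrM; have := tr _ Tu j; have := tr _ Tv j; rewrite uv /f => /andP[a1 a2] /andP[b1 b2].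
by rewrite ler_norml; apply/andP; split; lra.
Qed.

Lemma card_grid : (m <= 2 * n ^ 2 * d)%N -> (0 < d)%N ->
  #|{ffun 'I_d -> 'I_m.+1}|%:R <= (3 * d%:R) ^+ d * n%:R ^+ (2 * d) :> R.
Proof.
move=> mn' d0; rewrite card_ffun !card_ord natrX exprM -exprMn lerXn2r ?nnegrE ?mulr_ge0//.
apply: (@le_trans _ _ (3 * d * n ^ 2)%:R); last by rewrite !natrM expr2.
rewrite ler_nat; apply: (leq_ltn_trans mn'); rewrite (_ : 3 * d * n ^ 2 = 2 * n ^ 2 * d + n ^ 2 * d)%N.
  by rewrite -addn1 leq_add2l muln_gt0 expn_gt0 n0.
lia.
Qed.

End grid.

Section linearisation.
Context {dO dE} {Omega : measurableType dO} {E : measurableType dE} {R : realType}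
  (P : probability Omega R) (Q : probability E R) {n d : nat}.
Local Notation V := 'cV[R]_d.
Variable Y : 'I_n -> {RV P >-> E}.
Hypotheses (iY : mutually_independent Y)
  (YQ : forall i A, measurable A -> P (Y i @^-1` A) = Q A)
  (n1 : (1 < n)%N) (d0 : (0 < d)%N).
Variables (Theta : set V) (h : V -> E -> V) (h0 : E -> R) (o : V) (a b c1 mu : R)
  (M : 'M[R]_d).
Hypotheses (a0 : 0 < a) (b0 : 0 < b) (c10 : 0 < c1) (mu0 : 0 < mu) (To : Theta o)
  (mh : forall t j, Theta t -> measurable_fun [set: E] (fun x => h t x j 0))
  (h0_ge0 : forall x, 0 <= h0 x)
  (lip : forall x t t', Theta t -> Theta t' -> forall j,
    `|h t x j 0 - h t' x j 0| <= h0 x * enorm (t - t'))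
  (sh0 : subexp Q (fun x => a^-1 * h0 x) 2)
  (sxi : forall j, subexp Q (fun x => b^-1 * h o x j 0) 2).

Definition mean_score (t : V) : V := \col_j \int[Q]_x h t x j 0.
Local Notation m := mean_score.

Hypotheses (mo : m o = 0)
  (mono : forall t, Theta t -> mu * enorm (t - o) ^+ 2 <= dotv (m t) (t - o))
  (diff : forall t, Theta t -> enorm (m t - M *m (t - o)) <= c1 * enorm (t - o) ^+ 2)
  (diam : forall t, Theta t -> enorm (t - o) <= n%:R).

(** The mean of g is at most 2 in absolute value, so centring multiplies the exponential moment by
    at most e^2. *)
Lemma subexp_center (u g : E -> R) : subexp Q u 2 -> measurable_fun [set: E] g ->
  (forall x, `|g x| <= `|u x|) ->
  [/\ rintegrable Q g, `|\int[Q]_x g x| <= 2,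
    subexp Q (fun x => g x - \int[Q]_y g y) (2 * expR 2) &
    \int[Q]_x (g x - \int[Q]_y g y) = 0].
Proof.
move=> su mg gu; have [mu_ ui u2] := su.
have [gi gle] : rintegrable Q g /\ `|\int[Q]_x g x| <= 1 * \int[Q]_x expR `|u x|.
  apply: (subexp_dominated su mg) => x; rewrite mul1r.
  exact: le_trans (gu x) (le_expR _).
have g2 : `|\int[Q]_x g x| <= 2 by apply: (le_trans gle); rewrite mul1r.
have cst := rintegrable_cst Q (\int[Q]_y g y).
have mgc : measurable_fun [set: E] (fun x => g x - \int[Q]_y g y).
  exact: measurable_funB.
have mexp : measurable_fun [set: E] (fun x => expR `|g x - \int[Q]_y g y|).
  by apply: measurableT_comp => //; exact: measurableT_comp.
have le x : `|expR `|g x - \int[Q]_y g y| | <= expR 2 * expR `|u x|.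
  rewrite ger0_norm ?expR_ge0// -expRD ler_expR [2 + _]addrC.
  by apply: (le_trans (ler_normB _ _)); exact: lerD.
have [ei ele] := subexp_dominated su mexp le.
split => //; first split => //.
  apply: (le_trans (ler_norm _)); apply: (le_trans ele).
  by rewrite mulrC ler_wpM2r// expR_ge0.
by rewrite rintB// Rintegral_cst_probability subrr.
Qed.

Let K : R := 2 * expR 2.
(** The grid has O(n^(2 d)) points; one more power of n leaves a failure probability O(1 / n). *)
Let p := (2 * d).+1.
Let B : R := 2 * (p%:R + 4 * K).
Let L : R := ln n%:R.
Let s : R := Num.sqrt (n%:R * L).
Let nn : 0 < n%:R :> R. Proof. by rewrite ltr0n ltnW. Qed.
Let L12 : 1 / 2 <= L. Proof. exact: half_le_ln. Qed.
Let Ln : L <= n%:R. Proof. by rewrite /L ltW// ln_sublinear. Qed.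
Let ss : s ^+ 2 = n%:R * L.
Proof. by rewrite sqr_sqrtr// mulr_ge0//; have := L12; lra. Qed.
Let s0 : 0 <= s. Proof. exact: sqrtr_ge0. Qed.
Let s1 : 1 <= s.
Proof.
rewrite -(@sqrtr1 R) ler_wsqrtr//; have := L12.
have : 2 <= n%:R :> R by rewrite ler_nat.
nra.
Qed.
Let sn : s <= n%:R.
Proof.
by rewrite -[leRHS](ger0_norm (ltW nn)) -sqrtr_sqr expr2 ler_wsqrtr// ler_pM2l.
Qed.
Let B0 : 0 <= B.
Proof. by rewrite /B mulr_ge0// addr_ge0// mulr_ge0// mulr_ge0// expR_ge0. Qed.

Let xi_int j : rintegrable Q (fun x => h o x j 0).
Proof.
have [ri _ _ _] := subexp_center (sxi j) (subexp_measurable (sxi j)) (fun=> lexx _).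
have := rintegrableZl b ri; congr (rintegrable Q _); apply/funext => x.
by rewrite mulVKf ?gt_eqF.
Qed.

Let xi0 j : m o j 0 = 0. Proof. by rewrite mo [LHS]mxE. Qed.

Let D t j x := h t x j 0 - h o x j 0.
(** The increment divided by its Lipschitz scale is dominated by h0 / a uniformly in t, so
    fluctuations of D are proportional to the distance to o. At t = o both D and the inverse are
    0. *)
Let g t j x := (a * enorm (t - o))^-1 * D t j x.

Let gP t j x : Theta t -> D t j x = a * enorm (t - o) * g t j x.
Proof.
move=> Tt; have := lip x Tt To j; rewrite /g -/(D t j x).
have [->|e0 _] := eqVneq (enorm (t - o)) 0.
  by rewrite !mulr0 mul0r normr_le0 => /eqP.
by rewrite mulVKf// mulf_neq0// gt_eqF.
Qed.

Let mg t j : Theta t -> measurable_fun [set: E] (g t j).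
Proof.
move=> Tt; apply: measurable_funM => //; apply: measurable_funB; exact: mh.
Qed.

Let gu t j x : Theta t -> `|g t j x| <= `|a^-1 * h0 x|.
Proof.
move=> Tt; rewrite [leRHS]ger0_norm ?mulr_ge0 ?invr_ge0 ?(ltW a0)//.
rewrite /g normrM normfV [`|a * _|]ger0_norm ?mulr_ge0 ?enorm_ge0 ?(ltW a0)//.
have := lip x Tt To j; rewrite -/(D t j x).
have [->|e0] := eqVneq (enorm (t - o)) 0.
  by move=> _; rewrite mulr0 invr0 mul0r mulr_ge0 ?invr_ge0 ?(ltW a0).
have e1 : 0 < enorm (t - o) by rewrite lt_neqAle eq_sym e0 enorm_ge0.
move=> hl; rewrite invfM -mulrA ler_pM2l ?invr_gt0// [leLHS]mulrC ler_pdivrMr//.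
Qed.

Let mD t j : Theta t -> rintegrable Q (D t j) /\ \int[Q]_x D t j x = m t j 0.
Proof.
move=> Tt; have [gi _ _ _] := subexp_center sh0 (mg j Tt) (fun x => gu j x Tt).
have Di : rintegrable Q (D t j).
  have := rintegrableZl (a * enorm (t - o)) gi; congr (rintegrable Q _).
  by apply/funext => x; rewrite (gP j x Tt).
split=> //.
have -> : m t j 0 = m t j 0 - m o j 0 by rewrite mo [X in _ - X]mxE subr0.
rewrite !mxE -rintB; [by []| |exact: xi_int].
have := rintegrableD Di (xi_int j); congr (rintegrable Q _).
by apply/funext => x; rewrite subrK.
Qed.

(** C2 is the localisation constant, n |t - o| <= C2 sqrt (n L). The three terms come from the
    fluctuation of the increments, the grid error with 1 <= 2 L, and the quadratic remainder of
    (B1). *)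
Definition linear_const : R :=
  let C2 := 2 * d%:R * (b * B + (4 + 2 * B) * a) / mu in
  a * B * C2 + 2 * (4 + 2 * B) * a + c1 * C2 ^+ 2.

Let M' := (2 * n ^ 2 * d)%N.
Let rep := @grid_rep R d M' n Theta o.
Let cell := @grid_cell R d M' n o.
Let rep_in k : Theta (rep k). Proof. exact: grid_rep_in. Qed.

(** All functions needing a deviation bound: the score coordinates at o, the Lipschitz envelope, and
    the normalised increments at the grid points. *)
Let I : finType := ('I_d + (unit + {ffun 'I_d -> 'I_M'.+1} * 'I_d))%type.
Let cen (f : E -> R) x := f x - \int[Q]_y f y.
Let F (i : I) : E -> R := match i with
  | inl j => fun x => b^-1 * h o x j 0
  | inr (inl _) => cen (fun x => a^-1 * h0 x)
  | inr (inr (k, j)) => cen (g (rep k) j)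
  end.

(** Off G the bound is deterministic and holds for every root t in Theta at once, so the estimator
    may be substituted as a random point. The smallness condition keeps the random part of the
    increments below half of the drift given by monotonicity. *)
Lemma linearisation :
  2 * (d%:R * a * B * s) <= n%:R * mu ->
  exists G, [/\ measurable G,
    (P G <= (6 * d%:R * (3 * d%:R) ^+ d / n%:R)%:E)%E &
    forall w, ~ G w -> forall t, Theta t ->
      (forall j, \sum_(i < n) h t (Y i w) j 0 = 0) -> forall j,
      `|n%:R * (M *m (t - o)) j 0 + \sum_(i < n) h o (Y i w) j 0| <= linear_const * L].
Proof.
move=> small.
have K2 : 2 <= K.
  by rewrite /K ler_peMr// -expR0 ler_expR.
have sF i : subexp Q (F i) K /\ \int[Q]_x F i x = 0.
  case: i => [j|[u|[k j]]] /=.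
  - have [mf fi f2] := sxi j; split; first by split => //; exact: le_trans K2.
    by rewrite rintZl//; have := xi0 j; rewrite mxE => ->; rewrite mulr0.
  - by have [_ _ s1' s2'] := subexp_center sh0 (subexp_measurable sh0) (fun=> lexx _).
  - by have [_ _ s1' s2'] := subexp_center sh0 (mg j (rep_in k)) (fun x => gu j x (rep_in k)).
have [G [mG PG GF]] := deviations iY YQ n1 p (fun i => (sF i).1) (fun i => (sF i).2).
exists G; split => //.
  apply: (le_trans PG); rewrite lee_fin.
  have := @card_grid R d M' n (ltnW n1) (leqnn _) (leqnn _) d0.
  rewrite !(card_sum, card_prod, card_unit, card_ord) !natrD natrM.
  set X := #|_|%:R; set N := (3 * d%:R) ^+ d; set c := n%:R ^+ (2 * d) => XN.
  have d1 : 1 <= d%:R :> R by rewrite ler1n.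
  have N1 : 1 <= N by rewrite exprn_ege1//; lra.
  have cge1 : 1 <= c by rewrite exprn_ege1// ler1n ltnW.
  have nc : 1 <= N * c by rewrite mulr_ege1.
  have -> : 2 * n%:R ^- p = 2 * (c^-1 * n%:R^-1) :> R by rewrite /p exprS invfM [c^-1 * _]mulrC.
  have -> : 6 * d%:R * N / n%:R = 3 * d%:R * (N * c) * (2 * (c^-1 * n%:R^-1)).
    by field; rewrite !gt_eqF// (lt_le_trans ltr01).
  apply: ler_wpM2r; first by rewrite !mulr_ge0// invr_ge0// ?ltW// (lt_le_trans ltr01).
  nra.
move=> w Gw t Tt tw j; have {}GF := GF w Gw.
rewrite -/L -/s -/B in GF.
have Tn u : Theta u -> enorm (u - o) <= n%:R by exact: diam.
pose t' := rep (cell t); have Tt' : Theta t' by exact: rep_in.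
have close : enorm (t - t') <= n%:R^-1.
  by apply: grid_rep_close => //; exact: ltnW.
set r := enorm (t - o); pose rho := enorm (t' - o).
have r0 : 0 <= r by exact: enorm_ge0.
have rho_r : rho <= r + n%:R^-1.
  rewrite /rho (_ : t' - o = (t - o) + (t' - t)); last by rewrite [RHS]addrC addrA subrK.
  by apply: (le_trans (enormD _ _)); rewrite lerD2l enormB.
pose S (f : E -> R) := \sum_(i < n) f (Y i w).
have Scen f : S (cen f) = S f - n%:R * \int[Q]_x f x.
  by rewrite /S /cen sumrB sumr_const card_ord mulr_natl.
have SZ c f : S (fun x => c * f x) = c * S f by rewrite /S mulr_sumr.
have [_ h0m _ _] := subexp_center sh0 (subexp_measurable sh0) (fun=> lexx _).
have e1 k : `|S (fun x => h o x k 0)| <= b * B * s.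
  have : `|S (fun x => b^-1 * h o x k 0)| <= B * s := GF (inl k).
  rewrite (SZ b^-1 (fun x => h o x k 0)) normrM normfV (gtr0_norm b0).
  by rewrite mulrC ler_pdivrMr// [leRHS]mulrC mulrA.
have e2 : S h0 <= a * (B * s + 2 * n%:R).
  have : `|S (cen (fun x => a^-1 * h0 x))| <= B * s := GF (inr (inl tt)).
  rewrite Scen SZ => /ler_normlW.
  rewrite lerBlDr mulrC ler_pdivrMr// => hh; apply: (le_trans hh).
  rewrite mulrC ler_pM2l// lerD2l mulrC ler_wpM2r// ?(ltW nn)//.
  exact: ler_normlW h0m.
have e3 k : `|S (D t' k) - n%:R * m t' k 0| <= a * rho * (B * s).
  have hh : `|S (cen (g t' k))| <= B * s := GF (inr (inr (cell t, k))).
  rewrite -(mD k Tt').2.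
  have -> : D t' k = (fun x => a * rho * g t' k x) by apply/funext => x; rewrite (gP k x Tt').
  have [gi _ _ _] := subexp_center sh0 (mg k Tt') (fun x => gu k x Tt').
  rewrite SZ rintZl// mulrCA -mulrBr -Scen normrM.
  have ar : 0 <= a * rho by rewrite mulr_ge0 ?enorm_ge0// ltW.
  by rewrite (ger0_norm ar); exact: ler_wpM2l.
(* Moving from t to its grid point costs the sum of h0 over n, which is bounded on this event; e5 is
   the same for the means. *)
have e4 k : `|S (fun x => h t x k 0) - S (fun x => h t' x k 0)| <= S h0 / n%:R.
  rewrite /S -sumrB mulr_suml; apply: (le_trans (ler_norm_sum _ _ _)).
  apply: ler_sum => i _; apply: (le_trans (lip _ Tt Tt' _)).
  exact: ler_wpM2l.
have e5 k : `|m t k 0 - m t' k 0| <= a / n%:R * 2.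
  have [Dt ti] := mD k Tt; have [Dt' ti'] := mD k Tt'.
  rewrite -ti -ti' -rintB//.
  have mDD : measurable_fun [set: E] (fun x => D t k x - D t' k x).
    exact: rintegrable_measurable (rintegrableB Dt Dt').
  have le x : `|D t k x - D t' k x| <= a / n%:R * expR `|a^-1 * h0 x|.
    rewrite /D opprB addrA subrK.
    apply: (le_trans (lip _ Tt Tt' _)).
    apply: (@le_trans _ _ (h0 x * n%:R^-1)); first exact: ler_wpM2l.
    rewrite [leRHS]mulrAC; apply: ler_wpM2r; first by rewrite invr_ge0 ltW.
    rewrite -ler_pdivrMl//; apply: le_trans (le_expR _).
    exact: ler_norm.
  have [_] := subexp_dominated sh0 mDD le; move/le_trans; apply.
  by apply: ler_wpM2l; [rewrite divr_ge0// ltW|case: sh0].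
have aB : 0 <= a * B by rewrite mulr_ge0// ltW.
(* The score at t vanishes, so this sum is minus the centred increment at t' plus the two errors of
   replacing t by t'. *)
have e6 k : `|S (fun x => h o x k 0) + n%:R * m t k 0| <= a * B * s * r + (4 + 2 * B) * a.
  have -> : S (fun x => h o x k 0) + n%:R * m t k 0 =
    - (S (D t' k) - n%:R * m t' k 0) - (S (fun x => h t x k 0) - S (fun x => h t' x k 0)) +
    n%:R * (m t k 0 - m t' k 0).
    have -> : S (D t' k) = S (fun x => h t' x k 0) - S (fun x => h o x k 0) by rewrite /S -sumrB.
    have -> : S (fun x => h t x k 0) = 0 by exact: tw.
    by ring.
  have f1 := e3 k; have f2 := e4 k; have f3 := e5 k.
  have g3 : `|n%:R * (m t k 0 - m t' k 0)| <= 2 * a.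
    rewrite normrM (gtr0_norm nn); apply: (le_trans (ler_wpM2l (ltW nn) f3)).
    by rewrite (_ : n%:R * (a / n%:R * 2) = 2 * a)//; field; rewrite gt_eqF.
  have g2 : S h0 / n%:R <= a * B + 2 * a.
    rewrite ler_pdivrMr//; apply: (le_trans e2).
    have : a * B * s <= a * B * n%:R by exact: ler_wpM2l.
    lra.
  have g1 : a * rho * (B * s) <= a * B * s * r + a * B.
    have sB : 0 <= a * B * s by rewrite mulr_ge0.
    have h1 := ler_wpM2l sB rho_r.
    have h2 : a * B * s * n%:R^-1 <= a * B.
      by rewrite ler_pdivrMr//; exact: ler_wpM2l.
    lra.
  apply: (le_trans (ler_normD _ _)); apply: (le_trans (lerD (ler_normB _ _) g3)).
  rewrite normrN; lra.
pose C2 := 2 * d%:R * (b * B + (4 + 2 * B) * a) / mu.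
set c4 := (4 + 2 * B) * a in e6 C2 *.
have c40 : 0 <= c4 by rewrite /c4 mulr_ge0 ?ltW//; have := B0; lra.
have bB : 0 <= b * B by rewrite mulr_ge0// ltW.
have dd : 0 <= d%:R :> R by [].
have C20 : 0 <= C2.
  by rewrite /C2 divr_ge0 ?(ltW mu0)// mulr_ge0 ?mulr_ge0// addr_ge0.
(* Localisation: monotonicity gives mu r^2 <= <m t, t - o>, e1 and e6 bound m t, and [small] absorbs
   the term proportional to r into the left side. *)
have rbound : n%:R * r <= C2 * s.
  pose tau := b * B * s + (a * B * s * r + c4).
  have mt k : `|m t k 0| <= tau / n%:R.
    rewrite ler_pdivlMr// mulrC -{1}(gtr0_norm nn) -normrM.
    rewrite (_ : n%:R * m t k 0 = (S (fun x => h o x k 0) + n%:R * m t k 0) -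
      S (fun x => h o x k 0)); last by ring.
    by apply: (le_trans (ler_normB _ _)); rewrite /tau addrC; exact: lerD.
  have h1 : enorm (m t) <= d%:R * (tau / n%:R).
    exact: le_trans (enorm_norm1 _) (norm1_le mt).
  have h2 : mu * r ^+ 2 <= d%:R * (tau / n%:R) * r.
    apply: (le_trans (mono Tt)); apply: (le_trans (cauchy_schwarz _ _)).
    exact: ler_wpM2r.
  have h3 : mu * r * n%:R <= d%:R * tau.
    have [r00|rn0] := eqVneq r 0.
      rewrite r00 mulr0 mul0r; apply: mulr_ge0 => //; apply: addr_ge0; first exact: mulr_ge0.
      apply: addr_ge0 => //; apply: mulr_ge0 => //; exact: mulr_ge0.
    have rp : 0 < r by rewrite lt_neqAle eq_sym rn0.
    rewrite -ler_pdivlMr// -mulrA -(ler_pM2r rp).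
    by rewrite -[leLHS]mulrA -expr2.
  have h4 : 2 * (d%:R * a * B * s) * r <= n%:R * mu * r by exact: ler_wpM2r.
  have h5 : d%:R * c4 * 1 <= d%:R * c4 * s by apply: ler_wpM2l => //; rewrite mulr_ge0.
  rewrite /C2 mulrAC ler_pdivlMr//; move: h3; rewrite /tau; lra.
(* Here s^2 = n L turns the localisation into a logarithmic bound. *)
have sr : s * r <= C2 * L.
  rewrite -(ler_pM2r nn); have := ler_wpM2l s0 rbound.
  have -> : s * (C2 * s) = C2 * s ^+ 2 by ring.
  by rewrite ss; lra.
have nr2 : n%:R * r ^+ 2 <= C2 ^+ 2 * L.
  rewrite -(ler_pM2r nn); have nr0 : 0 <= n%:R * r by rewrite mulr_ge0.
  have := ler_pM nr0 nr0 rbound rbound.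
  have -> : C2 * s * (C2 * s) = C2 ^+ 2 * s ^+ 2 by ring.
  by rewrite ss; lra.
have e7 : `|m t j 0 - (M *m (t - o)) j 0| <= c1 * r ^+ 2.
  apply: le_trans (diff Tt); have := coord_enorm (m t - M *m (t - o)) j.
  by rewrite [X in `|X|]mxE [X in _ + X]mxE.
rewrite (_ : _ + _ = (S (fun x => h o x j 0) + n%:R * m t j 0) -
  n%:R * (m t j 0 - (M *m (t - o)) j 0)); last by rewrite /S; ring.
apply: (le_trans (ler_normB _ _)); rewrite normrM (gtr0_norm nn).
have := lerD (e6 j) (ler_wpM2l (ltW nn) e7) => /le_trans; apply.
have i1 : a * B * (s * r) <= a * B * (C2 * L) by exact: ler_wpM2l.
have i2 : c4 * (1 / 2) <= c4 * L by exact: ler_wpM2l.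
have i3 : c1 * (n%:R * r ^+ 2) <= c1 * (C2 ^+ 2 * L) by rewrite ler_pM2l.
have -> : linear_const = a * B * C2 + 2 * c4 + c1 * C2 ^+ 2 by rewrite /linear_const /= /C2 /c4 /B /p /K; ring.
lra.
Qed.

End linearisation.

(** * Distance over convex sets *)

Lemma rintegral_law {dO dT} {Omega : measurableType dO} {T : measurableType dT}
    {R : realType} (P : probability Omega R) (f : Omega -> T)
    (mf : measurable_fun [set: Omega] f) (F : T -> R) :
  measurable_fun [set: T] F -> rintegrable P (F \o f) ->
  rintegrable (law P mf) F /\ \int[law P mf]_x F x = \int[P]_w F (f w).
Proof.
move=> mF iF; split.
  apply/integrableP; split; first exact/measurable_EFinP.
  have mN : measurable_fun [set: T] (fun x => `|(EFin \o F) x|%E).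
    by apply/measurable_EFinP; apply: measurableT_comp.
  rewrite (ge0_integral_law P mf mN (fun=> abse_ge0 _)).
  by have /integrableP[_] := iF.
rewrite /Rintegral (integral_distribution (X := mfun_Sub (mem_set mf)))//.
exact/measurable_EFinP.
Qed.

Section inverse_square_root.
Context {R : realType} {d : nat}.
Variables (A : 'M[R]_d) (l : R).
Hypotheses (symA : A^T = A) (l0 : 0 < l) (lA : l <= lambda_min A).
Local Notation S := (inv_sqrtmx A).

Lemma lambda_min_unitmx : A \in unitmx.
Proof.
apply: posdef_unitmx; split => // v v0.
apply: lt_le_trans (quadratic_form_ge v symA l0 lA).
rewrite mulr_gt0// lt_neqAle eq_sym dotv_ge0 andbT.
by apply: contra_neq v0; exact: dotv_eq0.
Qed.

Lemma inv_sqrtmx_whitens : S *m A *m S^T = 1%:M.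
Proof.
have [[-> _] SS] := inv_sqrtmxP symA l0 lA.
apply: mulmx1C; rewrite mulmxA SS; exact: (mulVmx lambda_min_unitmx).
Qed.

Lemma dotv_mulmx (B : 'M[R]_d) (u v : 'cV[R]_d) : dotv (B *m u) v = dotv u (B^T *m v).
Proof.
have E (x y : 'cV[R]_d) : dotv x y = (x^T *m y) 0 0.
  by rewrite mxE; apply: eq_bigr => i _; rewrite mxE.
by rewrite !E trmx_mul mulmxA.
Qed.

(** |S v|^2 = <v, A^-1 v>, and l |A^-1 v| <= |v| follows from the lower bound on the quadratic form
    at A^-1 v. *)
Lemma enorm_inv_sqrtmx (v : 'cV[R]_d) : enorm (S *m v) <= enorm v / Num.sqrt l.
Proof.
have [[sS _] SS] := inv_sqrtmxP symA l0 lA.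
have sl : 0 < Num.sqrt l by rewrite sqrtr_gt0.
pose u := invmx A *m v.
have uv : l * enorm u <= enorm v.
  have [u0|u0] := eqVneq (enorm u) 0; first by rewrite u0 mulr0 enorm_ge0.
  have up : 0 < enorm u by rewrite lt_neqAle eq_sym u0 enorm_ge0.
  rewrite -(ler_pM2r up) -mulrA -expr2 sqr_enorm.
  apply: (le_trans (quadratic_form_ge u symA l0 lA)).
  by rewrite mulmxA mulmxV ?lambda_min_unitmx// mul1mx dotvC; exact: cauchy_schwarz.
rewrite ler_pdivlMr// -(@ler_pXn2r _ 2)// ?nnegrE ?mulr_ge0 ?enorm_ge0 ?(ltW sl)//.
rewrite exprMn (sqr_sqrtr (ltW l0)) [in leLHS]sqr_enorm dotv_mulmx sS mulmxA SS -/u.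
have := ler_wpM2l (ltW l0) (cauchy_schwarz v u).
have := ler_wpM2l (enorm_ge0 v) uv; lra.
Qed.

End inverse_square_root.

Section whitened_score.
Context {dE} {E : measurableType dE} {R : realType} (Q : probability E R) {d : nat}.
Local Notation V := 'cV[R]_d.
Variables (xi : E -> V) (b l : R) (A : 'M[R]_d).
Hypotheses (b0 : 0 < b) (l0 : 0 < l) (mxi : measurable_fun [set: E] xi)
  (sxi : subexp Q (fun x => b^-1 * enorm (xi x)) 2)
  (xi0 : forall j, \int[Q]_x xi x j 0 = 0)
  (AE : forall i j, A i j = \int[Q]_x (xi x i 0 * xi x j 0))
  (lA : l <= lambda_min A).

(** The sign is that of the linearisation, so that the sum of these vectors approximates the
    rescaled estimation error itself. *)
Definition whitened (x : E) : V := - (inv_sqrtmx A *m xi x).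

Let mc j : measurable_fun [set: E] (fun x => xi x j 0).
Proof. by have /measurable_vecP := mxi; apply. Qed.

Lemma measurable_whitened : measurable_fun [set: E] whitened.
Proof.
apply/measurable_vecP => j; under eq_fun do rewrite !mxE.
apply: measurableT_comp => //; apply: measurable_sum => k.
exact: measurable_funM.
Qed.

Definition whitened_law := law Q measurable_whitened.

Let symA : A^T = A.
Proof.
apply/matrixP => i j; rewrite mxE !AE; apply: eq_Rintegral => x _.
by rewrite mulrC.
Qed.

Let en x : `|b^-1 * enorm (xi x)| = b^-1 * enorm (xi x).
Proof. by rewrite ger0_norm// mulr_ge0 ?enorm_ge0// invr_ge0 ltW. Qed.

Let bxi x : enorm (xi x) = b * `|b^-1 * enorm (xi x)|.
Proof. by rewrite en mulVKf ?gt_eqF. Qed.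

Let ci j : rintegrable Q (fun x => xi x j 0).
Proof.
apply: (subexp_dominated (c := b) sxi (mc j) _).1 => x.
apply: (le_trans (coord_enorm _ _)); rewrite [leLHS]bxi.
by rewrite ler_pM2l// le_expR.
Qed.

Let cii j k : rintegrable Q (fun x => xi x j 0 * xi x k 0).
Proof.
have m : measurable_fun [set: E] (fun x => xi x j 0 * xi x k 0) by exact: measurable_funM.
apply: (subexp_dominated (c := b ^+ 2 * 4) sxi m _).1 => x.
rewrite normrM; apply: (@le_trans _ _ (enorm (xi x) ^+ 2)).
  by rewrite expr2 ler_pM// coord_enorm.
rewrite {1}bxi exprMn -mulrA ler_pM2l ?exprn_gt0//.
exact: sqr_le_expR.
Qed.

(** [norm1] of the whitened score is at most d b / sqrt l times y = |xi| / b, and y^3 <= 27 e^y,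
    whose mean is at most 27 * 2. *)
Let beta : R := (d%:R * b / Num.sqrt l) ^+ 3 * 54.

Let cube_int : rintegrable Q (fun x => norm1 (whitened x) ^+ 3) /\
  \int[Q]_x norm1 (whitened x) ^+ 3 <= beta.
Proof.
have sl : 0 < Num.sqrt l by rewrite sqrtr_gt0.
have m : measurable_fun [set: E] (fun x => norm1 (whitened x) ^+ 3).
  apply: measurable_funX; apply: (measurableT_comp (@measurable_norm1 R d)).
  exact: measurable_whitened.
have c0 : 0 <= d%:R * b / Num.sqrt l by rewrite divr_ge0 ?(ltW sl)// mulr_ge0// ltW.
have le x : `|norm1 (whitened x) ^+ 3| <=
    ((d%:R * b / Num.sqrt l) ^+ 3 * 27) * expR `|b^-1 * enorm (xi x)|.
  rewrite ger0_norm ?exprn_ge0 ?norm1_ge0// -mulrA.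
  apply: (@le_trans _ _ ((d%:R * b / Num.sqrt l) ^+ 3 * `|b^-1 * enorm (xi x)| ^+ 3)).
    rewrite -exprMn lerXn2r ?nnegrE ?norm1_ge0 ?(mulr_ge0 c0)//.
    have h j : `|whitened x j 0| <= enorm (xi x) / Num.sqrt l.
      rewrite mxE normrN; apply: (le_trans (coord_enorm _ _)).
      exact: (enorm_inv_sqrtmx symA l0 lA).
    apply: (le_trans (norm1_le h)); rewrite {1}bxi; set y := `|_|.
    by rewrite le_eqVlt; apply/orP; left; apply/eqP; ring.
  by apply: ler_wpM2l; [exact: exprn_ge0|exact: cube_le_expR].
have [ri rle] := subexp_dominated sxi m le; split => //.
apply: (le_trans (ler_norm _)); apply: (le_trans rle); rewrite /beta.
have [_ _ e2] := sxi.
rewrite (_ : 54 = 27 * 2) ?mulrA; last by rewrite -natrM.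
by apply: ler_wpM2l => //; rewrite mulr_ge0// exprn_ge0.
Qed.

Lemma isotropic_whitened : isotropic3 whitened_law.
Proof.
have [wi wle] := cube_int; have mw := measurable_whitened.
split.
- apply: (rintegral_law mw _ wi).1; apply: measurable_funX; exact: measurable_norm1.
- move=> i.
  have wE x : whitened x i 0 = \sum_j - inv_sqrtmx A i j * xi x j 0.
    by rewrite !mxE -sumrN; apply: eq_bigr => k _; rewrite mulNr.
  have ri : rintegrable Q ((fun v : V => v i 0) \o whitened).
    have := rintegrable_sum (index_enum 'I_d) (fun j => rintegrableZl (- inv_sqrtmx A i j) (ci j)).
    by congr (rintegrable Q _); apply/funext => x; rewrite /= wE.
  transitivity (\int[Q]_x whitened x i 0).
    exact: (rintegral_law mw (measurable_coord i) ri).2.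
  under eq_Rintegral do rewrite wE.
  rewrite Rintegral_sum => [|j]; last exact: rintegrableZl.
  by apply: big1 => j _; rewrite rintZl// xi0 mulr0.
move=> i k.
have wE x : whitened x i 0 * whitened x k 0 =
    \sum_p \sum_q (inv_sqrtmx A i p * inv_sqrtmx A k q) * (xi x p 0 * xi x q 0).
  rewrite !mxE mulrNN mulr_suml; apply: eq_bigr => p _.
  by rewrite mulr_sumr; apply: eq_bigr => q _; ring.
have rq p q := rintegrableZl (inv_sqrtmx A i p * inv_sqrtmx A k q) (cii p q).
have rp p := rintegrable_sum (index_enum 'I_d) (rq p).
have mc2 : measurable_fun [set: V] (fun v : V => v i 0 * v k 0).
  by apply: measurable_funM; exact: measurable_coord.
have ri : rintegrable Q ((fun v : V => v i 0 * v k 0) \o whitened).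
  have := rintegrable_sum (index_enum 'I_d) rp.
  by congr (rintegrable Q _); apply/funext => x; rewrite /= wE.
transitivity (\int[Q]_x (whitened x i 0 * whitened x k 0)).
  exact: (rintegral_law mw mc2 ri).2.
under eq_Rintegral do rewrite wE.
rewrite Rintegral_sum//.
have := inv_sqrtmx_whitens symA l0 lA => /matrixP/(_ i k); rewrite [RHS]mxE => <-.
transitivity (\sum_p \sum_q inv_sqrtmx A i p * inv_sqrtmx A k q * A p q).
  apply: eq_bigr => p _; rewrite Rintegral_sum//; apply: eq_bigr => q _.
  by rewrite rintZl// AE.
rewrite exchange_big [RHS]mxE; apply: eq_bigr => q _.
rewrite [X in X * _]mxE [X in _ * X]mxE mulr_suml; apply: eq_bigr => p _.
by rewrite mulrAC.
Qed.

Lemma moment3_whitened : moment3 whitened_law <= beta.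
Proof.
have [wi wle] := cube_int.
apply: le_trans wle; rewrite le_eqVlt; apply/orP; left; apply/eqP.
have mn : measurable_fun [set: V] (fun v : V => norm1 v ^+ 3).
  by apply: measurable_funX; exact: measurable_norm1.
exact: (rintegral_law measurable_whitened mn wi).2.
Qed.

End whitened_score.

Section sandwich.
Context {dO dE} {Omega : measurableType dO} {E : measurableType dE} {R : realType}
  (P : probability Omega R) (Q : probability E R) {n d : nat}.
Local Notation V := 'cV[R]_d.
Variables (Y : 'I_n -> {RV P >-> E}) (phi : E -> V) (N : probability V R).
Hypotheses (iY : mutually_independent Y)
  (YQ : forall i A, measurable A -> P (Y i @^-1` A) = Q A)
  (n0 : (0 < n)%N) (mphi : measurable_fun [set: E] phi) (gN : std_gaussian N).
Let nu := law Q mphi.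
Let W w := \sum_(i < n) phi (Y i w).

Let mW : measurable_fun [set: Omega] W.
Proof.
apply/measurable_vecP => j; under eq_fun do rewrite summxE.
apply: measurable_sum => i.
have m : measurable_fun [set: E] (fun x => phi x j 0).
  by have /measurable_vecP := mphi; apply.
exact: (measurableT_comp m).
Qed.

Lemma walk_sumE A : openv A -> P (W @^-1` A) = (walk_sum nu n A)%:E.
Proof.
move=> oA; have mA := measurable_openv oA.
have muE i B : measurable B -> P ((fun w => phi (Y i w)) @^-1` B) = nu B.
  move=> mB; have mpB : measurable (phi @^-1` B) by rewrite -[X in measurable X]setTI; exact: mphi.
  exact: (YQ i mpB).
rewrite /walk_sum -(expectation_sum_independent iY mphi muE)//; last exact: bmeas_indic.
have mWA : measurable (W @^-1` A) by rewrite -[X in measurable X]setTI; exact: mW.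
have -> : \int[P]_w \1_A (0 + \sum_(i < n) phi (Y i w)) = \int[P]_w \1_(W @^-1` A) w.
  by apply: eq_Rintegral => w _; rewrite add0r; apply: eq_indic.
rewrite /Rintegral integral_indic// setIT fineK//.
by rewrite fin_num_measure.
Qed.

Variables (K e eta : R) (U : Omega -> V) (A : set V) (G : set Omega) (q : R).
Hypotheses (be : forall A, convexv A -> openv A -> walk_dist N nu n A <= K)
  (eta0 : 0 < eta) (cA : convexv A) (mG : measurable G) (PG : (P G <= e%:E)%E)
  (UW : forall w, ~ G w -> forall j, `|U w j 0 - W w j 0| < eta)
  (mU : measurable (U @^-1` A))
  (qin : forall B, openv B -> B `<=` A -> gauss_sum N n B <= q)
  (qout : forall B, openv B -> A `<=` B -> q <= gauss_sum N n B).

(** A need not be Borel, so its Gaussian probability enters only as a number q lying between those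
    of the open convex sets I and O. The passage from O to I costs 8 d eta / sqrt n and from I to J
    another 4 d eta / sqrt n. The set J absorbs the difference between U and W from inside, O from
    outside. *)
Lemma sandwich :
  `|fine (P (U @^-1` A)) - q| <= e + K + 12 * d%:R * eta / Num.sqrt n%:R.
Proof.
pose O := dilate eta A; pose I := erode (enum 'I_d) (2 * eta) O.
pose J := erode (enum 'I_d) eta I.
have eta2 : 0 < 2 * eta by rewrite mulr_gt0.
have cO : convexv O by exact: convexv_dilate.
have oO : openv O by exact: openv_dilate.
have cI : convexv I by exact: convexv_erode.
have oI : openv I by exact: openv_erode.
have cJ : convexv J by exact: convexv_erode.
have oJ : openv J by exact: openv_erode.
have IA : I `<=` A by exact: erode_dilate.
have AO : A `<=` O by exact: sub_dilate.
have OI := gauss_sum_erode gN (enum 'I_d) n0 eta2 cO oO.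
have IJ := gauss_sum_erode gN (enum 'I_d) n0 eta0 cI oI.
rewrite size_enum_ord -/I in OI; rewrite size_enum_ord -/J in IJ.
have qI := qin oI IA; have qO := qout oO AO.
have bO := be cO oO; have bJ := be cJ oJ.
rewrite /walk_dist ler_norml in bO; rewrite /walk_dist ler_norml in bJ.
have mpre B : openv B -> measurable (W @^-1` B).
  by move=> oB; rewrite -[X in measurable X]setTI; apply: mW => //; exact: measurable_openv.
have fP B : measurable B -> P B \is a fin_num by move=> mB; exact: fin_num_measure.
have PGe : fine (P G) <= e by rewrite -lee_fin fineK// fP.
have up : fine (P (U @^-1` A)) <= walk_sum nu n O + e.
  rewrite -lee_fin fineK ?fP// EFinD -walk_sumE//.
  apply: (@le_trans _ _ (P (W @^-1` O `|` G))).
    apply: le_measure; rewrite ?inE//; first by apply: measurableU => //; exact: mpre.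
    move=> w Aw; have [Gw|Gw] := pselect (G w); [by right|left].
    by exists (U w) => // j; rewrite distrC; exact: UW.
  apply: (le_trans (measureU2 _ _ _)) => //; [exact: mpre|exact: leeD].
have down : walk_sum nu n J <= fine (P (U @^-1` A)) + e.
  rewrite -lee_fin EFinD fineK ?fP// -walk_sumE//.
  apply: (@le_trans _ _ (P (U @^-1` A `|` G))).
    apply: le_measure; rewrite ?inE//; [exact: mpre|exact: measurableU|].
    move=> w Jw; have [Gw|Gw] := pselect (G w); [by right|left].
    apply: IA; rewrite (_ : U w = W w + (U w - W w)); last by rewrite addrC subrK.
    apply: (erode_cube (s := enum 'I_d) eta0 cI Jw) => j.
    + by rewrite !mxE ltW// UW.
    + by rewrite mem_enum.
  by apply: (le_trans (measureU2 _ _ _)) => //; exact: leeD.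
move: bO bJ => /andP[bO1 bO2] /andP[bJ1 bJ2].
have -> : 12 * d%:R * eta / Num.sqrt n%:R =
  d%:R * (4 * (2 * eta) / Num.sqrt n%:R) + d%:R * (4 * eta / Num.sqrt n%:R) by lra.
have p1 : 0 <= d%:R * (4 * eta / Num.sqrt n%:R).
  by rewrite mulr_ge0// divr_ge0 ?sqrtr_ge0// mulr_ge0// ltW.
by rewrite ler_norml; apply/andP; split; lra.
Qed.

End sandwich.

Section estimator.
Context {dO dE} {Omega : measurableType dO} {E : measurableType dE} {R : realType}
  (P : probability Omega R) (Q : probability E R) {n d : nat}.
Local Notation V := 'cV[R]_d.
Variable Y : 'I_n -> {RV P >-> E}.
Hypotheses (iY : mutually_independent Y)
  (YQ : forall i A, measurable A -> P (Y i @^-1` A) = Q A)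
  (n1 : (1 < n)%N) (d0 : (0 < d)%N).
Variables (Theta : set V) (h : V -> E -> V) (h0 : E -> R) (o : V) (a b c1 mu l : R)
  (M A : 'M[R]_d) (D : R) (N : probability V R) (K : R).
Hypotheses (a0 : 0 < a) (b0 : 0 < b) (c10 : 0 < c1) (mu0 : 0 < mu) (l0 : 0 < l)
  (To : Theta o)
  (mh : forall t j, Theta t -> measurable_fun [set: E] (fun x => h t x j 0))
  (h0_ge0 : forall x, 0 <= h0 x)
  (lip : forall x t t', Theta t -> Theta t' -> forall j,
    `|h t x j 0 - h t' x j 0| <= h0 x * enorm (t - t'))
  (sh0 : subexp Q (fun x => a^-1 * h0 x) 2)
  (sxi : subexp Q (fun x => b^-1 * enorm (h o x)) 2)
  (mo : mean_score Q h o = 0)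
  (mono : forall t, Theta t ->
    mu * enorm (t - o) ^+ 2 <= dotv (mean_score Q h t) (t - o))
  (diff : forall t, Theta t ->
    enorm (mean_score Q h t - M *m (t - o)) <= c1 * enorm (t - o) ^+ 2)
  (diam : forall t, Theta t -> enorm (t - o) <= D)
  (AE : forall i j, A i j = \int[Q]_x (h o x i 0 * h o x j 0))
  (lA : l <= lambda_min A)
  (gN : std_gaussian N)
  (K0 : 0 <= K)
  (be : forall nu, isotropic3 nu ->
    moment3 nu <= (d%:R * b / Num.sqrt l) ^+ 3 * 54 -> forall n A,
    convexv A -> openv A -> walk_dist N nu n A <= K / Num.sqrt n.+1%:R).

(** The linearisation error after whitening, in units of ln n; the added 1 makes the inequality
    strict, as the open dilation requires. *)
Definition local_const : R := d%:R * @linear_const R d a b c1 mu / Num.sqrt l + 1.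

(** The leading 2 makes smallness imply D <= n, and the term over mu implies the hypothesis of
    [linearisation]. The others pay for the exceptional event, the Berry-Esseen error and the shell,
    with factors 2 from 1 <= 2 ln n. *)
Definition distance_const : R := 2 +
  4 * (d%:R * a * (2 * ((2 * d).+1%:R + 4 * (2 * expR 2)))) / mu +
  2 * (6 * d%:R * (3 * d%:R) ^+ d) + 2 * K + 12 * d%:R * local_const.

Lemma linear_const_ge0 : 0 <= @linear_const R d a b c1 mu.
Proof.
have e2 : 0 <= expR 2 :> R by exact: expR_ge0.
have B0 : 0 <= 2 * ((2 * d).+1%:R + 4 * (2 * expR 2)) :> R by rewrite mulr_ge0// addr_ge0// !mulr_ge0.
rewrite /linear_const; set B := 2 * _ in B0 *.
have a0' := ltW a0; have b0' := ltW b0; have m0' := ltW mu0; have c0' := ltW c10.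
have C2 : 0 <= 2 * d%:R * (b * B + (4 + 2 * B) * a) / mu.
  have h1 : 0 <= b * B by exact: mulr_ge0.
  have h2 : 0 <= (4 + 2 * B) * a by apply: mulr_ge0 => //; lra.
  by apply: divr_ge0 => //; apply: mulr_ge0; [exact: mulr_ge0|exact: addr_ge0].
move: C2; set C2 := _ / mu => C20.
change (0 <= a * B * C2 + 2 * (4 + 2 * B) * a + c1 * C2 ^+ 2).
have h1 : 0 <= a * B * C2 by apply: mulr_ge0 => //; exact: mulr_ge0.
have h2 : 0 <= (4 + 2 * B) * a by apply: mulr_ge0 => //; lra.
have h3 : 0 <= c1 * C2 ^+ 2 by rewrite mulr_ge0// exprn_ge0.
lra.
Qed.

Lemma local_const_ge1 : 1 <= local_const.
Proof.
by rewrite lerDr divr_ge0 ?sqrtr_ge0// mulr_ge0// linear_const_ge0.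
Qed.

Lemma distance_const_ge2 : 2 <= distance_const.
Proof.
have e2 : 0 <= expR 2 :> R by exact: expR_ge0.
have h1 : 0 <= 4 * (d%:R * a * (2 * ((2 * d).+1%:R + 4 * (2 * expR 2)))) / mu.
  by rewrite divr_ge0 ?(ltW mu0)// !mulr_ge0 ?(ltW a0)// addr_ge0// !mulr_ge0.
have h2 : 0 <= 2 * (6 * d%:R * (3 * d%:R) ^+ d) :> R by rewrite !mulr_ge0// exprn_ge0// mulr_ge0.
have h3 : 0 <= 12 * d%:R * local_const.
  by rewrite mulr_ge0//; apply: le_trans local_const_ge1.
rewrite /distance_const; have := K0; lra.
Qed.

Variables (theta : Omega -> V) (G0 : set Omega).
Hypotheses (mG0 : measurable G0) (PG0 : P G0 = 0%E) (ht : forall w, Theta (theta w))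
  (score0 : forall w, ~ G0 w -> forall j, \sum_(i < n) h (theta w) (Y i w) j 0 = 0).

Let T w := Num.sqrt n%:R *: (inv_sqrtmx A *m M *m (theta w - o)).

Lemma estimator_convex (B : set V) (q : R) : convexv B -> measurable (T @^-1` B) ->
  (forall B', openv B' -> B' `<=` [set x | B ((Num.sqrt n%:R)^-1 *: x)] -> gauss_sum N n B' <= q) ->
  (forall B', openv B' -> [set x | B ((Num.sqrt n%:R)^-1 *: x)] `<=` B' -> q <= gauss_sum N n B') ->
  distance_const * (D + 1) ^+ 2 * (ln n%:R / Num.sqrt n%:R) < 1 ->
  `|fine (P (T @^-1` B)) - q| <= distance_const * (ln n%:R / Num.sqrt n%:R).
Proof.
move=> cB mTB qin qout small.
have nn : 0 < n%:R :> R by rewrite ltr0n ltnW.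
set r := Num.sqrt n%:R in qin qout small *.
have r0 : 0 < r by rewrite sqrtr_gt0.
have rr : r ^+ 2 = n%:R by rewrite sqr_sqrtr// ltW.
set L := ln n%:R in small *.
have L12 : 1 / 2 <= L by exact: half_le_ln.
have r1 : 1 <= r by rewrite -(@sqrtr1 R) ler_wsqrtr// ler1n ltnW.
have D0 : 0 <= D.
  by apply: le_trans (diam To); exact: enorm_ge0.
have C2 := distance_const_ge2.
have lc1 := local_const_ge1.
have small' : distance_const * (D + 1) ^+ 2 * L < r.
  by move: small; rewrite mulrA ltr_pdivrMr// mul1r.
have D1 : D <= (D + 1) ^+ 2 by nra.
have D2 : 1 <= (D + 1) ^+ 2 by nra.
(* Smallness forces (D + 1)^2 < sqrt n, so Theta fits in the range of the grid. *)
have hD : D <= n%:R.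
  have h1 : 2 * (D + 1) ^+ 2 <= distance_const * (D + 1) ^+ 2 by apply: ler_wpM2r => //; lra.
  have h2 : 2 * (D + 1) ^+ 2 * L <= distance_const * (D + 1) ^+ 2 * L.
    by apply: ler_wpM2r => //; lra.
  have h3 : (D + 1) ^+ 2 <= 2 * (D + 1) ^+ 2 * L by nra.
  rewrite -rr; nra.
have hL : distance_const * L < r.
  apply: le_lt_trans small'; rewrite -mulrA ler_wpM2l//; first by lra.
  by rewrite ler_peMl//; lra.
have sL : Num.sqrt (n%:R * L) <= 2 * L * r.
  rewrite -(@ler_pXn2r _ 2)// ?nnegrE ?sqrtr_ge0 ?mulr_ge0 ?(ltW r0)//; last by lra.
  rewrite sqr_sqrtr; last by rewrite mulr_ge0 ?ltW//; lra.
  rewrite exprMn rr; have : L * 1 <= L * (4 * L) by apply: ler_wpM2l; lra.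
  move=> h1; have := ler_wpM2l (ltW nn) h1; lra.
set B0 := 2 * ((2 * d).+1%:R + 4 * (2 * expR 2)) : R.
have small2 : 2 * (d%:R * a * B0 * Num.sqrt (n%:R * L)) <= n%:R * mu.
  set X := d%:R * a * B0.
  have X0 : 0 <= X.
    rewrite /X /B0 !mulr_ge0 ?(ltW a0)// addr_ge0// !mulr_ge0// expR_ge0//.
  have CX : 4 * X / mu <= distance_const.
    have h2 : 0 <= 2 * (6 * d%:R * (3 * d%:R) ^+ d) :> R by rewrite !mulr_ge0// exprn_ge0// mulr_ge0.
    have h3 : 0 <= 12 * d%:R * local_const by rewrite mulr_ge0//; lra.
    rewrite /distance_const -/B0 -/X; have := K0; lra.
  have h1 : 2 * (X * Num.sqrt (n%:R * L)) <= 4 * X * L * r.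
    have := ler_wpM2l X0 sL; lra.
  apply: (le_trans h1).
  have h2 : 4 * X * L <= r * mu.
    rewrite -ler_pdivrMr//; apply: le_trans (ltW hL).
    by rewrite mulrAC ler_wpM2r//; lra.
  have := ler_wpM2r (ltW r0) h2; rewrite -rr expr2; lra.
have sxij j : subexp Q (fun x => b^-1 * h o x j 0) 2.
  have m : measurable_fun [set: E] (fun x => b^-1 * h o x j 0).
    by apply: measurable_funM => //; exact: mh.
  have me : measurable_fun [set: E] (fun x => expR `|b^-1 * h o x j 0|).
    by apply: measurableT_comp => //; exact: measurableT_comp.
  have le x : `|expR `|b^-1 * h o x j 0| | <= 1 * expR `|b^-1 * enorm (h o x)|.
    rewrite mul1r ger0_norm ?expR_ge0// ler_expR !normrM.
    by rewrite ler_wpM2l// [leRHS]ger0_norm ?enorm_ge0// coord_enorm.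
  have [ei ele] := subexp_dominated sxi me le; have [_ _ e2] := sxi.
  split => //; apply: (le_trans (ler_norm _)); apply: (le_trans ele).
  by rewrite mul1r.
have diam' t : Theta t -> enorm (t - o) <= n%:R by move=> /diam; move/le_trans; apply.
have [G1 [mG1 PG1 G1P]] := linearisation iY YQ n1 d0 a0 b0 c10 mu0 To mh h0_ge0 lip
  sh0 sxij mo mono diff diam' small2.
have mxi : measurable_fun [set: E] (h o) by apply/measurable_vecP => j; exact: mh.
have xi0 j : \int[Q]_x h o x j 0 = 0.
  by have := mo => /matrixP/(_ j 0); rewrite !mxE.
have iso := isotropic_whitened b0 l0 mxi sxi xi0 AE lA.
have m3 := moment3_whitened b0 l0 mxi sxi AE lA.
have symA : A^T = A.
  apply/matrixP => i j; rewrite mxE !AE; apply: eq_Rintegral => x _.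
  by rewrite mulrC.
pose eta := local_const * L.
have eta0 : 0 < eta by rewrite mulr_gt0//; lra.
(* Multiplying by another sqrt n, and B accordingly, brings the estimator to the scale of the
   unnormalised walk. *)
pose U w := n%:R *: (inv_sqrtmx A *m M *m (theta w - o)).
pose B' := [set x | B (r^-1 *: x)].
have UB : U @^-1` B' = T @^-1` B.
  apply/seteqP; split => w /=; rewrite /B' /U /T /= -/r scalerA -rr expr2 mulKf ?gt_eqF//.
have cB' : convexv B'.
  have := @convexv_preimage_affine R d B r^-1 0 cB; congr convexv.
  by apply/seteqP; split => x /=; rewrite add0r.
have mG : measurable (G1 `|` G0) by exact: measurableU.
have PG : (P (G1 `|` G0) <= (6 * d%:R * (3 * d%:R) ^+ d / n%:R)%:E)%E.
  apply: (le_trans (measureU2 _ mG1 mG0)); rewrite [X in (_ + X)%E]PG0 adde0; exact: PG1.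
have UW w : ~ (G1 `|` G0) w -> forall j,
    `|U w j 0 - (\sum_(i < n) whitened (h o) A (Y i w)) j 0| < eta.
  move=> Gw j; have Gw1 : ~ G1 w by move=> ?; apply: Gw; left.
  have Gw0 : ~ G0 w by move=> ?; apply: Gw; right.
  have := G1P w Gw1 _ (ht w) (score0 Gw0); rewrite -/L => lin.
  pose v : V := n%:R *: (M *m (theta w - o)) + \sum_(i < n) h o (Y i w).
  have vj k : `|v k 0| <= @linear_const R d a b c1 mu * L.
    have -> : v k 0 = n%:R * (M *m (theta w - o)) k 0 + \sum_(i < n) h o (Y i w) k 0.
      by rewrite /v [LHS]mxE summxE [in LHS]mxE.
    exact: lin.
  have -> : U w j 0 - (\sum_(i < n) whitened (h o) A (Y i w)) j 0 = (inv_sqrtmx A *m v) j 0.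
    rewrite /v mulmxDr -scalemxAr mulmxA mulmx_sumr [RHS]mxE; congr (_ + _).
    rewrite !summxE -sumrN; apply: eq_bigr => i _.
    by rewrite /whitened [X in - X]mxE opprK.
  apply: (le_lt_trans (coord_enorm _ _)).
  apply: (le_lt_trans (enorm_inv_sqrtmx symA l0 lA v)).
  have h1 : enorm v <= d%:R * (@linear_const R d a b c1 mu * L).
    exact: le_trans (enorm_norm1 _) (norm1_le vj).
  have sl : 0 < Num.sqrt l by rewrite sqrtr_gt0.
  have h2 : enorm v / Num.sqrt l <= d%:R * (@linear_const R d a b c1 mu * L) / Num.sqrt l.
    by rewrite ler_pM2r ?invr_gt0.
  apply: (le_lt_trans h2); rewrite /eta /local_const; lra.
have be' B'' : convexv B'' -> openv B'' ->
    walk_dist N (law Q (measurable_whitened A mxi)) n B'' <= K / r.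
  move=> cB'' oB''; apply: (le_trans (be iso m3 n cB'' oB'')).
  apply: ler_wpM2l => //; rewrite lef_pV2 ?posrE ?sqrtr_gt0//.
  by rewrite ler_wsqrtr// ler_nat.
have mU : measurable (U @^-1` B') by rewrite UB.
have := sandwich iY YQ (ltnW n1) gN be' eta0 cB' mG PG UW mU qin qout.
rewrite UB => /le_trans; apply; rewrite -/r.
set Z := 6 * d%:R * (3 * d%:R) ^+ d.
have Z0 : 0 <= Z by rewrite /Z !mulr_ge0// exprn_ge0// mulr_ge0.
have h1 : Z / n%:R <= 2 * Z * (L / r).
  rewrite -rr expr2 invfM mulrA [leRHS]mulrA ler_wpM2r ?invr_ge0 ?(ltW r0)//.
  rewrite ler_pdivrMr//; have h5 := ler_wpM2l Z0 L12.
  have ZL : 0 <= Z * L by lra.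
  have h6 := ler_wpM2l ZL r1; lra.
have h2 : K / r <= 2 * K * (L / r).
  by rewrite [leRHS]mulrA ler_wpM2r ?invr_ge0 ?(ltW r0)//; have := ler_wpM2l K0 L12; lra.
have h3 : 12 * d%:R * eta / r = 12 * d%:R * local_const * (L / r) by rewrite /eta; ring.
have h4 : 0 <= (2 + 4 * (d%:R * a * B0) / mu) * (L / r).
  rewrite mulr_ge0 ?divr_ge0 ?(ltW r0)//; last by lra.
  rewrite addr_ge0// divr_ge0 ?(ltW mu0)//.
  by rewrite /B0 !mulr_ge0 ?(ltW a0)// addr_ge0// !mulr_ge0// expR_ge0.
rewrite h3 /distance_const -/B0 -/Z; lra.
Qed.

End estimator.

(** * Conclusion *)

Lemma independent_sample {dO dE} {Omega : measurableType dO} {E : measurableType dE}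
    {R : realType} (P : probability Omega R) n (X : {RV P >-> E}) (Xs : 'I_n -> {RV P >-> E}) :
  iid (fun o : option 'I_n => if o is Some i then Xs i else X) ->
  mutually_independent Xs /\
  forall i A, measurable A -> P (Xs i @^-1` A) = distribution P X A.
Proof.
move=> [iX eX]; split=> [B mB|i A mA]; last exact: (eX (Some i) None A mA).
pose B' (k : option 'I_n) := if k is Some i then B i else setT.
have := iX B'; rewrite (bigD1 None)//= preimage_setT probability_setT mul1e => iX'.
pose F (k : option 'I_n) : {RV P >-> E} := if k is Some i then Xs i else X.
transitivity (P (\bigcap_(k in [set: option 'I_n]) (F k @^-1` B' k))).
  congr (P _); apply/seteqP; split => w /= h i _; last exact: (h (Some i)).
  by case: i => [i|//]; exact: h.
rewrite iX'; last by case=> [i|]; [exact: mB|exact: measurableT].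
rewrite (reindex_omap Some id)/=; last by case.
by apply: eq_bigl => i; rewrite eqxx.
Qed.

(** The infimum defining the norm is not known to be attained; doubling c leaves room for an
    admissible C below 2 c. This is the origin of a = 2 c4 and b = 2 c5. *)
Lemma psi1_norm_expR {dO} {Omega : measurableType dO} {R : realType}
    (P : probability Omega R) (Y : Omega -> R) (c : R) :
  measurable_fun [set: Omega] Y -> 0 < c -> (psi1_norm P Y <= c%:E)%E ->
  (\int[P]_w (expR `|(2 * c)^-1 * Y w|)%:E <= 2%:E)%E.
Proof.
move=> mY c0 Yc; have : (psi1_norm P Y < (2 * c)%:E)%E.
  by apply: (le_lt_trans Yc); rewrite lte_fin; lra.
move=> /ereal_inf_lt[_ [C [C0 EC] <-]]; rewrite lte_fin => C2.
move: EC; rewrite unlock => EC.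
have mp : measurable_fun [set: Omega] (fun w => (psi1 (`|Y w| / C))%:E).
  apply/measurable_EFinP; apply: measurable_funB => //.
  apply: measurableT_comp => //; apply: measurable_funM => //.
  exact: measurableT_comp.
have p0 w : (0 <= (psi1 (`|Y w| / C))%:E)%E.
  by rewrite lee_fin subr_ge0 -expR0 ler_expR divr_ge0// ltW.
apply: (@le_trans _ _ (\int[P]_w ((cst 1%E w) + (psi1 (`|Y w| / C))%:E))%E).
  apply: ge0_le_integral => //.
  - apply/measurable_EFinP; apply: measurableT_comp => //; apply: measurableT_comp => //.
    exact: measurable_funM.
  - by apply: emeasurable_funD.
  - move=> w _; rewrite -EFinD lee_fin /psi1 addrC subrK ler_expR normrM normfV.
    rewrite mulrC ler_wpM2l// lef_pV2 ?posrE ?normr_gt0 ?gt_eqF//; last by lra.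
    by rewrite ger0_norm ltW//; lra.
rewrite ge0_integralD//= integral_cst//= probability_setT mule1.
by rewrite (_ : 2 = 1 + 1) ?EFinD ?leeD//; lra.
Qed.

Section transfer.
Context {dO dE} {Omega : measurableType dO} {E : measurableType dE} {R : realType}
  (P : probability Omega R) (Q : probability E R) (Y : {RV P >-> E}) (N : set E).
Hypotheses (YQ : forall A, measurable A -> P (Y @^-1` A) = Q A)
  (mN : measurable N) (QN : Q N = 0%E).

Lemma ge0_integral_transfer (f : E -> R) : measurable_fun [set: E] f ->
  (forall x, 0 <= f x) -> (\int[P]_w (f (Y w))%:E = \int[Q]_x (f x)%:E)%E.
Proof.
move=> mf f0; exact: (@integral_sample _ _ _ _ _ P Q 1 (fun=> Y) (fun=> YQ) ord0 f mf f0).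
Qed.

Lemma ae_transfer : {ae P, forall w, ~ N (Y w)}.
Proof.
exists (Y @^-1` N); split; first by rewrite -[X in measurable X]setTI; exact: measurable_funP.
  by rewrite YQ.
by move=> w /= /contrapT.
Qed.

(** Combines the passage from Omega to the law Q with a change of the integrand on a null set. *)
Lemma integral_transfer (f f' : E -> R) : measurable_fun [set: E] f ->
  (forall x, ~ N x -> f x = f' x) -> rintegrable Q f' ->
  fine (\int[P]_w (f (Y w))%:E)%E = \int[Q]_x f' x.
Proof.
move=> mf ff' if'; have mf' := rintegrable_measurable if'.
have mY : measurable_fun [set: Omega] Y by [].
have iP : rintegrable P (f' \o Y).
  apply/integrableP; split; first by apply/measurable_EFinP; exact: measurableT_comp.
  have := ge0_integral_transfer (measurableT_comp (@normr_measurable R setT) mf')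
    (fun x => normr_ge0 (f' x)).
  move=> /= e; have /integrableP[_] := if'; congr (_ < _)%E.
  exact: esym e.
have [_ e] := rintegral_law mY mf' iP.
transitivity (\int[law P mY]_x f' x).
  rewrite e /Rintegral; congr fine; apply: ae_eq_integral => //.
  - by apply/measurable_EFinP; exact: measurableT_comp.
  - by apply/measurable_EFinP; exact: measurableT_comp.
  - by apply: filterS ae_transfer => w Nw _; rewrite ff'.
rewrite /Rintegral; congr fine.
by apply: eq_measure_integral => A mA _; exact: YQ.
Qed.

End transfer.

Section gaussian_vector.
Context {dZ} {OmegaZ : measurableType dZ} {R : realType} (PZ : probability OmegaZ R) {d : nat}.
Variable Z : 'I_d -> {RV PZ >-> R}.

Lemma measurable_rvec : measurable_fun [set: OmegaZ] (rvec Z).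
Proof.
apply/measurable_vecP => j; rewrite (_ : (fun _ => _) = Z j); first exact: measurable_funP.
by apply/funext => w; rewrite /rvec mxE.
Qed.

Lemma std_gaussian_rvec : std_normal_vec Z -> std_gaussian (law PZ measurable_rvec).
Proof.
move=> [iZ nZ] B mB.
have e : rvec Z @^-1` box B = \bigcap_(i in [set: 'I_d]) (Z i @^-1` B i).
  apply/seteqP; split => w /=; rewrite /box /rvec /=.
    by move=> h i _; have := h i; rewrite mxE.
  by move=> h i; rewrite mxE; exact: h.
transitivity (PZ (rvec Z @^-1` box B)); first by [].
rewrite e iZ//; apply: eq_bigr => i _; rewrite normal01E; exact: nZ.
Qed.

End gaussian_vector.

Lemma dimension_bound {dE} {E : measurableType dE} {R : realType} (Q : probability E R)
    {d : nat} (xi : E -> 'cV[R]_d) (b l : R) (A : 'M[R]_d) : 0 < b -> 0 < l ->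
  measurable_fun [set: E] xi -> subexp Q (fun x => b^-1 * enorm (xi x)) 2 ->
  (forall i j, A i j = \int[Q]_x (xi x i 0 * xi x j 0)) -> l <= lambda_min A ->
  l * d%:R <= 8 * b ^+ 2.
Proof.
move=> b0 l0 mxi sxi AE lA.
have symA : A^T = A.
  apply/matrixP => i j; rewrite mxE !AE; apply: eq_Rintegral => x _.
  by rewrite mulrC.
have lAii i : l <= A i i.
  have := quadratic_form_ge (delta_mx i 0) symA l0 lA.
  rewrite !dotv_delta mxE !eqxx mulr1 => /le_trans; apply.
  by rewrite -colE mxE.
have en x : `|b^-1 * enorm (xi x)| = b^-1 * enorm (xi x).
  by rewrite ger0_norm// mulr_ge0 ?enorm_ge0// invr_ge0 ltW.
have mc j : measurable_fun [set: E] (fun x => xi x j 0).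
  by have /measurable_vecP := mxi; apply.
have bnd x : enorm (xi x) ^+ 2 <= 4 * b ^+ 2 * expR `|b^-1 * enorm (xi x)|.
  have -> : enorm (xi x) ^+ 2 = b ^+ 2 * (b^-1 * enorm (xi x)) ^+ 2.
    by rewrite -exprMn mulVKf ?gt_eqF.
  have := @sqr_le_expR R _ (normr_ge0 (b^-1 * enorm (xi x))); rewrite {1}en => h.
  have := ler_wpM2l (sqr_ge0 b) h; lra.
have ii i : rintegrable Q (fun x => xi x i 0 * xi x i 0).
  have m : measurable_fun [set: E] (fun x => xi x i 0 * xi x i 0) by exact: measurable_funM.
  apply: (subexp_dominated sxi m _).1 => x; apply: le_trans (bnd x).
  by rewrite normrM expr2 ler_pM// coord_enorm.
apply: (@le_trans _ _ (\sum_i A i i)).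
  by rewrite mulr_natr -[d in leLHS]card_ord -sumr_const; apply: ler_sum.
under eq_bigr do rewrite AE; rewrite -Rintegral_sum//.
have m : measurable_fun [set: E] (fun x => \sum_(i < d) xi x i 0 * xi x i 0).
  by apply: measurable_sum => i; exact: measurable_funM.
have le x : `|\sum_(i < d) xi x i 0 * xi x i 0| <= 4 * b ^+ 2 * expR `|b^-1 * enorm (xi x)|.
  by apply: le_trans (bnd x); rewrite sqr_enorm ger0_norm// dotv_ge0.
have [_ h] := subexp_dominated sxi m le; have [_ _ e2] := sxi.
apply: (le_trans (ler_norm _)); apply: (le_trans h).
have -> : 8 * b ^+ 2 = 4 * b ^+ 2 * 2 by ring.
by apply: ler_wpM2l => //; rewrite mulr_ge0// exprn_ge0// ltW.
Qed.

Section assumptions.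
Context {R : realType} (c1 c4 c5 lambda1 lambda2 mu : R)
  (hc1 : 0 < c1) (hc4 : 0 < c4) (hc5 : 0 < c5) (hlambda2 : 0 < lambda2) (hmu : 0 < mu)
  {d n : nat} (hd : (0 < d)%N) (hn : (1 < n)%N)
  {dO dE : measure_display} {Omega : measurableType dO} {E : measurableType dE}
  (P : probability Omega R) (X : {RV P >-> E}) (Xs : 'I_n -> {RV P >-> E})
  (hX : iid (fun o : option 'I_n => if o is Some i then Xs i else X))
  (Theta : set 'cV[R]_d) (h : 'cV[R]_d -> E -> 'cV[R]_d)
  (hh : forall theta, Theta theta -> measurable_vec (h theta))
  (hat_theta : Omega -> 'cV[R]_d) (theta_star : 'cV[R]_d)
  (hhat_in : forall w, Theta (hat_theta w))
  (hhat : {ae P, forall w, Psi_n h Xs w (hat_theta w) = 0})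
  (hstar_in : Theta theta_star)
  (hstar : Psi h X theta_star = 0)
  (dPsi0 : 'M[R]_d)
  (hB1_mono : forall t1 t2, Theta t1 -> Theta t2 ->
     mu * enorm (t1 - t2) ^+ 2 <= dotv (Psi h X t1 - Psi h X t2) (t1 - t2))
  (hB1_diff : forall t, Theta t ->
     enorm (Psi h X t - Psi h X theta_star - dPsi0 *m (t - theta_star))
     <= c1 * enorm (t - theta_star) ^+ 2)
  (h0 : E -> R) (h0_meas : measurable_fun [set: E] h0)
  (h0_ge0 : forall x, 0 <= h0 x)
  (hB4_psi1 : (psi1_norm P (fun w => h0 (X w)) <= c4%:E)%E)
  (xi : 'I_n -> Omega -> 'cV[R]_d)
  (hxi : forall i w, xi i w = h theta_star (Xs i w))
  (Sigma : 'M[R]_d)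
  (hSigma : forall i, Sigma = expectation_mx P (fun w => xi i w *m (xi i w)^T))
  (hB5_eig : lambda2 <= lambda_min Sigma)
  (hB5_psi1 : forall i, (psi1_norm_vec P (xi i) <= c5%:E)%E).

Let Q : probability E R := distribution P X.

Variable N : set E.
Hypotheses (mN : measurable N) (QN : Q N = 0%E)
  (lipN : forall x, ~ N x -> forall t t', Theta t -> Theta t' -> forall j : 'I_d,
     `|h t x j 0 - h t' x j 0| <= h0 x * enorm (t - t')).

(* Replacing h by 0 on the null set makes the Lipschitz bound hold everywhere
   without affecting any law or expectation. *)
Definition null_off (t : 'cV[R]_d) (x : E) : 'cV[R]_d := \1_(~` N) x *: h t x.

Lemma null_offE t x j : ~ N x -> h t x j 0 = null_off t x j 0.
Proof. by move=> Nx; rewrite /null_off mxE indicE mem_set// mul1r. Qed.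

Lemma null_off0 t x : N x -> null_off t x = 0.
Proof. by move=> Nx; rewrite /null_off indicE memNset ?scale0r//; exact. Qed.

Let o := theta_star.
Let a := 2 * c4.
Let b := 2 * c5.
Let a0 : 0 < a. Proof. exact: mulr_gt0. Qed.
Let b0 : 0 < b. Proof. exact: mulr_gt0. Qed.
Let i0 : 'I_n := Ordinal (ltnW hn).

Let XQ A : measurable A -> P (X @^-1` A) = Q A. Proof. by []. Qed.
Let iXs := (independent_sample hX).1.
Let XsQ i A : measurable A -> P (Xs i @^-1` A) = Q A := (independent_sample hX).2 i A.

Lemma measurable_null_off t j : Theta t -> measurable_fun [set: E] (fun x => null_off t x j 0).
Proof.
move=> Tt; rewrite (_ : (fun _ => _) = (fun x => \1_(~` N) x * h t x j 0)).
  apply: measurable_funM; last exact: hh.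
  by apply: measurable_indic; exact: measurableC.
by apply/funext => x; rewrite mxE.
Qed.

Let mo : measurable_fun [set: E] (null_off o).
Proof. by apply/measurable_vecP => j; exact: measurable_null_off. Qed.

Let ho_meas : measurable_fun [set: E] (h o).
Proof. by apply/measurable_vecP => j; exact: hh. Qed.

Let enorm_meas (f : E -> 'cV[R]_d) : measurable_fun [set: E] f ->
  measurable_fun [set: E] (fun x => enorm (f x)).
Proof.
move=> /measurable_vecP mf.
have m : measurable_fun [set: E] (fun x => dotv (f x) (f x)).
  by apply: measurable_sum => i; apply: measurable_funM; exact: mf.
exact: measurableT_comp (continuous_measurable_fun (@sqrt_continuous R)) m.
Qed.

Lemma subexp_transfer (Y : {RV P >-> E}) (f : E -> R) c :
  (forall A, measurable A -> P (Y @^-1` A) = Q A) -> measurable_fun [set: E] f ->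
  0 < c -> (psi1_norm P (fun w => f (Y w)) <= c%:E)%E ->
  subexp Q (fun x => (2 * c)^-1 * f x) 2.
Proof.
move=> YQ mf c0 fc.
have mfY : measurable_fun [set: Omega] (fun w => f (Y w)) by exact: measurableT_comp.
have := psi1_norm_expR mfY c0 fc.
have me : measurable_fun [set: E] (fun x => expR `|(2 * c)^-1 * f x|).
  by apply: measurableT_comp => //; apply: measurableT_comp => //; exact: measurable_funM.
rewrite (ge0_integral_transfer YQ me (fun x => expR_ge0 _)) => le2.
have ri : rintegrable Q (fun x => expR `|(2 * c)^-1 * f x|).
  apply/integrableP; split; first exact/measurable_EFinP.
  apply: (@le_lt_trans _ _ 2%:E); last exact: ltry.
  rewrite (eq_integral (fun x => (expR `|(2 * c)^-1 * f x|)%:E))// => x _.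
  by rewrite /= ger0_norm// expR_ge0.
split => //; first exact: measurable_funM.
by rewrite -lee_fin /Rintegral fineK//; exact: (integrable_fin_num measurableT ri).
Qed.

Let sh0 : subexp Q (fun x => a^-1 * h0 x) 2.
Proof. exact: (subexp_transfer XQ h0_meas hc4 hB4_psi1). Qed.

Let sxi : subexp Q (fun x => b^-1 * enorm (null_off o x)) 2.
Proof.
have s1 : subexp Q (fun x => b^-1 * enorm (h o x)) 2.
  apply: (subexp_transfer (XsQ i0) (enorm_meas ho_meas) hc5).
  have e : xi i0 = (fun w => h o (Xs i0 w)) by apply/funext => w; rewrite hxi.
  by have := hB5_psi1 i0; rewrite e.
have m : measurable_fun [set: E] (fun x => b^-1 * enorm (null_off o x)).
  by apply: measurable_funM => //; exact: enorm_meas.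
have me : measurable_fun [set: E] (fun x => expR `|b^-1 * enorm (null_off o x)|).
  by apply: measurableT_comp => //; exact: measurableT_comp.
have le x : `|expR `|b^-1 * enorm (null_off o x)| | <= 1 * expR `|b^-1 * enorm (h o x)|.
  rewrite mul1r ger0_norm ?expR_ge0// ler_expR !normrM; apply: ler_wpM2l => //.
  have [Nx|Nx] := pselect (N x).
    rewrite null_off0// /enorm /dotv big1 ?sqrtr0 ?normr0//.
    by move=> i _; rewrite mxE mulr0.
  by rewrite /null_off indicE mem_set// scale1r.
have [ei ele] := subexp_dominated s1 me le; have [_ _ e2] := s1.
split; [exact: m|exact: ei|].
apply: (le_trans (ler_norm _)); apply: (le_trans ele).
by rewrite mul1r.
Qed.

Let lip x t t' : Theta t -> Theta t' -> forall j,
  `|null_off t x j 0 - null_off t' x j 0| <= h0 x * enorm (t - t').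
Proof.
move=> Tt Tt' j; have [Nx|Nx] := pselect (N x); last by rewrite -!null_offE//; exact: lipN.
by rewrite !null_off0// subrr normr0 mulr_ge0// enorm_ge0.
Qed.

Let off_int t j : Theta t -> rintegrable Q (fun x => null_off t x j 0).
Proof.
move=> Tt.
have oi : rintegrable Q (fun x => null_off o x j 0).
  apply: (subexp_dominated (c := b) sxi (measurable_null_off j hstar_in) _).1 => x.
  apply: (le_trans (coord_enorm _ _)); rewrite -ler_pdivrMl//.
  by apply: (le_trans (ler_norm _)); exact: le_expR.
have m : measurable_fun [set: E] (fun x => null_off t x j 0 - null_off o x j 0).
  by apply: measurable_funB; exact: measurable_null_off.
have di : rintegrable Q (fun x => null_off t x j 0 - null_off o x j 0).
  apply: (subexp_dominated (c := a * enorm (t - o)) sh0 m _).1 => x.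
  apply: (le_trans (lip x Tt hstar_in j)); rewrite mulrAC; apply: ler_wpM2r; first exact: enorm_ge0.
  rewrite -ler_pdivrMl//; apply: (le_trans (ler_norm _)); exact: le_expR.
have := rintegrableD di oi; congr (rintegrable Q _); apply/funext => x.
by rewrite subrK.
Qed.

Lemma mean_score_null_off t : Theta t -> mean_score Q null_off t = Psi h X t.
Proof.
move=> Tt; apply/matrixP => j k; rewrite ord1 [LHS]mxE [RHS]mxE expectation.unlock.
apply: esym; apply: (integral_transfer (f := fun x => h t x j 0) XQ mN QN).
- exact: hh.
- by move=> x Nx; exact: null_offE.
exact: off_int.
Qed.

Lemma Sigma_null_off j k :
  Sigma j k = \int[Q]_x (null_off o x j 0 * null_off o x k 0).
Proof.
rewrite (hSigma i0) mxE expectation.unlock.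
under eq_integral => w _ do rewrite mxE big_ord1 hxi [X in _ * X]mxE.
have mj i : measurable_fun [set: E] (fun x => h o x i 0) by exact: hh.
apply: (integral_transfer (f := fun x => h o x j 0 * h o x k 0) (XsQ i0) mN QN).
- exact: measurable_funM.
- by move=> x Nx; rewrite !null_offE.
have m : measurable_fun [set: E] (fun x => null_off o x j 0 * null_off o x k 0).
  by apply: measurable_funM; exact: measurable_null_off.
apply: (subexp_dominated (c := b ^+ 2 * 4) sxi m _).1 => x.
rewrite normrM; apply: (@le_trans _ _ (enorm (null_off o x) ^+ 2)).
  by rewrite expr2 ler_pM// coord_enorm.
rewrite -[X in X ^+ 2 <= _](@mulVKf _ b) ?gt_eqF// exprMn -mulrA ler_pM2l ?exprn_gt0//.
rewrite -[X in X ^+ 2 <= _]ger0_norm; first exact: sqr_le_expR.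
by rewrite mulr_ge0 ?enorm_ge0// invr_ge0 ltW.
Qed.

Lemma dimension_le : lambda2 * d%:R <= 8 * (2 * c5) ^+ 2.
Proof. exact: (dimension_bound b0 hlambda2 mo sxi Sigma_null_off hB5_eig). Qed.

Lemma estimating_equation : exists G0, [/\ measurable G0, P G0 = 0%E &
  forall w, ~ G0 w -> forall j, \sum_(i < n) null_off (hat_theta w) (Xs i w) j 0 = 0].
Proof.
have aeN : {ae P, forall w, forall i, ~ N (Xs i w)}.
  by apply: filter_forall => i; exact: (ae_transfer (XsQ i)).
have [G0 [mG0 PG0 sG0]] : {ae P, forall w, forall j,
    \sum_(i < n) null_off (hat_theta w) (Xs i w) j 0 = 0}.
  apply: filterS2 hhat aeN => w /matrixP hw Nw j.
  have := hw j 0; rewrite [LHS]mxE [RHS]mxE summxE => /eqP.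
  rewrite mulf_eq0 invr_eq0 pnatr_eq0 gtn_eqF ?(ltnW hn)//= => /eqP e; rewrite -[RHS]e.
  by apply: eq_bigr => i _; rewrite -null_offE.
exists G0; split => // w Gw; apply: contrapT => Hw; exact/Gw/sG0.
Qed.

Variables (dZ : measure_display) (OmegaZ : measurableType dZ)
  (PZ : probability OmegaZ R) (Z : 'I_d -> {RV PZ >-> R}) (hZ : std_normal_vec Z)
  (K : R) (K0 : 0 <= K)
  (be : forall N mu : probability 'cV[R]_d R, std_gaussian N -> isotropic3 mu ->
    moment3 mu <= (d%:R * (2 * c5) / Num.sqrt lambda2) ^+ 3 * 54 -> forall n A,
    convexv A -> openv A -> walk_dist N mu n A <= K / Num.sqrt n.+1%:R).

Local Notation C := (@distance_const R d (2 * c4) (2 * c5) c1 mu lambda2 K).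

Lemma convex_distance_bound :
  (convex_distance P PZ
     (fun w => Num.sqrt n%:R *:
        (inv_sqrtmx Sigma *m dPsi0 *m (hat_theta w - theta_star)))
     (rvec Z)
   <= C%:E * (ediam Theta + 1) ^+ 2 * ((Num.sqrt n%:R)^-1 * ln n%:R)%:E)%E.
Proof.
set T := fun w => _.
have nn : 0 < n%:R :> R by rewrite ltr0n ltnW.
have r0 : 0 < Num.sqrt n%:R :> R by rewrite sqrtr_gt0.
have L0 : 0 < ln n%:R :> R by rewrite ln_gt0// ltr1n.
have X0 : 0 < (Num.sqrt n%:R)^-1 * ln n%:R :> R by rewrite mulr_gt0// invr_gt0.
have C2 : 2 <= C by apply: distance_const_ge2 => //; exact: mulr_gt0.
have C0 : 0 < C by lra.
have dge : (0 <= ediam Theta)%E.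
  apply: ereal_sup_ubound; exists o => //; exists o => //.
  by rewrite subrr /enorm /dotv big1 ?sqrtr0// => i _; rewrite mxE mulr0.
(* An infinite diameter makes the bound infinite, because the constant and ln n are positive. *)
move: dge; case De : (ediam Theta) => [D| |]// D0; last first.
  by rewrite addye// expe2 mulyy gt0_muley ?lte_fin// gt0_mulye ?lte_fin// leey.
rewrite -EFinD -EFin_expe -!EFinM.
have diam t : Theta t -> enorm (t - o) <= D.
  by move=> Tt; rewrite -lee_fin -De; apply: ereal_sup_ubound; exists t => //; exists o.
apply: ge_ereal_sup => _ [B [cB mTB mZB] <-].
have fin1 : P (T @^-1` B) \is a fin_num by exact: fin_num_measure.
have fin2 : PZ (rvec Z @^-1` B) \is a fin_num by exact: fin_num_measure.
rewrite -(fineK fin1) -(fineK fin2) -EFinB lee_fin.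
have p1 : 0 <= fine (P (T @^-1` B)) <= 1.
  by rewrite fine_ge0//= -lee_fin fineK// probability_le1.
have p2 : 0 <= fine (PZ (rvec Z @^-1` B)) <= 1.
  by rewrite fine_ge0//= -lee_fin fineK// probability_le1.
have p12 : `|fine (P (T @^-1` B)) - fine (PZ (rvec Z @^-1` B))| <= 1.
  by move: p1 p2 => /andP[? ?] /andP[? ?]; rewrite ler_norml; apply/andP; split; lra.
(* Two probabilities differ by at most 1, so a bound of at least 1 is trivial; otherwise the
   smallness needed for localisation is available. *)
have [big|small] := leP 1 (C * (D + 1) ^+ 2 * ((Num.sqrt n%:R)^-1 * ln n%:R)).
  exact: le_trans big.
have [G0 [mG0 PG0 score0]] := estimating_equation.
have gN := std_gaussian_rvec hZ.
have mono' t : Theta t ->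
    mu * enorm (t - o) ^+ 2 <= dotv (mean_score Q null_off t) (t - o).
  move=> Tt; rewrite mean_score_null_off//.
  by have := hB1_mono Tt hstar_in; rewrite hstar subr0.
have diff' t : Theta t ->
    enorm (mean_score Q null_off t - dPsi0 *m (t - o)) <= c1 * enorm (t - o) ^+ 2.
  move=> Tt; rewrite mean_score_null_off//.
  by have := hB1_diff Tt; rewrite hstar subr0.
have mso : mean_score Q null_off o = 0 by rewrite mean_score_null_off.
have gE B' : openv B' -> gauss_sum (law PZ (measurable_rvec Z)) n B' =
    fine (PZ (rvec Z @^-1` [set z | B' (Num.sqrt n%:R *: z)])).
  move=> oB'; rewrite gauss_sumE//; last exact: measurable_openv.
  have oB'' : openv [set z : 'cV[R]_d | B' (Num.sqrt n%:R *: z)].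
    have := @openv_preimage_affine R d B' (Num.sqrt n%:R) 0 oB'; congr openv.
    by apply/seteqP; split => x /=; rewrite add0r.
  have -> : (fun z : 'cV[R]_d => \1_B' (Num.sqrt n%:R *: z) : R) =
    \1_[set z : 'cV[R]_d | B' (Num.sqrt n%:R *: z)].
    by apply/funext => z; exact: eq_indic.
  by rewrite /Rintegral integral_indic ?setIT//; exact: measurable_openv.
have mS B' : openv B' -> measurable (rvec Z @^-1` [set z | B' (Num.sqrt n%:R *: z)]).
  move=> oB'; rewrite -[X in measurable X]setTI; apply: (measurable_rvec Z) => //.
  apply: measurable_openv.
  have := @openv_preimage_affine R d B' (Num.sqrt n%:R) 0 oB'; congr openv.
  by apply/seteqP; split => x /=; rewrite add0r.
have qin B' : openv B' -> B' `<=` [set x | B ((Num.sqrt n%:R)^-1 *: x)] ->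
    gauss_sum (law PZ (measurable_rvec Z)) n B' <= fine (PZ (rvec Z @^-1` B)).
  move=> oB' sB'; rewrite gE// fine_le//; first exact: fin_num_measure (mS _ oB').
  apply: le_measure; rewrite ?inE//; first exact: mS.
  by move=> w /= /sB' /=; rewrite scalerA mulVf ?scale1r// gt_eqF.
have qout B' : openv B' -> [set x | B ((Num.sqrt n%:R)^-1 *: x)] `<=` B' ->
    fine (PZ (rvec Z @^-1` B)) <= gauss_sum (law PZ (measurable_rvec Z)) n B'.
  move=> oB' sB'; rewrite gE// fine_le//; first exact: fin_num_measure (mS _ oB').
  apply: le_measure; rewrite ?inE//; first exact: mS.
  by move=> w /= Bw; apply: sB' => /=; rewrite scalerA mulVf ?scale1r// gt_eqF.
rewrite [_^-1 * _]mulrC in small *.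
have := estimator_convex iXs XsQ hn hd a0 b0 hc1 hmu hlambda2 hstar_in
  measurable_null_off h0_ge0 lip sh0 sxi mso mono' diff' diam Sigma_null_off hB5_eig
  gN K0 (fun nu => be gN) mG0 PG0 hhat_in score0 (convex_set_convexv cB) mTB qin qout small.
move/le_trans; apply; apply: ler_wpM2r; first by rewrite divr_ge0// ltW.
by rewrite ler_peMr// ?(ltW C0)// exprn_ege1//; rewrite lerDr -lee_fin.
Qed.

End assumptions.

Theorem theorem3p3 (R : realType) (c1 c4 c5 lambda1 lambda2 mu : R)
  (hc1 : 0 < c1) (hc4 : 0 < c4) (hc5 : 0 < c5)
  (hlambda1 : 0 < lambda1) (hlambda2 : 0 < lambda2) (hmu : 0 < mu) :
  exists2 C : R, 0 < C &
  forall (d n : nat) (hd : (0 < d)%N) (hn : (1 < n)%N)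
    (dO dE : measure_display)
    (Omega : measurableType dO) (E : measurableType dE)
    (P : probability Omega R)
    (* the sample *)
    (X : {RV P >-> E}) (Xs : 'I_n -> {RV P >-> E})
    (hX : iid (fun o : option 'I_n => if o is Some i then Xs i else X))
    (* the model *)
    (Theta : set 'cV[R]_d) (h : 'cV[R]_d -> E -> 'cV[R]_d)
    (hh : forall theta, Theta theta -> measurable_vec (h theta))
    (* the estimator and the parameter *)
    (hat_theta : Omega -> 'cV[R]_d) (theta_star : 'cV[R]_d)
    (hhat_meas : measurable_vec hat_theta)
    (hhat_in : forall w, Theta (hat_theta w))
    (hhat : {ae P, forall w, Psi_n h Xs w (hat_theta w) = 0})
    (hstar_in : Theta theta_star)
    (hstar : Psi h X theta_star = 0)
    (* (B1) *)
    (dPsi0 : 'M[R]_d) (hdPsi0 : posdef dPsi0)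
    (hB1_mono : forall t1 t2, Theta t1 -> Theta t2 ->
       mu * enorm (t1 - t2) ^+ 2 <= dotv (Psi h X t1 - Psi h X t2) (t1 - t2))
    (hB1_diff : forall t, Theta t ->
       enorm (Psi h X t - Psi h X theta_star - dPsi0 *m (t - theta_star))
       <= c1 * enorm (t - theta_star) ^+ 2)
    (hB1_eig : lambda1 <= lambda_min dPsi0)
    (* (B4) *)
    (h0 : E -> R) (h0_meas : measurable_fun [set: E] h0)
    (h0_ge0 : forall x, 0 <= h0 x)
    (hB4_lip : {ae distribution P X, forall x, forall t t',
       Theta t -> Theta t' -> forall j : 'I_d,
       `|h t x j 0 - h t' x j 0| <= h0 x * enorm (t - t')})
    (hB4_psi1 : (psi1_norm P (fun w => h0 (X w)) <= c4%:E)%E)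
    (* (B5) *)
    (xi : 'I_n -> Omega -> 'cV[R]_d)
    (hxi : forall i w, xi i w = h theta_star (Xs i w))
    (Sigma : 'M[R]_d)
    (hSigma : forall i, Sigma = expectation_mx P (fun w => xi i w *m (xi i w)^T))
    (hB5_eig : lambda2 <= lambda_min Sigma)
    (hB5_psi1 : forall i, (psi1_norm_vec P (xi i) <= c5%:E)%E)
    (* a standard Gaussian vector, possibly on another probability space *)
    (dZ : measure_display) (OmegaZ : measurableType dZ)
    (PZ : probability OmegaZ R) (Z : 'I_d -> {RV PZ >-> R})
    (hZ : std_normal_vec Z),
  (convex_distance P PZ
     (fun w => Num.sqrt n%:R *:
        (inv_sqrtmx Sigma *m dPsi0 *m (hat_theta w - theta_star)))
     (rvec Z)
   <= C%:E * (ediam Theta + 1) ^+ 2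
      * (d%:R ^+ 4 * (Num.sqrt n%:R)^-1 * ln n%:R)%:E)%E.
Proof.
pose beta d : R := (d%:R * (2 * c5) / Num.sqrt lambda2) ^+ 3 * 54.
have [K hK] : exists K : nat -> R, forall d, (0 < d)%N -> 0 <= K d /\
    forall N nu : probability 'cV[R]_d R, std_gaussian N -> isotropic3 nu ->
    moment3 nu <= beta d -> forall n A, convexv A -> openv A ->
    walk_dist N nu n A <= K d / Num.sqrt n.+1%:R.
  (* The Berry-Esseen constant depends on d; a choice function collects one for each dimension
     before d is fixed. *)
  have /choice[K hK] : forall d, exists Kd : R, (0 < d)%N -> 0 <= Kd /\
      forall N nu : probability 'cV[R]_d R, std_gaussian N -> isotropic3 nu ->
      moment3 nu <= beta d -> forall n A, convexv A -> openv A ->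
      walk_dist N nu n A <= Kd / Num.sqrt n.+1%:R.
    move=> d; have [->|d0] := posnP d; first by exists 0.
    by have [Kd Kd0 be] := berry_esseen (beta d) d0; exists Kd.
  by exists K.
pose Cd d := @distance_const R d (2 * c4) (2 * c5) c1 mu lambda2 (K d).
(* By [dimension_le] only dimensions d <= m can occur, so a finite sum dominates every relevant
   constant. *)
pose m := Num.truncn (8 * (2 * c5) ^+ 2 / lambda2).
exists (1 + \sum_(d < m.+1) `|Cd d|); first by rewrite ltr_pwDl// sumr_ge0.
move=> d n hd hn dO dE Omega E P X Xs hX Theta h hh hat_theta theta_star hhat_meas
  hhat_in hhat hstar_in hstar dPsi0 hdPsi0 hB1_mono hB1_diff hB1_eig h0 h0_meas h0_ge0
  hB4_lip hB4_psi1 xi hxi Sigma hSigma hB5_eig hB5_psi1 dZ OmegaZ PZ Z hZ.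
have [N [mN QN sN]] := hB4_lip.
have lipN x : ~ N x -> forall t t', Theta t -> Theta t' -> forall j : 'I_d,
    `|h t x j 0 - h t' x j 0| <= h0 x * enorm (t - t').
  by move=> Nx; apply: contrapT => nlip; apply: Nx; exact: sN.
have [K0 be] := hK d hd.
have dim := dimension_le hc5 hlambda2 hn hX hh hstar_in hxi hSigma hB5_eig hB5_psi1 mN QN.
have := convex_distance_bound hc1 hc4 hc5 hlambda2 hmu hd hn hX hh hhat_in hhat hstar_in
  hstar hB1_mono hB1_diff h0_meas h0_ge0 hB4_psi1 hxi hSigma hB5_eig hB5_psi1 mN QN lipN
  hZ K0 be.
move/le_trans; apply.
have CdC : Cd d <= 1 + \sum_(k < m.+1) `|Cd k|.
  have dm : (d < m.+1)%N.
    have e0 : 0 <= 8 * (2 * c5) ^+ 2 / lambda2.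
      by rewrite divr_ge0 ?(ltW hlambda2)// mulr_ge0// sqr_ge0.
    have /andP[_ mlt] := Num.Theory.truncn_itv e0.
    rewrite -(ltr_nat R); apply: le_lt_trans mlt.
    by rewrite ler_pdivlMr// mulrC.
  rewrite (bigD1 (Ordinal dm))//=; have := ler_norm (Cd d).
  have : 0 <= \sum_(i < m.+1 | i != Ordinal dm) `|Cd i| by exact: sumr_ge0.
  lra.
have C2 : 2 <= Cd d.
  by apply: distance_const_ge2 => //; rewrite mulr_gt0.
have D2 : (0 <= (ediam Theta + 1) ^+ 2)%E by exact: sqre_ge0.
have X0 : 0 <= (Num.sqrt n%:R)^-1 * ln n%:R :> R.
  by rewrite mulr_ge0 ?invr_ge0 ?sqrtr_ge0// ln_ge0// ler1n ltnW.
apply: lee_pmul.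
- by rewrite mule_ge0// lee_fin; apply: le_trans C2.
- by rewrite lee_fin.
- by rewrite lee_wpmul2r// lee_fin.
(* The dimension is already paid for by the constant; the factor d^4 is at least 1 and only enlarges
   the bound. *)
rewrite lee_fin -mulrA; apply: ler_peMl => //.
by rewrite exprn_ege1// ler1n.
Qed.
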